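(* Let $n>2$ be an integer with $n\not\equiv 2\bmod 4$, let $K=\mathbb{Q}(\xi_n)$, $d=\varphi(n)$, and let $k\geqslant 2$ be an integer. The topological entropy $h_{\mathrm{top}}$ of the topological dynamical system $(\mathbb{X}_k,\mathbb{Z}^d)$ agrees with the patch counting entropy $h_{\mathrm{pc}}$ of $V'_k$; that is, \[ h_{\mathrm{top}}\,=\,h_{\mathrm{pc}}\,=\,\log(2)/\zeta_K(k). \]
   Context: $\xi_n$ is a primitive $n$-th root of unity, $\varphi$ is Euler's totient function, $\mathcal{O}_n=\mathbb{Z}[\xi_n]$ is the ring of integers of $K$, and $\zeta_K$ is the Dedekind zeta function of $K$. A non-zero $x\in\mathcal{O}_n$ is $k$-free if the principal ideal $(x)$ is not divisible by the $k$-th power of any (non-zero) prime ideal of $\mathcal{O}_n$; $0$ is not $k$-free. Set \[V'_k=\Bigl\{(m_1,\dots,m_d)\in\mathbb{Z}^d:\textstyle\sum_{i=1}^d m_i\xi_n^{i-1}\text{ is }k\text{-free in }\mathcal{O}_n\Bigr\}.\] Subsets of $\mathbb{Z}^d$ are identified with elements of $\{0,1\}^{\mathbb{Z}^d}$ (product topology) via characteristic functions, and $\mathbb{X}_k=\overline{\{t+V'_k:t\in\mathbb{Z}^d\}}$, with $\mathbb{Z}^d$ acting by translations. A patch of $V'_k$ of radius $r>0$ is a set $V'_k\cap B_r(z)$ with $z\in\mathbb{Z}^d$, where $B_r(z)$ is the ball of radius $r$ around $z$ in $\mathbb{R}^d$; patches are counted up to translation, i.e. $\#_r$ is the number of distinct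 sets $(V'_k-z)\cap B_r(0)$, $z\in\mathbb{Z}^d$. The patch counting entropy is $h_{\mathrm{pc}}=\lim_{r\to\infty}\log(\#_r)/\mathrm{vol}(B_r)$. Here $\log$ is the natural logarithm. *)

(* Defs.v *)
From HB Require Import structures.
From mathcomp Require Import all_boot all_order all_algebra all_field.
From mathcomp Require Import finmap.
From mathcomp Require Import all_classical all_reals all_analysis.

Set Implicit Arguments.
Unset Strict Implicit.
Unset Printing Implicit Defensive.

Import Order.TTheory GRing.Theory Num.Theory.
Import numFieldNormedType.Exports.

Local Open Scope classical_set_scope.
Local Open Scope ring_scope.

(* [O] stands for a subring of [K], so that ideals are closed under opposite. *)

Section Ideals.
Variables (K : fieldType) (O : set K).

Definition is_ideal (I : set K) : Prop :=
  [/\ I `<=` O, I 0, (forall x y, I x -> I y -> I (x + y))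
    & (forall a x, O a -> I x -> I (a * x))].

Definition nonzero_ideal (I : set K) : Prop := is_ideal I /\ I <> [set 0].

Definition prime_ideal (P : set K) : Prop :=
  [/\ is_ideal P, P <> O
    & forall x y, O x -> O y -> P (x * y) -> P x \/ P y].

Definition principal_ideal (x : K) : set K := [set a * x | a in O].

Definition ideal_mul (I J : set K) : set K :=
  [set x | exists s : seq (K * K),
     (forall p, p \in s -> I p.1 /\ J p.2) /\ x = \sum_(p <- s) p.1 * p.2].

Definition ideal_exp (I : set K) (k : nat) : set K := iter k (ideal_mul I) O.

Definition ideal_dvd (I J : set K) : Prop :=
  exists2 Q, is_ideal Q & J = ideal_mul I Q.

(* The index [#|O / I|]; [fset_set] makes it 0 when there are infinitely many
   cosets. *)
Definition ideal_norm (I : set K) : nat :=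
  #|` fset_set [set [set x + y | y in I] | x in O]|.

Definition kfree (k : nat) (x : K) : Prop :=
  [/\ O x, x != 0
    & forall P, prime_ideal P -> P <> [set 0] ->
        ~ ideal_dvd (ideal_exp P k) (principal_ideal x)].

End Ideals.

Definition ring_of_integers (K : fieldExtType rat) : set K :=
  [set x | integralOver (intr : int -> K) x].

(* The Dirichlet series defining the Dedekind zeta function, for real [s > 1]
   (where it converges). *)
Definition dedekind_zeta (R : realType) (K : fieldExtType rat) (s : R) : R :=
  fine (\esum_(I in nonzero_ideal (@ring_of_integers K))
          ((ideal_norm (@ring_of_integers K) I)%:R `^ (- s))%:E)%E.

Definition int_adjoin (K : fieldExtType rat) (x : K) : set K :=
  [set (map_poly intr p).[x] | p in [set: {poly int}]].

(* Coordinates are indexed from 0, hence the exponent [i] instead of [i - 1]. *)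
Definition kfree_points (K : fieldExtType rat) (xi : K) (d k : nat) :
    set 'rV[int]_d :=
  [set m | kfree (int_adjoin xi) k (\sum_(i < d) (m 0 i)%:~R * xi ^+ i)].
Arguments kfree_points [K] xi d k _.

Definition shift_space (d : nat) := prod_topology (fun _ : 'rV[int]_d => bool).

Definition char_fun (d : nat) (V : set 'rV[int]_d) : shift_space d :=
  fun m => m \in V.

(* On characteristic functions this is [V |-> t + V]. *)
Definition translate (d : nat) (t : 'rV[int]_d) (w : shift_space d) :
    shift_space d :=
  fun m => w (m - t).

Definition hull (d : nat) (V : set 'rV[int]_d) : set (shift_space d) :=
  closure [set translate t (char_fun V) | t in [set: 'rV[int]_d]].

(* Adler-Konheim-McAndrew entropy of a [Z^d]-action on an invariant compact
   subset [X] of [T]. The open covers of [X] are given by families of open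
   subsets of [T]; taking traces on [X] does not change subcover numbers. *)
Section TopologicalEntropy.
Variables (R : realType) (d : nat) (T : topologicalType) (X : set T).
Variable act : 'rV[int]_d -> T -> T.

Definition open_cover (U : set (set T)) : Prop :=
  (forall A, U A -> open A) /\ X `<=` \bigcup_(A in U) A.

Definition min_subcover (U : set (set T)) : R :=
  inf [set #|` F|%:R | F in [set F : {fset (set T)} |
         [set` F] `<=` U /\ X `<=` \bigcup_(A in [set` F]) A]].

Definition cube (N : nat) : set 'rV[int]_d :=
  [set t | forall i, 0 <= t 0 i < N%:Z].

(* The common refinement of the covers [t^-1 U] for [t] in [F]. *)
Definition cover_join (F : set 'rV[int]_d) (U : set (set T)) : set (set T) :=
  [set \bigcap_(t in F) (act t @^-1` A t) |
     A in [set A : 'rV[int]_d -> set T | forall t, U (A t)]].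

(* The limit exists by subadditivity, so it is the limit superior. *)
Definition cover_entropy (U : set (set T)) : \bar R :=
  limn_esup (fun N : nat =>
    (ln (min_subcover (cover_join (cube N) U)) / N%:R ^+ d)%:E).

Definition topological_entropy : \bar R :=
  ereal_sup [set cover_entropy U | U in open_cover].

End TopologicalEntropy.

Section PatchCounting.
Variable R : realType.

Definition euclidean_ball (d : nat) (r : R) : set 'rV[R]_d :=
  [set x | 0 < r /\ \sum_(i < d) x 0 i ^+ 2 < r ^+ 2].

Fixpoint iterated_integral (d : nat) : ('rV[R]_d -> \bar R) -> \bar R :=
  match d with
  | 0 => fun f => f 0
  | d'.+1 => fun f =>
      (\int[lebesgue_measure]_(x in [set: R])
         iterated_integral
           (fun v : 'rV[R]_d' => f (row_mx (const_mx x : 'rV[R]_1) v)))%E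
  end.

(* [d]-dimensional Lebesgue measure, as the integral of an indicator function
   computed coordinate by coordinate. *)
Definition volume (d : nat) (A : set 'rV[R]_d) : R :=
  fine (iterated_integral (fun x => (\1_A x)%:E)).

Definition patch_at (d : nat) (V : set 'rV[int]_d) (r : R) (z : 'rV[int]_d) :
    set 'rV[int]_d :=
  [set m | V (m + z) /\ euclidean_ball r (map_mx intr m)].

Definition patch_number (d : nat) (V : set 'rV[int]_d) (r : R) : nat :=
  #|` fset_set [set patch_at V r z | z in [set: 'rV[int]_d]]|.

Definition patch_rate (d : nat) (V : set 'rV[int]_d) (r : R) : R :=
  ln (patch_number V r)%:R / volume (@euclidean_ball d r).

Definition patch_entropy (d : nat) (V : set 'rV[int]_d) : R :=
  lim (patch_rate V r @[r --> +oo]).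

End PatchCounting.

(* Main.v *)
(* Let O = Z[xi], identified with Z^d. A sieve over the finitely many prime ideals
   in S replaces V'_k by a set that is periodic modulo the product of the P^k, P in
   S, with density the product over S of 1 - N(P)^-k; by the Euler product this
   density tends to 1 / zeta_K(k) as S grows. Counting subsets of this periodic set
   in a window F bounds the number of patches above by C_S 2^(density * #F + o(#F)).
   Conversely, the Chinese remainder theorem and a count of the multiples of P^k in
   large boxes show that every subset of the patch of V'_k at the origin is again a
   patch, which gives the matching lower bound. Patches on cubes compute the
   topological entropy, patches on balls the patch counting entropy.

   The arithmetic rests on one fact: every rational prime l divides a power of some
   pi in O, with l in pi O, such that y^q = y mod pi for all y and some power q of l.
   It makes O / pi O reduced, so that O is integrally closed, and gives inverses of
   the prime ideals containing pi. *)
Require Import Defs.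
From mathcomp Require Import all_boot all_order all_algebra all_field.
From mathcomp Require Import finmap.
From mathcomp Require Import all_classical all_reals all_analysis.
From mathcomp Require cyclic.
From mathcomp Require Import measurable_realfun.
From mathcomp Require Import zify ring lra.

Set Implicit Arguments.
Unset Strict Implicit.
Unset Printing Implicit Defensive.

Import Order.TTheory GRing.Theory Num.Theory.
Import numFieldNormedType.Exports.

Local Open Scope classical_set_scope.
Local Open Scope ring_scope.

(** * Transversals and indices of subgroups *)

(** Sizes are measured by coordinates alone: no embeddings, no field norm, no Minkowski theory. Two
    opposite estimates carry the arithmetic. A nonzero vector of an ideal in the box of radius B
    forces the index to be O(B^d), by division with remainder; and by the pigeonhole principle an
    ideal of index q has a nonzero vector of size at most q^(1/d). Together they bound the number of
    ideals of index at most X by O(X). Hence the zeta sum converges for k >= 2, and finite sets of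
    primes with small tails exist. The obstacle is the infinitely many primes outside S. Nonzero
    vectors in a box of radius L see only those with N(P)^k = O(L^d), but each one costs, besides
    its density, a rounding error of order 1. As k >= 2, the number of such primes is O(L^(d/2)), so
    that these errors are negligible even against a fixed residue class. This is what lets the
    Chinese remainder theorem prescribe a patch exactly, and not only up to a small proportion of
    its points. *)

Section Transversals.
Variable V : zmodType.
Implicit Types (G H : set V) (s t : seq V).

Definition subgroup H := H 0 /\ forall x y, H x -> H y -> H (x - y).

Definition separated H s :=
  uniq s /\ forall r r', r \in s -> r' \in s -> H (r - r') -> r = r'.

Definition covers G H s :=
  forall x, G x -> exists2 r, r \in s & H (x - r).

Definition transversal G H s :=
  [/\ [set` s] `<=` G, separated H s & covers G H s].

(** A relation witnessed by a finite list of representatives: finiteness of the index is part of it,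
    whereas [ideal_norm] is 0 on an infinite quotient. *)
Definition has_index G H n := exists2 s, transversal G H s & size s = n.

Lemma subgroupB H x y : subgroup H -> H x -> H y -> H (x - y).
Proof. by case=> _; apply. Qed.

Lemma subgroupN H x : subgroup H -> H x -> H (- x).
Proof. by move=> [h0 hB] hx; rewrite -sub0r; apply: hB. Qed.

Lemma subgroupD H x y : subgroup H -> H x -> H y -> H (x + y).
Proof.
by move=> hH hx hy; rewrite -[y]opprK; apply: hH.2 => //; apply: subgroupN.
Qed.

Lemma subgroup_swap H x y : subgroup H -> H (x - y) -> H (y - x).
Proof. by move=> hH hx; rewrite -opprB; apply: subgroupN. Qed.

Lemma subgroup_trans H x y z : subgroup H -> H (x - y) -> H (y - z) -> H (x - z).
Proof. by move=> hH h1 h2; rewrite -(subrK y x) -addrA; apply: subgroupD. Qed.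

Lemma subgroupMn H x n : subgroup H -> H x -> H (x *+ n).
Proof.
move=> hH hx; elim: n => [|n ih]; first by rewrite mulr0n; apply: hH.1.
by rewrite mulrS; apply: subgroupD.
Qed.

Lemma subgroupMz H x (n : int) : subgroup H -> H x -> H (x *~ n).
Proof.
move=> hH hx; case: n => n; first exact: subgroupMn.
by rewrite NegzE mulrNz; apply: subgroupN => //; apply: subgroupMn.
Qed.

Lemma subgroup_sum H (I : Type) (r : seq I) (P : pred I) (F : I -> V) :
  subgroup H -> (forall i, P i -> H (F i)) -> H (\sum_(i <- r | P i) F i).
Proof.
move=> hH hF; elim/big_ind: _ => //; first exact: hH.1.
by move=> x y; apply: subgroupD.
Qed.

(** Sending [r] to the first element of [t] congruent to it is injective on a separated list and
    keeps [W], which depends only on the class modulo [H]. For constant [W] this bounds sizes; in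
    general it makes the number of classes in [W] independent of the transversal. *)
Lemma count_separated G H s t (W : pred V) : subgroup H ->
  (forall x y, H (x - y) -> W x -> W y) ->
  [set` s] `<=` G -> separated H s -> covers G H t ->
  (count W s <= count W t)%N.
Proof.
move=> hH hW sG [us hs] ht.
pose P r := [pred r' | `[< H (r - r') >]].
pose f r := nth 0 t (find (P r) t).
have fP r : r \in s -> f r \in t /\ H (r - f r).
  move=> rs; have hr : has (P r) t.
    by have [r' r't hr'] := ht _ (sG _ rs); apply/hasP; exists r' => //; apply/asboolP.
  split; first by rewrite mem_nth // -has_find.
  by have /asboolP := nth_find 0 hr.
rewrite -!size_filter -(size_map f); apply: uniq_leq_size.
  rewrite map_inj_in_uniq ?filter_uniq // => r r'.
  rewrite !mem_filter => /andP[_ rs] /andP[_ r's] fE.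
  apply: hs => //; apply: (subgroup_trans hH (fP _ rs).2).
  by rewrite fE; apply: subgroup_swap => //; apply: (fP _ r's).2.
move=> x /mapP[r]; rewrite mem_filter => /andP[Wr rs] ->.
by rewrite mem_filter (fP _ rs).1 andbT; apply: hW Wr; apply: (fP _ rs).2.
Qed.

Lemma size_separated G H s t : subgroup H ->
  [set` s] `<=` G -> separated H s -> covers G H t -> (size s <= size t)%N.
Proof. by move=> *; rewrite -!count_predT; apply: (@count_separated G H). Qed.

Lemma count_transversal G H s t (W : pred V) : subgroup H ->
  (forall x y, H (x - y) -> W x -> W y) ->
  transversal G H s -> transversal G H t -> count W s = count W t.
Proof.
move=> hH hW [sG hs cs] [tG ht ct].
by apply/eqP; rewrite eqn_leq; apply/andP; split; apply: (@count_separated G H).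
Qed.

Lemma size_transversal G H s t : subgroup H ->
  transversal G H s -> transversal G H t -> size s = size t.
Proof. by move=> *; rewrite -!count_predT; apply: (@count_transversal G H). Qed.

Lemma has_index_uniq G H m n : subgroup H ->
  has_index G H m -> has_index G H n -> m = n.
Proof. by move=> hH [s hs <-] [t ht <-]; apply: (@size_transversal G H). Qed.

Lemma separated_cons H x s : subgroup H -> separated H s ->
  (forall r, r \in s -> ~ H (x - r)) -> separated H (x :: s).
Proof.
move=> hH [us hs] hx; split.
  by rewrite /= us andbT; apply/negP => /hx; rewrite subrr; apply; apply: hH.1.
move=> r r'; rewrite !inE => /predU1P[->|rs] /predU1P[->|r's] //.
- by move/(hx _ r's).
- by move/(subgroup_swap hH)/(hx _ rs).
- exact: hs.
Qed.

Lemma covers_transversal G H s : subgroup H -> [set` s] `<=` G ->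
  covers G H s -> exists2 t, transversal G H t & (size t <= size s)%N.
Proof.
move=> hH sG cs.
have [t [ts st ct] szt] : exists2 t, [/\ {subset t <= s}, separated H t &
    (forall x, x \in s -> exists2 r, r \in t & H (x - r))] &
    (size t <= size s)%N.
  elim: s {sG cs} => [|x s [t [ts st ct] szt]]; first by exists [::].
  have [[r rt hr]|hn] := pselect (exists2 r, r \in t & H (x - r)).
    exists t; last exact: leq_trans szt _.
    split => //; first by move=> y yt; rewrite inE ts ?orbT.
    by move=> y; rewrite inE => /predU1P[->|/ct//]; exists r.
  exists (x :: t) => //; split.
  - by move=> y; rewrite !inE => /predU1P[->|/ts ->]; rewrite ?eqxx ?orbT.
  - by apply: separated_cons => // r rt hr; apply: hn; exists r.
  - move=> y; rewrite inE => /predU1P[->|/ct[r rt hr]].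
      by exists x; rewrite ?inE ?eqxx// subrr; apply: hH.1.
    by exists r => //; rewrite inE rt orbT.
exists t => //; split => // [y /ts/sG //|x /cs [r /ct[r' r't h'] h]].
by exists r' => //; apply: subgroup_trans h h'.
Qed.

(** An uncovered [x] could be prepended to [t], giving a separated list longer than the transversal
    [s]. This is how an injective map on a finite quotient is seen to be surjective. *)
Lemma separated_covers G H s t : subgroup H -> subgroup G ->
  transversal G H s -> [set` t] `<=` G -> separated H t -> size t = size s ->
  covers G H t.
Proof.
move=> hH hG [sG hs cs] tG ht szt x Gx; apply: contrapT => hn.
have : (size (x :: t) <= size s)%N.
  apply: (@size_separated G H) => //.
    by move=> y /=; rewrite inE => /predU1P[->|/tG].
  by apply: separated_cons => // r rt hr; apply: hn; exists r.
by rewrite /= szt ltnn.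
Qed.

Lemma has_index_tower G G' H m n : subgroup G -> subgroup G' -> subgroup H ->
  G' `<=` G -> H `<=` G' ->
  has_index G G' m -> has_index G' H n -> has_index G H (m * n)%N.
Proof.
move=> hG hG' hH sG' sH [s [sG [us hs] cs] <-] [t [tG [ut ht] ct] <-].
exists [seq x + y | x <- s, y <- t]; last by rewrite size_allpairs.
have key x y x' y' : x \in s -> x' \in s -> y \in t -> y' \in t ->
    H ((x + y) - (x' + y')) -> x = x' /\ y = y'.
  move=> xs x's yt y't; rewrite opprD addrACA => h.
  have xx' : x = x'.
    apply: hs => //; rewrite -[x - x'](addrK (y - y')).
    by apply: subgroupB => //; [apply: sH|apply: subgroupB => //; apply: tG].
  by split=> //; apply: ht => //; move: h; rewrite xx' subrr add0r.
split.
- move=> _ /allpairsP[[x y] /= [xs yt ->]].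
  by apply: subgroupD => //; first [exact: sG | exact/sG'/tG].
- split.
    apply: allpairs_uniq => // -[x y] [x' y'].
    move=> /allpairsP[[x1 y1] /= [xs yt [? ?]]] /allpairsP[[x2 y2] /= [xs' yt' [? ?]]].
    subst x1 y1 x2 y2 => e.
    have h : H ((x + y) - (x' + y')) by rewrite /= in e; rewrite e subrr; apply: hH.1.
    by have [-> ->] := key _ _ _ _ xs xs' yt yt' h.
  move=> _ _ /allpairsP[[x1 y1] /= [xs yt ->]] /allpairsP[[x2 y2] /= [xs' yt' ->]] h.
  by have [-> ->] := key _ _ _ _ xs xs' yt yt' h.
- move=> x Gx; have [r rs hr] := cs x Gx; have [r' rt' hr'] := ct _ hr.
  exists (r + r'); first by apply/allpairsP; exists (r, r').
  by rewrite opprD addrA.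
Qed.

Lemma has_index_gt0 G H n : G 0 -> has_index G H n -> (0 < n)%N.
Proof. by move=> G0 [s [_ _ cs] <-]; case: s cs => // /(_ _ G0)[]. Qed.

Lemma leq_has_index G H H' m n : subgroup H -> subgroup H' -> H `<=` H' ->
  has_index G H m -> has_index G H' n -> (n <= m)%N.
Proof.
move=> hH hH' sH [s [sG hs cs] <-] [t [tG ht ct] <-].
apply: (@size_separated G H') => // x Gx.
by have [r rs hr] := cs x Gx; exists r => //; apply: sH.
Qed.

(** The transversal [t] modulo [H'] stays separated modulo the smaller [H] after adding [r0 + a],
    where [r0] represents 0 and [a] lies in [H'] but not in [H]. This drives the inductions on the
    index. *)
Lemma has_index_strict G H H' m n : subgroup G -> subgroup H -> subgroup H' ->
  H `<=` H' -> H' `<=` G -> ~ H' `<=` H ->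
  has_index G H m -> has_index G H' n -> (n < m)%N.
Proof.
move=> hG hH hH' sH sH' nH [s [sG hs cs] <-] [t [tG ht ct] <-].
have /existsNP[a /not_implyP[H'a nHa]] := nH.
have ct0 := ct 0 hG.1; have [r0 r0t hr0] := ct0.
pose b := r0 + a; have : (size (b :: t) <= size s)%N; last by [].
apply: (@size_separated G H) => //.
  move=> y /=; rewrite inE => /predU1P[->|/tG//].
  by apply: subgroupD => //; first [exact: tG | exact: sH'].
have ht' : separated H t.
  by split; [exact: ht.1|move=> r r' rt rt' h; apply: ht.2 => //; apply: sH].
apply: separated_cons => // r rt h.
have r0r : r0 = r.
  apply: ht.2 => //; rewrite -[r0 - r](addrK a).
  by apply: hH'.2 => //; rewrite addrAC; apply: sH.
by apply: nHa; move: h; rewrite /b r0r addrAC subrr add0r.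
Qed.

End Transversals.

Lemma ideal_normE (K : fieldType) (G H : set K) n : subgroup H ->
  has_index G H n -> ideal_norm G H = n.
Proof.
move=> hH [s [sG [us hs] cs] <-].
pose f (x : K) : set K := [set x + y | y in H].
have fE x x' : H (x - x') -> f x = f x'.
  move=> h; apply/seteqP; split => _ [y Hy <-].
    exists (x - x' + y); first exact: subgroupD.
    by rewrite addrA addrC -[x' + _]addrC subrK addrC.
  exists (x' - x + y); first by apply: subgroupD => //; apply: subgroup_swap.
  by rewrite addrA addrC -[x + _]addrC subrK addrC.
rewrite /ideal_norm; have -> : [set [set x + y | y in H] | x in G] =
    [set` [fset x in map f s]%fset].
  apply/seteqP; split=> [_ [x Gx <-]|X] /=.
    have [r rs hr] := cs x Gx; rewrite -/(f x) (fE _ _ hr) inE.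
    by apply/mapP; exists r.
  by rewrite inE => /mapP[r rs ->]; exists r => //; apply: sG.
rewrite set_fsetK card_fseq undup_id ?size_map// map_inj_in_uniq// => r r' rs r's e.
have : f r r by exists 0; [apply: hH.1|rewrite addr0].
rewrite e => -[y Hy yE]; apply: hs => //.
by rewrite -yE addrAC subrr add0r.
Qed.

(** * Orders as lattices *)

Section Boxes.
Variable d : nat.
Implicit Types (v w : 'rV[int]_d).

Definition inbox (B : nat) v := forall i, (`|v 0%R i| <= B)%N.

Definition box_seq (B : nat) : seq 'rV[int]_d :=
  [seq \row_i ((f i : nat)%:Z - B%:Z) | f : {ffun 'I_d -> 'I_(B.*2.+1)}].

Lemma mem_box_seq B v : v \in box_seq B <-> inbox B v.
Proof.
split=> [/mapP[f _ ->] i|hv].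
  by rewrite mxE; case: (f i) => k hk /=; lia.
apply/mapP; exists [ffun i => inord (`|(v 0 i + B%:Z)%R|)%N]; first by rewrite mem_enum.
apply/rowP => i; by rewrite mxE ffunE inordK; have := hv i => /=; lia.
Qed.

Lemma size_box_seq B : size (box_seq B) = (B.*2.+1 ^ d)%N.
Proof. by rewrite size_map -cardE card_ffun !card_ord. Qed.

Lemma box_seq_uniq B : uniq (box_seq B).
Proof.
rewrite map_inj_uniq ?enum_uniq// => f g /rowP e; apply/ffunP => i.
have := e i; rewrite !mxE /= => h; apply/val_inj => /=; move: h.
by case: (f i) => k hk; case: (g i) => l hl /=; lia.
Qed.

Lemma inbox_le B B' v : (B <= B')%N -> inbox B v -> inbox B' v.
Proof. by move=> le hv i; apply: leq_trans le. Qed.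

Lemma inboxD B B' v w : inbox B v -> inbox B' w -> inbox (B + B') (v + w).
Proof. by move=> hv hw i; rewrite mxE; have := hv i; have := hw i => /=; lia. Qed.

Lemma inboxN B v : inbox B v -> inbox B (- v).
Proof. by move=> hv i; rewrite mxE; have := hv i => /=; lia. Qed.

Lemma inbox_sum (I : Type) (r : seq I) (B : I -> nat) (F : I -> 'rV[int]_d) :
  (forall i, inbox (B i) (F i)) -> inbox (\sum_(i <- r) B i)%N (\sum_(i <- r) F i).
Proof.
move=> hF; elim: r => [|i r ih]; first by rewrite !big_nil => j; rewrite mxE.
by rewrite !big_cons; apply: inboxD.
Qed.

Lemma inbox_scale B m v (a : int) : (`|a| <= m)%N -> inbox B v ->
  inbox (m * B) (a *: v).
Proof. by move=> ha hv i; rewrite mxE abszM leq_mul. Qed.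

Lemma inbox_gt0 B v : v != 0 -> inbox B v -> (0 < B)%N.
Proof.
move=> v0; case: B => // hv; case/eqP: v0; apply/rowP => i.
by have := hv i; rewrite mxE /=; lia.
Qed.

Lemma inbox_ex v : exists2 B, (0 < B)%N & inbox B v.
Proof.
exists (\sum_i `|v 0%R i|%N).+1 => // i; apply: leqW.
by rewrite (bigD1 i)//= leq_addr.
Qed.

End Boxes.

(** All that the counting needs of [Z[xi]]: a ring with integer coordinates, from which sizes are
    read off. [order_frac] lets quotients be written with integer denominators, so that they can be
    rounded coordinatewise. *)
Record is_order (K : fieldType) (d : nat) (phi : 'rV[int]_d -> K) : Prop := IsOrder {
  orderB : forall u v, phi (u - v) = phi u - phi v;
  order_inj : injective phi;
  order1 : exists u, phi u = 1;
  orderM : forall u v, exists w, phi w = phi u * phi v;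
  order_frac : forall x, exists m v, (0 < m)%N /\ x *+ m = phi v }.

Section Order.
Variables (K : fieldType) (d : nat) (phi : 'rV[int]_d -> K).
Hypothesis phiP : is_order phi.
Local Notation O := (range phi).
Implicit Types (I J : set K) (v w : 'rV[int]_d).

Lemma order0E : phi 0 = 0.
Proof. by rewrite -(subrr 0) (orderB phiP) subrr. Qed.

Lemma orderN v : phi (- v) = - phi v.
Proof. by rewrite -sub0r (orderB phiP) order0E sub0r. Qed.

Lemma orderD v w : phi (v + w) = phi v + phi w.
Proof. by rewrite -[w in LHS]opprK (orderB phiP) orderN opprK. Qed.

Lemma order_sum (I : Type) (r : seq I) (F : I -> 'rV[int]_d) :
  phi (\sum_(i <- r) F i) = \sum_(i <- r) phi (F i).
Proof. by rewrite (big_morph phi orderD order0E). Qed.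

Lemma orderMn v n : phi (v *+ n) = phi v *+ n.
Proof. by elim: n => [|n ih]; rewrite ?mulr0n ?order0E// !mulrS orderD ih. Qed.

Lemma orderMz v (n : int) : phi (v *~ n) = phi v *~ n.
Proof. by case: n => n; rewrite ?NegzE ?mulrNz ?orderN ?orderMn. Qed.

Lemma orderZ v (n : int) : phi (n *: v) = phi v *~ n.
Proof. by rewrite -[n in LHS]intz scaler_int orderMz. Qed.

Lemma order_eq0 v : (phi v == 0) = (v == 0).
Proof. by rewrite -order0E (inj_eq (order_inj phiP)). Qed.

Lemma orderE v : phi v = \sum_i phi (delta_mx 0 i) *~ v 0 i.
Proof.
by rewrite [in LHS](row_sum_delta v) order_sum; apply: eq_bigr => i _; rewrite orderZ.
Qed.

Lemma O_in v : O (phi v). Proof. by exists v. Qed.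
Hint Resolve O_in : core.

Lemma O_subgroup : subgroup O.
Proof.
split; first by rewrite -order0E.
by move=> _ _ [u _ <-] [v _ <-]; rewrite -(orderB phiP).
Qed.

Lemma O1 : O 1. Proof. by have [u <-] := order1 phiP. Qed.

Lemma OM x y : O x -> O y -> O (x * y).
Proof. by move=> [u _ <-] [v _ <-]; have [w <-] := orderM phiP u v. Qed.

Lemma OD x y : O x -> O y -> O (x + y).
Proof. by apply: subgroupD O_subgroup. Qed.

Lemma ON x : O x -> O (- x).
Proof. by apply: subgroupN O_subgroup. Qed.

Lemma OB x y : O x -> O y -> O (x - y).
Proof. by apply: subgroupB O_subgroup. Qed.

Lemma On n : O n%:R.
Proof. by apply: subgroupMn O_subgroup O1. Qed.

Lemma OX x n : O x -> O (x ^+ n).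
Proof.
by move=> hx; elim: n => [|n ih]; rewrite ?expr0 ?exprS; [apply: O1|apply: OM].
Qed.

Lemma order_dim_gt0 : (0 < d)%N.
Proof.
rewrite lt0n; apply/eqP => d0.
have [u hu] := order1 phiP; have u0 : u = 0.
  by apply/rowP => i; have := ltn_ord i; rewrite {2}d0.
by have := oner_eq0 K; rewrite -hu order_eq0 u0 eqxx.
Qed.

Lemma natr_order_neq0 n : (0 < n)%N -> (n%:R : K) != 0.
Proof.
move=> n0; have [u hu] := order1 phiP; rewrite -hu -orderMn order_eq0.
have u0 : u != 0 by rewrite -order_eq0 hu oner_eq0.
apply: contra_neq u0 => /rowP h; apply/rowP => i.
by have /eqP := h i; rewrite mulmxnE mxE mulrn_eq0 gtn_eqF//= => /eqP.
Qed.

Lemma ideal_subgroup I : is_ideal O I -> subgroup I.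
Proof.
move=> [IO I0 ID IM]; split=> // x y Ix Iy; apply: ID => //.
by rewrite -mulN1r; apply: IM => //; apply: ON O1.
Qed.

Lemma principal_is_ideal x : O x -> is_ideal O (principal_ideal O x).
Proof.
move=> Ox; split.
- by move=> _ [a Oa <-]; apply: OM.
- by exists 0; rewrite ?mul0r//; apply: O_subgroup.1.
- by move=> _ _ [a Oa <-] [b Ob <-]; exists (a + b); rewrite ?mulrDl//; apply: OD.
- by move=> a _ Oa [b Ob <-]; exists (a * b); rewrite ?mulrA//; apply: OM.
Qed.

Lemma O_is_ideal : is_ideal O O.
Proof.
by split => //; [apply: O_subgroup.1|move=> x y; apply: OD|move=> x y; apply: OM].
Qed.

(** Multiplication is bilinear, so [C] comes from the coordinates of the products of basis vectors.
    This inequality takes the place of absolute values. *)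
Lemma mul_bound : exists2 C, (0 < C)%N & forall u v w B m,
  phi w = phi u * phi v -> inbox B u -> inbox m v -> inbox (C * B * m) w.
Proof.
have /choice[f hf] : forall ij : 'I_d * 'I_d, exists w,
    phi w = phi (delta_mx 0 ij.1) * phi (delta_mx 0 ij.2).
  by move=> ij; apply: orderM.
have /choice[c hc] : forall ij, exists B, inbox B (f ij).
  by move=> ij; have [B _ hB] := inbox_ex (f ij); exists B.
exists (\sum_i \sum_j c (i, j)).+1%N => // u v w B m wE hu hv.
have -> : w = \sum_i \sum_j (u 0 i * v 0 j) *: f (i, j).
  apply: (order_inj phiP); rewrite wE !order_sum (orderE u) mulr_suml.
  apply: eq_bigr => i _; rewrite order_sum (orderE v) mulr_sumr.
  by apply: eq_bigr => j _; rewrite orderZ hf/= mulrzAl mulrzAr -mulrzA [X in _ *~ X]mulrC.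
apply: (@inbox_le _ (\sum_i \sum_j (B * m) * c (i, j)))%N.
  under eq_bigr do rewrite -big_distrr/=.
  by rewrite -big_distrr/= mulnC -mulnA leq_mul.
apply: inbox_sum => i; apply: inbox_sum => j; apply: inbox_scale => //.
by rewrite abszM leq_mul.
Qed.

(** Division with remainder by [phi v]: write [y / phi v] as [phi a / m] and reduce the coordinates
    of [a] modulo [m]. The remainder is [phi v * phi r / m] with [r] of size at most [m]; as
    [mul_bound] is linear in that size, [m] cancels and the bound depends on [B] only. *)
Lemma covers_principal : exists2 C, (0 < C)%N & forall B v,
  (0 < B)%N -> inbox B v -> v != 0 ->
  covers O (principal_ideal O (phi v)) (map phi (box_seq d (C * B))).
Proof.
have [C C0 hC] := mul_bound; exists C => // B v B0 hv v0 y Oy.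
have pv0 : phi v != 0 by rewrite order_eq0.
have [m [a [m0 aE]]] := order_frac phiP (y / phi v).
pose q := \row_i (a 0%R i %/ m)%Z; pose r := \row_i (a 0%R i %% m)%Z.
have aqr : a = q *+ m + r.
  apply/rowP => i; rewrite mxE mulmxnE !mxE.
  by rewrite [LHS](divz_eq _ m) -[_ *+ m]mulr_natr natz.
have [w _ wE] : O (y - phi v * phi q) by apply: OB => //; apply: OM.
exists (phi w); last first.
  by exists (phi q); rewrite // wE opprB addrC subrK mulrC.
apply: map_f; apply/mem_box_seq.
have h : phi (w *+ m) = phi v * phi r.
  rewrite orderMn wE mulrnBl -[y](divfK pv0) mulrC -mulrnAr aE.
  by rewrite -mulrnAr -mulrBr -orderMn -(orderB phiP) aqr addrC addKr.
have hr : inbox m r.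
  move=> i; rewrite mxE; have := @ltz_mod (a 0 i) m; have := @modz_ge0 (a 0 i) m.
  lia.
have := hC _ _ _ _ _ h hv hr => hw i; have := hw i.
by rewrite mulmxnE -mulr_natr natz abszM absz_nat leq_pmul2r.
Qed.

(** [I] contains the multiples of [phi v], so the box of remainders modulo [phi v] also covers [O]
    modulo [I]; its [(2 * C * B + 1) ^ d] points are at most [(3 * C * B) ^ d]. *)
Lemma index_box : exists2 C, (0 < C)%N & forall I B v,
  is_ideal O I -> (0 < B)%N -> inbox B v -> v != 0 -> I (phi v) ->
  exists2 n, has_index O I n & (n <= C * B ^ d)%N.
Proof.
have [C C0 hC] := covers_principal; exists ((3 * C) ^ d)%N.
  by rewrite expn_gt0 muln_gt0 C0.
move=> I B v idI B0 hv v0 Iv.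
have cs : covers O I (map phi (box_seq d (C * B))).
  move=> x Ox; have [r rs [a Oa aE]] := hC _ _ B0 hv v0 x Ox; exists r => //.
  by rewrite -aE; case: idI => _ _ _; apply.
have sO : [set` map phi (box_seq d (C * B))] `<=` O by move=> _ /mapP[w _ ->].
have [t ht szt] := covers_transversal (ideal_subgroup idI) sO cs.
exists (size t); first by exists t.
apply: leq_trans szt _; rewrite size_map size_box_seq -expnMn leq_exp2r ?order_dim_gt0//.
have : (0 < C * B)%N by rewrite muln_gt0 C0.
by rewrite -mulnA; lia.
Qed.

Lemma has_index_ex I : is_ideal O I -> I <> [set 0] -> exists n, has_index O I n.
Proof.
move=> idI I0; have [v [v0 Iv]] : exists v, v != 0 /\ I (phi v).
  apply: contrapT => hn; apply: I0; apply/seteqP; split => [x Ix|_ ->]; last by case: idI.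
  have [v _ vE] : O x by case: idI => + _ _ _; apply.
  rewrite -vE; apply: contrapT => h; apply: hn; exists v; rewrite vE; split => //.
  by apply/eqP => v0; apply: h; rewrite v0 order0E.
have [C _ hC] := index_box; have [B B0 hB] := inbox_ex v.
by have [n hn _] := hC _ _ _ idI B0 hB v0 Iv; exists n.
Qed.

(** Pigeonhole: for the largest [b] with [b ^ d <= q], the cube from 0 to [b] has [b.+1 ^ d], hence
    more than [q], lattice points, and two of them agree modulo [I]. *)
Lemma small_element I q : subgroup I -> has_index O I q ->
  exists v b, [/\ v != 0, I (phi v), inbox b v & (b ^ d <= q)%N].
Proof.
move=> sI [t [tO ht ct] <-].
have ex : exists b, (size t < b.+1 ^ d)%N.
  exists (size t); apply: leq_trans (_ : (size t).+1 ^ 1 <= _)%N; first by rewrite expn1.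
  by rewrite leq_pexp2l ?order_dim_gt0.
case: (ex_minnP ex) => b hb bmin.
have hbd : (b ^ d <= size t)%N.
  case: b {hb} bmin => [|b] bmin; first by rewrite exp0n ?order_dim_gt0.
  by rewrite leqNgt; apply/negP => /bmin; rewrite ltnn.
pose s := [seq \row_i ((f i : nat)%:Z) | f : {ffun 'I_d -> 'I_(b.+1)}] : seq 'rV[int]_d.
have sbox v w : v \in s -> w \in s -> inbox b (v - w).
  move=> /mapP[f _ ->] /mapP[g _ ->] i; rewrite !mxE.
  by case: (f i) => k hk; case: (g i) => l hl /=; lia.
have us : uniq s.
  rewrite map_inj_uniq ?enum_uniq// => f g /rowP e; apply/ffunP => i.
  have := e i; rewrite !mxE /= => h; apply/val_inj => /=; move: h.
by case: (f i) => k hk; case: (g i) => l hl /=; lia.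
apply: contrapT => hn.
have : (size (map phi s) <= size t)%N.
  apply: (@size_separated _ O I) => //; first by move=> _ /mapP[w _ ->].
  split; first by rewrite map_inj_uniq//; apply: order_inj.
  move=> _ _ /mapP[v vs ->] /mapP[w ws ->]; rewrite -(orderB phiP) => h.
  apply: contrapT => vw; apply: hn; exists (v - w), b; split=> //; last exact: sbox.
  by rewrite subr_eq0; apply/eqP => e; apply: vw; rewrite e.
by rewrite size_map /s size_map -cardE card_ffun !card_ord leqNgt hb.
Qed.

End Order.

Lemma leq_expn_self b d : (0 < d)%N -> (b <= b ^ d)%N.
Proof.
by case: b => // b d0; rewrite -[X in (X <= _)%N]expn1 leq_pexp2l.
Qed.

(** * Linear bounds for ideals of bounded index and for coset points in a box *)

Section OrderCounting.
Variables (K : fieldType) (d : nat) (phi : 'rV[int]_d -> K).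
Hypothesis phiP : is_order phi.
Local Notation O := (range phi).
Implicit Types (I J : set K) (v w : 'rV[int]_d).

Lemma order_mulrn_inj x y n : (0 < n)%N -> x *+ n = y *+ n -> x = y :> K.
Proof.
move=> n0 /eqP; rewrite -subr_eq0 -mulrnBl -mulr_natr mulf_eq0.
by rewrite (negPf (natr_order_neq0 phiP n0)) orbF subr_eq0 => /eqP.
Qed.

(* Otherwise the multiples [0, y, ..., C y] would be distinct modulo [phi v] and,
   added to representatives of [O / I], give more than [C * q] classes. *)
Lemma principal_multiple C I q v b : is_ideal O I ->
  (forall J B v, is_ideal O J -> (0 < B)%N -> inbox B v -> v != 0 -> J (phi v) ->
    exists2 n, has_index O J n & (n <= C * B ^ d)%N) ->
  has_index O I q -> I (phi v) -> v != 0 -> inbox b v -> (b ^ d <= q)%N ->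
  forall y, I y -> principal_ideal O (phi v) (y *+ C`!).
Proof.
move=> idI hC hq Iv v0 hv hb y Iy.
have b0 := inbox_gt0 v0 hv.
have idv : is_ideal O (principal_ideal O (phi v)).
  by apply: principal_is_ideal => //; exists v.
have Pv : principal_ideal O (phi v) (phi v).
  by exists 1; rewrite ?mul1r//; apply: O1.
have [n hn nC] := hC _ _ _ idv b0 hv v0 Pv.
have sv := ideal_subgroup phiP idv; have sI := ideal_subgroup phiP idI.
have PI : principal_ideal O (phi v) `<=` I.
  by move=> _ [a Oa <-]; case: idI => _ _ _; apply.
suff [j /andP[j0 jC] hj] : exists2 j, (0 < j <= C)%N &
    principal_ideal O (phi v) (y *+ j).
  have /dvdnP[k ->] : (j %| C`!)%N by apply: dvdn_fact; rewrite j0.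
  by rewrite mulnC mulrnA; apply: subgroupMn.
apply: contrapT => hn'.
have [t [tO ht ct] szt] := hq; have [t' [tO' ht' ct'] szt'] := hn.
have key r r' j j' : r \in t -> r' \in t -> (j <= C)%N -> (j' <= j)%N ->
    principal_ideal O (phi v) ((r + y *+ j) - (r' + y *+ j')) -> r = r' /\ j = j'.
  move=> rt rt' jC jj'; rewrite opprD addrACA -mulrnBr// => h.
  have rr : r = r'.
    apply: ht.2 => //; rewrite -[r - r'](addrK (y *+ (j - j'))).
    by apply: subgroupB => //; [apply: PI|apply: subgroupMn].
  split => //; apply/eqP; rewrite eqn_leq jj' andbT leqNgt; apply/negP => jj.
  apply: hn'; exists (j - j')%N; first by rewrite subn_gt0 jj leq_subLR (leq_trans jC)// leq_addl.
  by move: h; rewrite rr subrr add0r.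
have key2 r r' j j' : r \in t -> r' \in t -> (j <= C)%N -> (j' <= C)%N ->
    principal_ideal O (phi v) ((r + y *+ j) - (r' + y *+ j')) -> r = r' /\ j = j'.
  move=> rt rt' jC jC' h; have [jj|jj] := leqP j' j; first exact: key h.
  have [] := key _ _ _ _ rt' rt jC' (ltnW jj); last by move=> -> ->.
  exact: subgroup_swap.
pose s := [seq r + y *+ j | r <- t, j <- iota 0 C.+1].
have hio j : j \in iota 0 C.+1 -> (j <= C)%N by rewrite mem_iota.
have : (size s <= size t')%N.
  apply: (@size_separated _ O (principal_ideal O (phi v))) => //.
    move=> _ /allpairsP[[r j] /= [rt _ ->]]; apply: (OD phiP); first exact: tO.
    by case: idI => IO _ _ _; apply: IO; apply: subgroupMn.
  split.
    apply: allpairs_uniq; [exact: ht.1|exact: iota_uniq|move=> [r j] [r' j']].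
    move=> h1 h2 e; rewrite /= in e.
    have [[r1 j1] [/= rt1 jt1 [? ?]]] := allpairsP h1; subst r1 j1.
    have [[r2 j2] [/= rt2 jt2 [? ?]]] := allpairsP h2; subst r2 j2.
    have h := sv.1; rewrite -(subrr (r + y *+ j)) {2}e in h.
    by have [-> ->] := key2 _ _ _ _ rt1 rt2 (hio _ jt1) (hio _ jt2) h.
  move=> _ _ /allpairsP[[r j] /= [r1 j1 ->]] /allpairsP[[r' j'] /= [r2 j2 ->]] h.
  by have [-> ->] := key2 _ _ _ _ r1 r2 (hio _ j1) (hio _ j2) h.
rewrite size_allpairs size_iota szt szt' leqNgt => /negP; apply.
apply: leq_ltn_trans nC _; apply: (@leq_ltn_trans (C * q)); first by rewrite leq_mul2l hb orbT.
by rewrite mulnC ltn_pmul2l//; apply: has_index_gt0 hq; apply: (O_subgroup phiP).1.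
Qed.

(* [I] is recovered from a short [x] in [I] and from the set of all [a] such that
   [x * a] lies in [C! * I], which contains [C! * O]. *)
Lemma ideal_count : exists2 C, (0 < C)%N & forall X (T : seq (set K)), uniq T ->
  (forall I, I \in T -> is_ideal O I /\ exists2 n, has_index O I n & (n <= X)%N) ->
  (size T <= C * X)%N.
Proof.
have [C C0 hC] := index_box phiP; pose M := C`!.
have M0 : (0 < M)%N by apply: fact_gt0.
pose rowf (f : {ffun 'I_d -> 'I_M}) : 'rV[int]_d := \row_i (f i : nat)%:Z.
(* [3 ^ d * X] bounds the number of vectors in a box of radius [b] with [b ^ d <= X], and
   [2 ^ (M ^ d)] is the number of sets of residue vectors modulo [M]. *)
exists (3 ^ d * 2 ^ (M ^ d))%N; first by rewrite muln_gt0 !expn_gt0.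
move=> X T uT hT.
have [X0|X0] := posnP X.
  case: T {uT} hT => // I T /(_ I); rewrite inE eqxx => /(_ isT)[idI [n hn nX]].
  have := has_index_gt0 (O_subgroup phiP).1 hn; lia.
have d0 := order_dim_gt0 phiP.
have exb : exists b, (b ^ d <= X)%N by exists 0%N; rewrite exp0n.
have bbd b : (b ^ d <= X)%N -> (b <= X)%N.
  exact/leq_trans/leq_expn_self.
case: (ex_maxnP exb bbd) => b hb bmax.
have b1 : (0 < b)%N by apply: bmax; rewrite exp1n.
have /choice[vI hv] : forall I, exists v, I \in T ->
    [/\ v != 0, I (phi v), inbox b v &
       forall y, I y -> principal_ideal O (phi v) (y *+ M)].
  move=> I; have [IT|nIT] := pselect (I \in T); last by exists 0.
  have [idI [q hq qX]] := hT I IT.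
  have [v [b' [v0 Iv hv hb']]] := small_element phiP (ideal_subgroup phiP idI) hq.
  exists v => _; split => //.
    by apply: inbox_le hv; apply: bmax; apply: leq_trans hb' qX.
  exact: (@principal_multiple C I q v b').
pose D I := [set f : {ffun 'I_d -> 'I_M} |
   `[< exists2 z, I z & phi (vI I) * phi (rowf f) = z *+ M >]]%SET.
pose g I := (vI I, D I).
have sub I J : I \in T -> J \in T -> g I = g J -> I `<=` J.
  move=> IT JT [vE DE] y Iy; have [v0 Iv _ hM] := hv _ IT; have [_ Jv _ _] := hv _ JT.
  have [idI _] := hT _ IT; have [idJ _] := hT _ JT.
  have [_ [w _ <-] wE] := hM y Iy.
  pose q : 'rV[int]_d := \row_i (w 0%R i %/ M)%Z.
  pose f : {ffun 'I_d -> 'I_M} := [ffun i => Ordinal (ltn_pmod (`|(w 0%R i %% M)%Z|)%N M0)].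
  have wqf : w = q *+ M + rowf f.
    apply/rowP => i; rewrite mxE mulmxnE !mxE ffunE /=.
    rewrite modn_small; last by have := @ltz_mod (w 0 i) M; have := @modz_ge0 (w 0 i) M; lia.
    rewrite gez0_abs ?modz_ge0//; last by lia.
    by rewrite [LHS](divz_eq _ M) -[_ *+ M]mulr_natr natz.
  have fE : phi (vI I) * phi (rowf f) = (y - phi q * phi (vI I)) *+ M.
    rewrite mulrnBl -wE wqf (orderD phiP) mulrDl (orderMn phiP) mulrnAl.
    by rewrite addrAC subrr add0r mulrC.
  have : f \in D I.
    rewrite inE; apply/asboolP; exists (y - phi q * phi (vI I)) => //.
    apply: (subgroupB (ideal_subgroup phiP idI)) => //.
    by case: idI => _ _ _; apply=> //; exists q.
  rewrite DE inE => /asboolP[z Jz]; rewrite -vE fE => /(order_mulrn_inj M0) zE.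
  rewrite -[y](subrK (phi q * phi (vI I))) zE; case: idJ => _ _ JD JM; apply: JD => //.
  by rewrite vE; apply: JM => //; exists q.
have gi : {in T &, injective g}.
  by move=> I J IT JT e; apply/seteqP; split; apply: sub.
rewrite -(size_map g).
apply: (@leq_trans (size [seq (v, D) | v <- box_seq d b, D <- enum {set {ffun 'I_d -> 'I_M}}])).
  apply: uniq_leq_size; first by rewrite map_inj_in_uniq.
  move=> _ /mapP[I IT ->]; apply/allpairsP; exists (vI I, D I); split => //=.
    by apply/mem_box_seq; have [] := hv _ IT.
  by rewrite mem_enum.
rewrite size_allpairs size_box_seq -cardE -cardsT -powersetT card_powerset cardsT card_ffun !card_ord.
rewrite mulnAC leq_mul2r; apply/orP; right.
apply: (@leq_trans ((3 * b) ^ d)); first by rewrite leq_exp2r//; lia.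
by rewrite expnMn leq_mul2l hb orbT.
Qed.

(* Two close points of a coset of [I] differ by a short element of [I], whose
   principal ideal would have too small an index. *)
Lemma packing : exists2 C, (0 < C)%N & forall I q c L (s : seq 'rV[int]_d),
  is_ideal O I -> has_index O I q -> uniq s -> (0 < L)%N ->
  (forall v, v \in s -> inbox L v /\ I (phi v - c)) ->
  (q * size s <= C * (L ^ d + q))%N.
Proof.
have [C C0 hC] := index_box phiP; exists (C * 3 ^ d)%N.
  by rewrite muln_gt0 C0 expn_gt0.
move=> I q c L s idI hq us L0 hs.
have d0 := order_dim_gt0 phiP; have sI := ideal_subgroup phiP idI.
have q0 : (0 < q)%N by apply: has_index_gt0 hq; apply: (O_subgroup phiP).1.
(* For the largest such [b], a nonzero vector of [I] cannot lie in the box of radius [b]. So a cell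
   made of [b.+1] consecutive integers in each coordinate holds at most one point of [s]. *)
have exb : exists b, (C * b ^ d < q)%N by exists 0%N; rewrite exp0n// muln0.
have bbd b : (C * b ^ d < q)%N -> (b <= q)%N.
  move=> /ltnW; apply: leq_trans; apply: leq_trans (leq_pmull _ C0).
  exact: leq_expn_self.
case: (ex_maxnP exb bbd) => b hb bmax.
have hqb : (q <= C * b.+1 ^ d)%N.
  by rewrite leqNgt; apply/negP => /bmax; rewrite ltnn.
have far v w : v \in s -> w \in s -> inbox b (v - w) -> v = w.
  move=> vs ws hvw; apply: contrapT => vw.
  have vw0 : v - w != 0 by rewrite subr_eq0; apply/eqP.
  have b0 := inbox_gt0 vw0 hvw.
  have Ivw : I (phi (v - w)).
    rewrite (orderB phiP) -[phi v](subrK c) -addrA.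
    apply: subgroupD => //; first exact: (hs _ vs).2.
    by apply: subgroup_swap => //; exact: (hs _ ws).2.
  have [n hn] := hC _ _ _ idI b0 hvw vw0 Ivw.
  by rewrite (has_index_uniq sI hn hq) leqNgt hb.
pose m := (L.*2 %/ b.+1)%N.
pose g v : {ffun 'I_d -> 'I_m.+1} :=
  [ffun i => inord (`|(v 0 i + L%:Z)%R| %/ b.+1)%N].
have szs : (size s <= m.+1 ^ d)%N.
  have -> : (m.+1 ^ d = #|{ffun 'I_d -> 'I_m.+1}|)%N by rewrite card_ffun !card_ord.
  have ug : uniq (map g s).
    rewrite map_inj_in_uniq// => v w vs ws /ffunP e; apply: far => // i.
    have := e i; rewrite !ffunE !mxE => /(congr1 val) /=.
    have [hv _] := hs _ vs; have [hw _] := hs _ ws.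
    have hm u : inbox L u -> (`|(u 0%R i + L%:Z)%R| %/ b.+1 < m.+1)%N.
      by move=> hu; rewrite ltnS leq_div2r//; have := hu i; lia.
    rewrite !inordK ?hm// => {}e; have := hv i; have := hw i.
    have := ltn_pmod (`|(v 0 i + L%:Z)%R|)%N (ltn0Sn b).
    have := ltn_pmod (`|(w 0 i + L%:Z)%R|)%N (ltn0Sn b).
    have := divn_eq (`|(v 0 i + L%:Z)%R|)%N b.+1.
    have := divn_eq (`|(w 0 i + L%:Z)%R|)%N b.+1.
    by rewrite e /=; move: (_ * _)%N => X; lia.
  by rewrite -(size_map g) -(card_uniqP ug) max_card.
(* If [L] is smaller than a cell there are at most [2 ^ d] points, which the term [q] of the bound
   pays for; otherwise the number of cells gives the term [L ^ d]. *)
have [bL|bL] := leqP b.+1 L; last first.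
  apply: (@leq_trans (q * 2 ^ d)).
    rewrite leq_mul2l (leq_trans szs) ?orbT// leq_exp2r//.
    by rewrite /m ltnS -ltnS ltn_divLR//; lia.
  rewrite mulnDr; apply: leq_trans (leq_addl _ _); rewrite mulnC leq_mul2r.
  apply/orP; right; apply: (@leq_trans (3 ^ d)); first by rewrite leq_exp2r.
  exact: leq_pmull.
apply: (@leq_trans (C * b.+1 ^ d * m.+1 ^ d)); first exact: leq_mul.
rewrite mulnDr; apply: leq_trans (leq_addr _ _).
rewrite -!mulnA leq_mul2l; apply/orP; right; rewrite -!expnMn leq_exp2r//.
have := leq_trunc_div L.*2 b.+1; rewrite -/m mulnS mulnC; lia.
Qed.

(** Read backwards: an ideal of index above [C * L ^ d] contains no nonzero vector of the box. In
    the sieve it discards the primes of large norm. *)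
Lemma index_inbox : exists2 C, (0 < C)%N & forall I q v L,
  is_ideal O I -> has_index O I q -> v != 0 -> I (phi v) -> inbox L v ->
  (q <= C * L ^ d)%N.
Proof.
have [C C0 hC] := index_box phiP; exists C => // I q v L idI hq v0 Iv hv.
have L0 := inbox_gt0 v0 hv.
have [n hn] := hC _ _ _ idI L0 hv v0 Iv.
by rewrite (has_index_uniq (ideal_subgroup phiP idI) hn hq).
Qed.

End OrderCounting.

(** * Ideal arithmetic *)

Section IdealArithmetic.
Variables (K : fieldType) (d : nat) (phi : 'rV[int]_d -> K).
Hypothesis phiP : is_order phi.
Local Notation O := (range phi).
Local Notation ideal := (is_ideal O).
Local Notation "I ** J" := (ideal_mul I J) (at level 40, left associativity).
Implicit Types (I J L P Q : set K) (x y c : K).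

Lemma idealO I x : ideal I -> I x -> O x.
Proof. by case=> IO _ _ _; apply: IO. Qed.

Lemma idealM I a x : ideal I -> O a -> I x -> I (a * x).
Proof. by case=> _ _ _; apply. Qed.

Lemma idealD I x y : ideal I -> I x -> I y -> I (x + y).
Proof. by case=> _ _ + _; apply. Qed.

Lemma idealB I x y : ideal I -> I x -> I y -> I (x - y).
Proof. by move=> /(ideal_subgroup phiP); apply: subgroupB. Qed.

Lemma ideal1 I : ideal I -> I 1 -> I = O.
Proof.
move=> idI I1; apply/seteqP; split=> x; first exact: idealO.
by move=> Ox; rewrite -[x]mulr1; apply: idealM.
Qed.

Lemma ideal_mul_min I J L : subgroup L -> (forall x y, I x -> J y -> L (x * y)) ->
  I ** J `<=` L.
Proof.
move=> sL h _ [s [hs ->]]; rewrite big_seq.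
by apply: subgroup_sum => // p /hs[]; apply: h.
Qed.

Lemma ideal_mul_in I J x y : I x -> J y -> (I ** J) (x * y).
Proof.
move=> Ix Jy; exists [:: (x, y)]; rewrite big_seq1; split => // p.
by rewrite inE => /eqP ->.
Qed.

Lemma ideal_mul_ideal I J : ideal I -> ideal J -> ideal (I ** J).
Proof.
move=> idI idJ; split.
- apply: ideal_mul_min; first exact: O_subgroup phiP.
  by move=> x y Ix Jy; apply: (OM phiP); [apply: idealO Ix|apply: idealO Jy].
- by rewrite -(mul0r 0); apply: ideal_mul_in; [case: idI|case: idJ].
- move=> _ _ [s [hs ->]] [t [ht ->]]; exists (s ++ t); rewrite big_cat; split => // p.
  by rewrite mem_cat => /orP[/hs|/ht].
- move=> a _ Oa [s [hs ->]]; exists [seq (a * p.1, p.2) | p <- s]; split.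
    by move=> _ /mapP[p /hs[Ip Jp] ->]; split => //=; apply: idealM.
  by rewrite big_map mulr_sumr; apply: eq_bigr => p _; rewrite mulrA.
Qed.

Lemma ideal_mulC I J : I ** J = J ** I.
Proof.
suff h I' J' : I' ** J' `<=` J' ** I' by apply/seteqP; split; apply: h.
move=> _ [s [hs ->]]; exists [seq (p.2, p.1) | p <- s]; split.
  by move=> _ /mapP[p /hs[? ?] ->].
by rewrite big_map; apply: eq_bigr => p _; rewrite mulrC.
Qed.

Lemma ideal_mulS I J J' : J `<=` J' -> I ** J `<=` I ** J'.
Proof.
by move=> sJ _ [s [hs ->]]; exists s; split => // p /hs[? /sJ].
Qed.

Lemma ideal_mulA I J L : ideal I -> ideal J -> ideal L ->
  I ** (J ** L) = I ** J ** L.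
Proof.
suff h I' J' L' : ideal I' -> ideal J' -> ideal L' ->
    I' ** (J' ** L') `<=` I' ** J' ** L'.
  move=> idI idJ idL; apply/seteqP; split; first exact: h.
  have := h L J I idL idJ idI.
  by rewrite (ideal_mulC L (J ** I)) (ideal_mulC J I) (ideal_mulC (L ** J) I) (ideal_mulC L J).
move=> idI idJ idL; have idR := ideal_mul_ideal (ideal_mul_ideal idI idJ) idL.
apply: ideal_mul_min; first exact: (ideal_subgroup phiP).
move=> x y Ix; have sS : subgroup (fun y => (I' ** J' ** L') (x * y)).
  split; first by rewrite mulr0; case: idR.
  by move=> u v hu hv; rewrite mulrBr; apply: idealB.
apply: (ideal_mul_min sS) => u v Ju Lv; rewrite mulrA.
by apply: ideal_mul_in => //; apply: ideal_mul_in.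
Qed.

Lemma ideal_mulO I : ideal I -> I ** O = I.
Proof.
move=> idI; apply/seteqP; split.
  apply: ideal_mul_min; first exact: (ideal_subgroup phiP idI).
  by move=> x y Ix Oy; rewrite mulrC; apply: idealM.
by move=> x Ix; rewrite -[x]mulr1; apply: ideal_mul_in => //; apply: O1.
Qed.

Lemma ideal_mul_subl I J : ideal I -> ideal J -> I ** J `<=` I.
Proof.
move=> idI idJ; rewrite -{2}(ideal_mulO idI); apply: ideal_mulS.
by move=> x; apply: idealO.
Qed.

Lemma ideal_mul_subr I J : ideal I -> ideal J -> I ** J `<=` J.
Proof. by move=> idI idJ; rewrite ideal_mulC; apply: ideal_mul_subl. Qed.

Lemma principal_mulE c J x : ideal J ->
  (principal_ideal O c ** J) x <-> exists2 j, J j & x = c * j.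
Proof.
move=> idJ; split; last first.
  move=> [j Jj ->]; apply: ideal_mul_in => //.
  by exists 1; rewrite ?mul1r//; apply: O1.
apply: (@ideal_mul_min _ _ (fun x => exists2 j, J j & x = c * j)).
  split; first by exists 0; rewrite ?mulr0//; case: idJ.
  by move=> _ _ [i Ji ->] [j Jj ->]; exists (i - j); rewrite ?mulrBr//; apply: idealB.
move=> _ y [a Oa <-] Jy; exists (a * y); first exact: idealM.
by rewrite mulrCA mulrA.
Qed.

(** Invertibility as a fractional ideal, stated without leaving [O]: the inverse is [Q] divided by
    [c]. *)
Definition invertible I := exists Q c,
  [/\ ideal Q, O c, c != 0 & I ** Q = principal_ideal O c].

Lemma invertible_cancel P I J : ideal P -> ideal I -> ideal J -> invertible P ->
  P ** I `<=` P ** J -> I `<=` J.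
Proof.
move=> idP idI idJ [Q [c [idQ Oc c0 PQ]]] sIJ x Ix.
have : (principal_ideal O c ** J) (c * x).
  rewrite -PQ (ideal_mulC P) -ideal_mulA//; apply: (ideal_mulS sIJ).
  rewrite ideal_mulA// (ideal_mulC Q) PQ.
  by apply/principal_mulE => //; exists x.
by move/(principal_mulE _ _ idJ) => [j Jj /(mulfI c0) ->].
Qed.

Lemma invertible_cancel_eq P I J : ideal P -> ideal I -> ideal J -> invertible P ->
  P ** I = P ** J -> I = J.
Proof.
move=> idP idI idJ iP e; apply/seteqP.
by split; apply: (invertible_cancel idP) => //; rewrite e.
Qed.

(** To contain is to divide: the cofactor is [Q ** J] divided by [c], where [c] generates [P ** Q].
    It consists of elements of [O] because [J] lies in [P]. *)
Lemma ideal_sub_dvd P J : ideal P -> ideal J -> invertible P -> J `<=` P ->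
  exists2 J', ideal J' & J = P ** J'.
Proof.
move=> idP idJ [Q [c [idQ Oc c0 PQ]]] sJP.
have idQJ := ideal_mul_ideal idQ idJ.
pose J' := [set y | (Q ** J) (c * y)].
have hJ' x : (Q ** J) x -> exists2 y, J' y & x = c * y.
  move=> hx; have : principal_ideal O c x.
    by rewrite -PQ ideal_mulC; apply: (ideal_mulS sJP).
  by move=> [y Oy yE]; exists y; rewrite 1?mulrC// /J' /= mulrC yE.
have idJ' : ideal J'.
  split.
  - move=> y; rewrite /J' /= => /(ideal_mulS sJP).
    by rewrite ideal_mulC PQ => -[z Oz]; rewrite mulrC => /(mulfI c0) <-.
  - by rewrite /J' /= mulr0; case: idQJ.
  - by move=> x y; rewrite /J' /= mulrDr; apply: idealD.
  - by move=> a x Oa; rewrite /J' /= mulrCA; apply: idealM.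
exists J' => //.
have QJ : Q ** J = principal_ideal O c ** J'.
  apply/seteqP; split => x.
    by move=> /hJ' [y ? ?]; apply/principal_mulE => //; exists y.
  by move/(principal_mulE _ _ idJ') => [y ? ->].
have idc : ideal (principal_ideal O c) by apply: principal_is_ideal.
have : principal_ideal O c ** J = principal_ideal O c ** (P ** J').
  rewrite -{1}PQ -ideal_mulA// QJ !ideal_mulA//.
  by rewrite (ideal_mulC P).
move=> e; apply/seteqP; split => x hx.
  have : (principal_ideal O c ** J) (c * x) by apply/principal_mulE => //; exists x.
  by rewrite e => /principal_mulE-/(_ (ideal_mul_ideal idP idJ'))[j ? /(mulfI c0) ->].
have : (principal_ideal O c ** (P ** J')) (c * x).
  by apply/principal_mulE => //; [apply: ideal_mul_ideal|exists x].
by rewrite -e => /principal_mulE-/(_ idJ)[j ? /(mulfI c0) ->].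
Qed.

Lemma invertibleM I J : ideal I -> ideal J -> invertible I -> invertible J ->
  invertible (I ** J).
Proof.
move=> idI idJ [Q [c [idQ Oc c0 IQ]]] [Q' [c' [idQ' Oc' c0' JQ]]].
exists (Q ** Q'), (c * c'); split; rewrite ?mulf_neq0//.
- exact: ideal_mul_ideal.
- exact: OM.
have idc' : ideal (principal_ideal O c') by apply: principal_is_ideal.
have -> : I ** J ** (Q ** Q') = (I ** Q) ** (J ** Q').
  have h := ideal_mul_ideal.
  rewrite -(ideal_mulA idI idJ (h _ _ idQ idQ')) (ideal_mulA idJ idQ idQ').
  by rewrite (ideal_mulC J Q) -(ideal_mulA idQ idJ idQ') ideal_mulA//; apply: h.
rewrite IQ JQ; apply/seteqP; split => x.
  move/(principal_mulE _ _ idc') => [_ [a Oa <-] ->]; exists a => //.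
  by rewrite mulrCA.
move=> [a Oa <-]; apply/principal_mulE => //; exists (a * c'); first by exists a.
by rewrite mulrCA.
Qed.

Lemma invertibleO : invertible O.
Proof.
exists O, 1; rewrite oner_eq0; split => //; try exact: O1; try exact: O_is_ideal.
rewrite ideal_mulO; last exact: O_is_ideal.
by apply/seteqP; split => [x Ox|_ [a Oa <-]]; [exists x|]; rewrite ?mulr1.
Qed.

Lemma nonzero_ideal_mul I J : nonzero_ideal O I -> nonzero_ideal O J ->
  nonzero_ideal O (I ** J).
Proof.
have h L : ideal L -> L <> [set 0] -> exists2 x, L x & x != 0.
  move=> idL L0; apply: contrapT => hn; apply: L0; apply/seteqP.
  split=> [x Lx /=|_ ->]; last by case: idL.
  by apply/eqP/negPn/negP => x0; apply: hn; exists x.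
move=> [idI I0] [idJ J0]; split; first exact: ideal_mul_ideal.
have [x Ix x0] := h _ idI I0; have [y Jy y0] := h _ idJ J0.
move=> e; have : (I ** J) (x * y) by apply: ideal_mul_in.
by rewrite e => /eqP; rewrite mulf_eq0 (negPf x0) (negPf y0).
Qed.

Lemma nonzero_idealO : nonzero_ideal O O.
Proof.
split; first exact: O_is_ideal.
move=> e; have := O1 phiP; rewrite e => /eqP; by rewrite oner_eq0.
Qed.

Lemma ideal_exp_ideal I k : nonzero_ideal O I -> nonzero_ideal O (ideal_exp O I k).
Proof.
move=> hI; elim: k => [|k ih]; first exact: nonzero_idealO.
exact: nonzero_ideal_mul.
Qed.

Lemma ideal_exp_invertible I k : ideal I -> invertible I ->
  ideal (ideal_exp O I k) /\ invertible (ideal_exp O I k).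
Proof.
move=> idI iI; elim: k => [|k [ih1 ih2]]; first by split; [apply: O_is_ideal|apply: invertibleO].
by split; [apply: ideal_mul_ideal|apply: invertibleM].
Qed.

(** Multiplication by [x] is injective on the finite quotient of [O] by [P], hence surjective, and 1
    is reached. *)
Lemma prime_maximal P x : prime_ideal O P -> P <> [set 0] -> O x -> ~ P x ->
  exists2 y, O y & P (1 - x * y).
Proof.
move=> [idP PO pP] P0 Ox nPx; have sP := ideal_subgroup phiP idP.
have [n [s [sO hs cs] szs]] := has_index_ex phiP idP P0.
have us : separated P [seq x * r | r <- s].
  have x0 : x != 0 by apply/eqP => x0; apply: nPx; rewrite x0; case: idP.
  split; first by rewrite map_inj_uniq ?hs.1//; apply: mulfI.
  move=> _ _ /mapP[r rs ->] /mapP[r' rs' ->]; rewrite -mulrBr => h.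
  have [//|hr] := pP _ _ Ox (OB phiP (sO _ rs) (sO _ rs')) h.
  by rewrite (hs.2 _ _ rs rs' hr).
have tO : [set` [seq x * r | r <- s]] `<=` O.
  by move=> _ /mapP[r /sO Or ->]; apply: OM.
have [_ /mapP[r rs ->] h] := separated_covers sP (O_subgroup phiP)
  (And3 sO hs cs) tO us (size_map _ _) (O1 phiP).
by exists r => //; apply: sO.
Qed.

(** Induction on the index replaces a chain condition. If [x * y] lies in [I] but neither factor
    does, then [I + x * O] has smaller index, and it is proper: from [1 = i + a * x] it would follow
    that [y] is in [I]. *)
Lemma maximal_ideal_ex I : nonzero_ideal O I -> I <> O ->
  exists P, [/\ prime_ideal O P, P <> [set 0] & I `<=` P].
Proof.
move=> [idI I0]; have [n hn] := has_index_ex phiP idI I0.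
elim/ltn_ind: n => n ih in I idI I0 hn * => nO.
have [pI|] := pselect (prime_ideal O I); first by exists I; split => // x.
move/not_and3P => [/(_ idI)//|/(_ nO)//|].
move=> /existsNP[x] /existsNP[y] /not_implyP[Ox] /not_implyP[Oy].
move=> /not_implyP[Ixy] /not_orP[nIx nIy].
pose J := [set z | exists2 i, I i & exists2 a, O a & z = i + a * x].
have sJ : I `<=` J.
  by move=> i Ii; exists i => //; exists 0; rewrite ?mul0r ?addr0//; apply: (O_subgroup phiP).1.
have idJ : ideal J.
  split.
  - by move=> _ [i Ii [a Oa ->]]; apply: (OD phiP); [apply: idealO Ii|apply: OM].
  - by apply: sJ; case: idI.
  - move=> _ _ [i Ii [a Oa ->]] [j Ij [b Ob ->]]; exists (i + j); first exact: idealD.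
    by exists (a + b); [apply: (OD phiP)|rewrite mulrDl addrACA].
  - move=> c _ Oc [i Ii [a Oa ->]]; exists (c * i); first exact: idealM.
    by exists (c * a); [apply: OM|rewrite mulrDr mulrA].
have Jx : J x.
  exists 0; first by case: idI.
  by exists 1; rewrite ?mul1r ?add0r//; apply: (O1 phiP).
have J0 : J <> [set 0].
  move=> e; apply: nIx; move: Jx; rewrite e => ->; by case: idI.
have JO : J <> O.
  move=> e; apply: nIy; have : J 1 by rewrite e; apply: (O1 phiP).
  move=> [i Ii [a Oa e1]]; rewrite -[y]mulr1 e1 mulrDr mulrCA.
  apply: idealD => //; first by apply: idealM.
  by rewrite [y * x]mulrC; apply: idealM.
have [m hm] := has_index_ex phiP idJ J0.
have mn : (m < n)%N.
  apply: (has_index_strict (O_subgroup phiP) (ideal_subgroup phiP idI)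
    (ideal_subgroup phiP idJ) sJ _ _ hn hm); first by move=> z; apply: idealO.
  by move/(_ _ Jx).
have [P [pP P0 sP]] := ih m mn J idJ J0 hm JO.
by exists P; split => //; apply: subset_trans sP.
Qed.

Lemma integer_in_ideal I : nonzero_ideal O I -> exists2 m, (0 < m)%N & I m%:R.
Proof.
move=> [idI I0]; have [n [s [sO hs cs] szs]] := has_index_ex phiP idI I0.
apply: contrapT => hn; have sI := ideal_subgroup phiP idI.
have key i j : (i <= j)%N -> I (j%:R - i%:R) -> i = j.
  move=> ij; rewrite -natrB// => h; apply: contrapT => nij; apply: hn.
  by exists (j - i)%N => //; lia.
have key2 i j : I (i%:R - j%:R) -> i = j.
  have [ij|ij] := leqP i j; first by move=> /(subgroup_swap sI)/(key _ _ ij).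
  by move=> /(key _ _ (ltnW ij)).
have : (size [seq i%:R : K | i <- iota 0 n.+1] <= size s)%N.
  apply: (size_separated sI _ _ cs); first by move=> _ /mapP[i _ ->]; apply: (On phiP).
  split; last by move=> _ _ /mapP[i _ ->] /mapP[j _ ->] /key2 ->.
  rewrite map_inj_uniq ?iota_uniq// => i j e; apply: key2.
  by rewrite e subrr; case: idI.
by rewrite size_map size_iota szs ltnn.
Qed.

(** Euclid's argument: a positive integer [m] lies in all nonzero ideals of [S], and a prime ideal
    containing [m * B + 1] cannot contain [m]. *)
Lemma inf_primes (S : seq (set K)) : exists P,
  [/\ prime_ideal O P, P <> [set 0] & P \notin S].
Proof.
pose S' := [seq P <- S | `[< nonzero_ideal O P >]].
have [m m0 hm] : exists2 m, (0 < m)%N & forall P, P \in S' -> P m%:R.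
  have : forall P, P \in S' -> nonzero_ideal O P.
    by move=> P; rewrite mem_filter => /andP[/asboolP].
  elim: S' => [|P T ih] hT; first by exists 1%N.
  have [//|m m0 hm] := ih; first by move=> Q QT; apply: hT; rewrite inE QT orbT.
  have hP : nonzero_ideal O P by apply: hT; rewrite inE eqxx.
  have [n n0 hn] := integer_in_ideal hP.
  exists (m * n)%N; first by rewrite muln_gt0 m0.
  move=> Q; rewrite inE natrM => /predU1P[->|QT].
    by apply: idealM hn; [exact: hP.1|apply: (On phiP)].
  rewrite mulrC; apply: idealM; [|exact: (On phiP)|exact: hm].
  by have [] := hT Q; rewrite ?inE ?QT ?orbT.
have [u hu] := order1 phiP; have [B B0 hB] := inbox_ex u.
(* [B] bounds the coordinates of 1, so that 1 is not a multiple of [N > B] and [N] generates a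
   proper ideal. *)
pose N := (m * B).+1; pose I := principal_ideal O (N%:R : K).
have idI : ideal I by apply: principal_is_ideal => //; apply: On.
have I0 : I <> [set 0].
  move=> e; have : I N%:R by exists 1; rewrite ?mul1r//; apply: O1.
  by rewrite e => /eqP; apply/negP; apply: natr_order_neq0 phiP _ _.
have IO : I <> O.
  move=> e; have : I 1 by rewrite e; apply: O1.
  move=> [_ [v _ <-] /esym]; rewrite mulr_natr -hu -(orderMn phiP) => /(order_inj phiP) uv.
  have : phi u = 0; last by rewrite hu => /eqP; rewrite oner_eq0.
  apply/eqP; rewrite (order_eq0 phiP); apply/eqP/rowP => i; rewrite mxE.
  have := hB i; rewrite uv mulmxnE -mulr_natr natz abszM absz_nat.
  have [->|v0] := eqVneq (v 0 i) 0; first by rewrite mul0r.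
  have : (0 < `|v 0%R i|)%N by rewrite absz_gt0.
  move=> v1 h; have := leq_trans (leq_pmull N v1) h.
  by rewrite leqNgt ltnS leq_pmull.
have [P [pP P0 sP]] := maximal_ideal_ex (conj idI I0) IO.
exists P; split => //; apply/negP => PS.
have [idP PO _] := pP; apply: PO; apply: ideal1 => //.
have PS' : P \in S' by rewrite mem_filter PS andbT; apply/asboolP.
have -> : 1 = N%:R - B%:R * m%:R :> K.
  by rewrite /N -natr1 natrM [_ * m%:R]mulrC addrAC subrr add0r.
apply: idealB => //; first by apply: sP; exists 1; rewrite ?mul1r//; apply: O1.
by apply: idealM => //; [apply: On|apply: hm].
Qed.

Lemma prime_sub P P' : prime_ideal O P -> P <> [set 0] -> prime_ideal O P' ->
  P `<=` P' -> P = P'.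
Proof.
move=> pP P0 [idP' P'O _] sP; apply/seteqP; split => // x P'x.
apply: contrapT => nPx.
have [y Oy h] := prime_maximal pP P0 (idealO idP' P'x) nPx.
apply: P'O; apply: ideal1 => //; rewrite -[1](subrK (x * y)); apply: idealD => //.
  exact: sP.
by rewrite mulrC; apply: idealM.
Qed.

Lemma prime_mul_sub P I J : prime_ideal O P -> ideal I -> ideal J ->
  I ** J `<=` P -> I `<=` P \/ J `<=` P.
Proof.
move=> [idP _ pP] idI idJ sP; apply: contrapT => /not_orP[].
move=> /existsNP[x /not_implyP[Ix nPx]] /existsNP[y /not_implyP[Jy nPy]].
have := sP _ (ideal_mul_in Ix Jy).
by case/pP => //; [apply: idealO Ix|apply: idealO Jy].
Qed.

End IdealArithmetic.

(** Invertibility is asked of nonzero primes only, since these are what the cyclotomic case handles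
    directly; [nzideal_invertible] extends it to all nonzero ideals. *)
Record is_dedekind (K : fieldType) (d : nat) (phi : 'rV[int]_d -> K) : Prop := IsDedekind {
  dedekind_order : is_order phi;
  dedekind_invertible : forall P, prime_ideal (range phi) P -> P <> [set 0] ->
    invertible phi P }.

(** * Multiplicativity of the norm and residues modulo prime powers *)

Section Dedekind.
Variables (K : fieldType) (d : nat) (phi : 'rV[int]_d -> K).
Hypothesis phiD : is_dedekind phi.
Let phiP := dedekind_order phiD.
Local Notation O := (range phi).
Local Notation ideal := (is_ideal O).
Local Notation nzideal := (nonzero_ideal O).
Local Notation "I ** J" := (ideal_mul I J) (at level 40, left associativity).
Local Notation "P ^^ k" := (ideal_exp O P k) (at level 30).
Implicit Types (I J L P Q : set K) (x y c : K).

Definition nzprime P := prime_ideal O P /\ P <> [set 0].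

Lemma nzprime_nz P : nzprime P -> nzideal P.
Proof. by move=> [[? _ _] ?]. Qed.

Lemma nzprime_not1 P : nzprime P -> ~ P 1.
Proof. by move=> [[idP PO _] _] /(ideal1 idP). Qed.

Lemma nzprime_invertible P : nzprime P -> invertible phi P.
Proof. by move=> [? ?]; apply: dedekind_invertible. Qed.

Lemma ideal_norm_index I : nzideal I -> has_index O I (ideal_norm O I).
Proof.
move=> [idI I0]; have [n hn] := has_index_ex phiP idI I0.
by rewrite (ideal_normE (ideal_subgroup phiP idI) hn).
Qed.

Lemma ideal_norm_gt0 I : nzideal I -> (0 < ideal_norm O I)%N.
Proof.
by move=> /ideal_norm_index; apply: has_index_gt0; apply: (O_subgroup phiP).1.
Qed.

Lemma norm_index_eq I n : nzideal I -> has_index O I n -> ideal_norm O I = n.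
Proof. by move=> [idI _]; apply: ideal_normE; apply: (ideal_subgroup phiP). Qed.

Lemma ideal_exp_nz P k : nzprime P -> nzideal (P ^^ k).
Proof. by move=> /nzprime_nz; apply: ideal_exp_ideal. Qed.

(** The powers of [P] decrease strictly, since cancelling [P ^^ k] would put 1 in [P]; so each step
    raises the index. *)
Lemma ideal_exp_index P k : nzprime P ->
  exists2 q, has_index O (P ^^ k) q & (k < q)%N.
Proof.
move=> pP; have [idP _] := nzprime_nz pP.
elim: k => [|k [q hq kq]].
  have h := ideal_norm_index (ideal_exp_nz 0 pP).
  by exists (ideal_norm O (P ^^ 0)) => //; apply: ideal_norm_gt0; apply: ideal_exp_nz.
have h := ideal_norm_index (ideal_exp_nz k.+1 pP).
have [idk _] := ideal_exp_nz k pP; have [idk1 _] := ideal_exp_nz k.+1 pP.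
exists (ideal_norm O (P ^^ k.+1)) => //; apply: leq_ltn_trans kq _.
apply: (has_index_strict (O_subgroup phiP) (ideal_subgroup phiP idk1)
    (ideal_subgroup phiP idk) _ _ _ h hq).
- exact: (ideal_mul_subr phiP idP idk).
- by case: idk.
- have [_ ik] := ideal_exp_invertible phiP k idP (nzprime_invertible pP).
  have idO := O_is_ideal phiP.
  rewrite -[X in X `<=` _](ideal_mulO phiP idk) /= -/(ideal_exp O P k) (ideal_mulC P).
  move=> h'; move: (invertible_cancel phiP idk idO idP ik h' (O1 phiP)).
  exact: (nzprime_not1 pP).
Qed.

(* [I = P * I] would put [I] in all powers of [P], whose indices are unbounded. *)
Lemma prime_mul_neq P I : nzprime P -> nzideal I -> I <> P ** I.
Proof.
move=> pP hI e; have [idP _] := nzprime_nz pP; have [idI _] := hI.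
have h k : I `<=` P ^^ k.
  elim: k => [|k ih] /=; first by move=> x; apply: idealO idI.
  by rewrite e; apply: ideal_mulS.
have [q hq] := ideal_exp_index (ideal_norm O I) pP.
rewrite ltnNge => /negP; apply; apply: leq_has_index (h _) _ hq.
- exact: (ideal_subgroup phiP idI).
- by apply: (ideal_subgroup phiP); apply: (ideal_exp_nz _ pP).1.
- exact: ideal_norm_index.
Qed.

(** Induction on the index: a proper [I] lies in a prime [P], so [I = P ** J] with [J] containing
    [I], and [prime_mul_neq] excludes equality. *)
Lemma nzideal_invertible I : nzideal I -> invertible phi I.
Proof.
move=> hI; have := ideal_norm_index hI; move: (ideal_norm O I) => n.
elim/ltn_ind: n => n ih in I hI * => hn.
have [->|nO] := pselect (I = O); first exact: invertibleO.
have [P [p1 p2 IP]] := maximal_ideal_ex phiP hI nO.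
have pP : nzprime P by [].
have [idI I0] := hI; have [idP _] := nzprime_nz pP.
have [J idJ IPJ] := ideal_sub_dvd phiP idP idI (nzprime_invertible pP) IP.
have J0 : J <> [set 0].
  move=> J0; apply: I0; apply/seteqP; split => [x|_ ->]; last by case: idI.
  by rewrite IPJ => /(ideal_mul_subr phiP idP idJ); rewrite J0.
have IJ : I `<=` J by rewrite IPJ; exact: (ideal_mul_subr phiP idP idJ).
rewrite IPJ; apply: invertibleM => //; first exact: nzprime_invertible.
apply: (ih (ideal_norm O J)) => //; last exact: ideal_norm_index.
apply: (has_index_strict (O_subgroup phiP) (ideal_subgroup phiP idI)
    (ideal_subgroup phiP idJ) IJ _ _ hn (ideal_norm_index (conj idJ J0))).
  by case: idJ.
move=> JI; apply: (prime_mul_neq pP (conj idJ J0)); rewrite -IPJ.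
exact/seteqP.
Qed.

(** [I] modulo [P ** I] is a line over the field [O] modulo [P]. Indeed, for [a] in [I] outside
    [P ** I], the ideal [P ** I + a * O] equals [I ** J'] with [J'] containing [P] but not contained
    in it; so [J' = O] and [a] generates. *)
Lemma index_prime_mul P I p : nzprime P -> nzideal I -> has_index O P p ->
  has_index I (P ** I) p.
Proof.
move=> pP hI [s [sO hs cs] szs]; have [idP P0] := nzprime_nz pP.
have [idI I0] := hI; have idPI := ideal_mul_ideal phiP idP idI.
have PII := ideal_mul_subr phiP idP idI.
have [a Ia nPIa] : exists2 a, I a & ~ (P ** I) a.
  apply: contrapT => hn; apply: (prime_mul_neq pP hI).
  apply/seteqP; split => // a Ia; apply: contrapT => h; apply: hn.
  by exists a.
have key x : O x -> (P ** I) (a * x) -> P x.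
  move=> Ox hx; apply: contrapT => nPx.
  have [y Oy hy] := prime_maximal phiP pP.1 P0 Ox nPx.
  apply: nPIa; rewrite -[a](subrK (a * x * y)); apply: (idealD idPI).
    by rewrite -mulrA -{1}[a]mulr1 -mulrBr mulrC; apply: ideal_mul_in.
  by rewrite mulrC; apply: idealM idPI _ _.
exists [seq a * r | r <- s]; last by rewrite size_map.
have Oa := idealO idI Ia.
split.
- by move=> _ /mapP[r /sO Or ->]; rewrite mulrC; apply: idealM idI _ _.
- split.
    rewrite map_inj_uniq ?hs.1//; apply: mulfI; apply/eqP => a0.
    by apply: nPIa; rewrite a0; case: idPI.
  move=> _ _ /mapP[r rs ->] /mapP[r' rs' ->]; rewrite -mulrBr => h.
  by rewrite (hs.2 _ _ rs rs' (key _ (OB phiP (sO _ rs) (sO _ rs')) h)).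
pose J := [set z | exists2 i, (P ** I) i & exists2 x, O x & z = i + a * x].
have sJ : P ** I `<=` J.
  move=> i hi; exists i => //; exists 0; rewrite ?mulr0 ?addr0//.
  exact: (O_subgroup phiP).1.
have idJ : ideal J.
  split.
  - by move=> _ [i hi [x Ox ->]]; apply: (OD phiP); [apply: idealO hi|apply: OM].
  - by apply: sJ; case: idPI.
  - move=> _ _ [i hi [x Ox ->]] [j hj [y Oy ->]]; exists (i + j); first exact: (idealD idPI).
    by exists (x + y); [apply: (OD phiP)|rewrite mulrDr addrACA].
  - move=> c _ Oc [i hi [x Ox ->]]; exists (c * i); first exact: (idealM idPI).
    by exists (c * x); [apply: OM|rewrite mulrDr mulrCA].
have JI : J `<=` I.
  move=> _ [i hi [x Ox ->]]; apply: (idealD idI); first exact: PII.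
  by rewrite mulrC; apply: (idealM idI).
have iI := nzideal_invertible hI.
have [J' idJ' JJ'] := ideal_sub_dvd phiP idI idJ iI JI.
have PJ' : P `<=` J'.
  apply: (invertible_cancel phiP idI idP idJ' iI).
  by rewrite -JJ' ideal_mulC.
have [x J'x nPx] : exists2 x, J' x & ~ P x.
  apply: contrapT => hn; apply: nPIa.
  have : J a.
    exists 0; first by case: idPI.
    by exists 1; rewrite ?mulr1 ?add0r//; apply: (O1 phiP).
  rewrite JJ' ideal_mulC; apply: (ideal_mul_min (ideal_subgroup phiP idPI)).
  move=> x y J'x Iy; apply: ideal_mul_in => //.
  by apply: contrapT => nPx; apply: hn; exists x.
have [y Oy hy] := prime_maximal phiP pP.1 P0 (idealO idJ' J'x) nPx.
have J'O : J' = O.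
  apply: (ideal1 idJ'); rewrite -[1](subrK (x * y)); apply: (idealD idJ').
    exact: PJ'.
  by rewrite mulrC; apply: (idealM idJ').
move=> z Iz; have : J z by rewrite JJ' J'O ideal_mulO.
move=> [i hi [w Ow ->]]; have [r rs hr] := cs w Ow.
exists (a * r); first exact: map_f.
rewrite -addrA -mulrBr; apply: (idealD idPI) => //.
by rewrite mulrC; apply: ideal_mul_in.
Qed.

Lemma ideal_normM P I : nzprime P -> nzideal I ->
  ideal_norm O (P ** I) = (ideal_norm O P * ideal_norm O I)%N.
Proof.
move=> pP hI; have [idI _] := hI; have [idP _] := nzprime_nz pP.
apply: norm_index_eq; first exact: (nonzero_ideal_mul phiP (nzprime_nz pP) hI).
rewrite mulnC; apply: has_index_tower (ideal_norm_index hI) _.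
- exact: (O_subgroup phiP).
- exact: (ideal_subgroup phiP idI).
- exact: (ideal_subgroup phiP (ideal_mul_ideal phiP idP idI)).
- by case: idI.
- exact: (ideal_mul_subr phiP idP idI).
- by apply: index_prime_mul => //; apply: ideal_norm_index; apply: nzprime_nz.
Qed.

Lemma ideal_norm_exp P k : nzprime P -> ideal_norm O (P ^^ k) = (ideal_norm O P ^ k)%N.
Proof.
move=> pP; elim: k => [|k ih].
  apply: norm_index_eq; first exact: (nonzero_idealO phiP).
  exists [:: 0] => //; split.
  - by move=> x /=; rewrite inE => /eqP ->; apply: (O_subgroup phiP).1.
  - by split => // r r'; rewrite !inE => /eqP -> /eqP ->.
  - by move=> x Ox; exists 0; rewrite ?inE ?subr0.
by rewrite expnS -ih -ideal_normM//; apply: ideal_exp_nz.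
Qed.

Definition comaximal I J := exists a b, [/\ I a, J b & a + b = 1].

Lemma comaximalC I J : comaximal I J -> comaximal J I.
Proof. by move=> [a [b [? ? e]]]; exists b, a; rewrite addrC. Qed.

Lemma comaximal_mul I I' J : ideal I -> ideal I' -> ideal J ->
  comaximal I J -> comaximal I' J -> comaximal (I ** I') J.
Proof.
move=> idI idI' idJ [a [b [Ia Jb ab]]] [a' [b' [Ia' Jb' ab']]].
exists (a * a'), (a * b' + b * (a' + b')); split.
- exact: ideal_mul_in.
- apply: (idealD idJ); first by apply: (idealM idJ) => //; apply: idealO Ia.
  by rewrite ab' mulr1.
- by rewrite addrA -mulrDr -mulrDl ab ab' mulr1.
Qed.

Lemma comaximal_sub I I' J : I `<=` I' -> comaximal I J -> comaximal I' J.
Proof. by move=> s [a [b [Ia Jb ab]]]; exists a, b; split => //; apply: s. Qed.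

Lemma comaximal_exp I J k : ideal I -> ideal J -> comaximal I J -> comaximal (I ^^ k) J.
Proof.
move=> idI idJ h.
suff [] : ideal (I ^^ k) /\ comaximal (I ^^ k) J by [].
elim: k => [|k [ih1 ih2]].
  split; first exact: (O_is_ideal phiP).
  by exists 1, 0; rewrite addr0; split => //; [apply: (O1 phiP)|case: idJ].
by split; [apply: ideal_mul_ideal|apply: comaximal_mul].
Qed.

Lemma nzprime_comaximal P P' k : nzprime P -> nzprime P' -> P <> P' ->
  comaximal (P ^^ k) (P' ^^ k).
Proof.
move=> pP pP' nPP'; have [idP P0] := nzprime_nz pP; have [idP' P0'] := nzprime_nz pP'.
suff h : comaximal P P'.
  apply: comaximal_exp => //; first exact: (ideal_exp_nz k pP').1.
  by apply: comaximalC; apply: comaximal_exp => //; apply: comaximalC.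
have [x Px nPx] : exists2 x, P x & ~ P' x.
  apply: contrapT => hn; apply: nPP'; apply: (prime_sub phiP pP.1 P0 pP'.1).
  by move=> x Px; apply: contrapT => nx; apply: hn; exists x.
have [y Oy hy] := prime_maximal phiP pP'.1 P0' (idealO idP Px) nPx.
exists (x * y), (1 - x * y); split => //; last by rewrite addrC subrK.
by rewrite mulrC; apply: (idealM idP).
Qed.

(** With [a + b = 1], the element [b * x + a * y] is congruent to [x] modulo [I] and to [y] modulo
    [J]. The two invariant conditions become independent, so their counts multiply. *)
Lemma crt_transversal I J s t (W1 W2 : pred K) : ideal I -> ideal J -> comaximal I J ->
  transversal O I s -> transversal O J t ->
  (forall x y, I (x - y) -> W1 x -> W1 y) -> (forall x y, J (x - y) -> W2 x -> W2 y) ->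
  exists u, [/\ transversal O (I `&` J) u, size u = (size s * size t)%N &
    count (fun x => W1 x && W2 x) u = (count W1 s * count W2 t)%N].
Proof.
move=> idI idJ [a [b [Ia Jb ab]]] [sO hs cs] [tO ht ct] hW1 hW2.
have Oa := idealO idI Ia; have Ob := idealO idJ Jb.
pose f x y := b * x + a * y.
have fI x y : O x -> O y -> I (f x y - x).
  move=> Ox Oy; have -> : f x y - x = (y - x) * a by rewrite /f -{2}[x]mul1r -ab; ring.
  by apply: (idealM idI) => //; apply: (OB phiP).
have fJ x y : O x -> O y -> J (f x y - y).
  move=> Ox Oy; have -> : f x y - y = (x - y) * b by rewrite /f -{2}[y]mul1r -ab; ring.
  by apply: (idealM idJ) => //; apply: (OB phiP).
have sI := ideal_subgroup phiP idI; have sJ := ideal_subgroup phiP idJ.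
have inj x y x' y' : x \in s -> y \in t -> x' \in s -> y' \in t ->
    (I `&` J) (f x y - f x' y') -> x = x' /\ y = y'.
  move=> xs yt xs' yt' [h1 h2].
  have := sO _ xs; have := sO _ xs'; have := tO _ yt; have := tO _ yt' => *.
  split; [apply: hs.2 => //|apply: ht.2 => //].
    apply: (subgroup_trans sI) (fI x' y' _ _) => //.
    by apply: (subgroup_trans sI) h1; apply: (subgroup_swap sI); apply: fI.
  apply: (subgroup_trans sJ) (fJ x' y' _ _) => //.
  by apply: (subgroup_trans sJ) h2; apply: (subgroup_swap sJ); apply: fJ.
exists [seq f x y | x <- s, y <- t]; split.
- split.
  + move=> _ /allpairsP[[x y] /= [/sO Ox /tO Oy ->]].
    by apply: (OD phiP); apply: OM.
  + split.
      apply: allpairs_uniq; [exact: hs.1|exact: ht.1|].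
      move=> [x y] [x' y'] h1 h2 e; rewrite /= in e.
      have [[x1 y1] [/= ? ? [? ?]]] := allpairsP h1; subst x1 y1.
      have [[x2 y2] [/= ? ? [? ?]]] := allpairsP h2; subst x2 y2.
      have [] : x = x' /\ y = y'; last by move=> -> ->.
      by apply: inj => //; rewrite e subrr; split; [apply: sI.1|apply: sJ.1].
    move=> _ _ /allpairsP[[x y] /= [p1 p2 ->]] /allpairsP[[x' y'] /= [p3 p4 ->]] h.
    by have [-> ->] := inj _ _ _ _ p1 p2 p3 p4 h.
  + move=> z Oz; have [x xs hx] := cs z Oz; have [y yt hy] := ct z Oz.
    exists (f x y); first by apply/allpairsP; exists (x, y).
    have Ox := sO _ xs; have Oy := tO _ yt.
    split; first by apply: (subgroup_trans sI) hx _; apply: (subgroup_swap sI); apply: fI.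
    by apply: (subgroup_trans sJ) hy _; apply: (subgroup_swap sJ); apply: fJ.
- by rewrite size_allpairs.
have cnt x : x \in s -> count (fun z => W1 z && W2 z) [seq f x y | y <- t] =
    (W1 x * count W2 t)%N.
  move=> xs; rewrite count_map -[RHS]/(W1 x * count W2 t)%N.
  have Ox := sO _ xs.
  have -> : (W1 x * count W2 t)%N = count (fun y => W1 x && W2 y) t.
    by case: (W1 x); rewrite ?mul1n ?mul0n//= count_pred0.
  apply: eq_in_count => y /tO Oy /=; congr (_ && _).
    by apply/idP/idP; apply: hW1; [|apply: (subgroup_swap sI)]; apply: fI.
  by apply/idP/idP; apply: hW2; [|apply: (subgroup_swap sJ)]; apply: fJ.
elim: (s) cnt => [|x s' ih] cnt //=.
rewrite count_cat ih; last by move=> z zs; apply: cnt; rewrite inE zs orbT.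
by rewrite cnt ?inE ?eqxx// mulnDl.
Qed.

(** An intersection instead of a product, so that membership is a system of congruences; the
    conjunct [O x] gives [O] when [S] is empty. *)
Definition prime_powers (k : nat) (S : seq (set K)) : set K :=
  [set x | O x /\ forall P, P \in S -> (P ^^ k) x].

Lemma prime_powers_ideal k S : (forall P, P \in S -> nzprime P) -> ideal (prime_powers k S).
Proof.
move=> hS; split.
- by move=> x [].
- split; first exact: (O_subgroup phiP).1.
  by move=> P /hS/(ideal_exp_nz k)[[]].
- move=> x y [Ox hx] [Oy hy]; split; first exact: (OD phiP).
  move=> P PS; apply: (idealD (ideal_exp_nz k (hS _ PS)).1); [exact: hx|exact: hy].
- move=> c x Oc [Ox hx]; split; first exact: OM.
  by move=> P PS; apply: (idealM (ideal_exp_nz k (hS _ PS)).1) => //; apply: hx.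
Qed.

Lemma prime_powers_cons k P S :
  P ^^ k `<=` O -> P ^^ k `&` prime_powers k S = prime_powers k (P :: S).
Proof.
move=> PO; apply/seteqP; split => x.
  by move=> [Px [Ox h]]; split => // Q; rewrite inE => /predU1P[->|/h].
move=> [Ox h]; split; first by apply: h; rewrite inE eqxx.
by split => // Q QS; apply: h; rewrite inE QS orbT.
Qed.

Lemma comaximal_prime_powers k P S : nzprime P -> (forall Q, Q \in S -> nzprime Q) ->
  P \notin S -> comaximal (P ^^ k) (prime_powers k S).
Proof.
move=> pP; elim: S => [|Q S ih] hS nPS.
  exists 0, 1; split; [by case: (ideal_exp_nz k pP).1| |by rewrite add0r].
  by split => //; apply: (O1 phiP).
move: nPS; rewrite inE negb_or => /andP[nPQ nPS].
have pQ : nzprime Q by apply: hS; rewrite inE eqxx.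
have hS' R : R \in S -> nzprime R by move=> RS; apply: hS; rewrite inE RS orbT.
have idP := (ideal_exp_nz k pP).1; have idQ := (ideal_exp_nz k pQ).1.
have idS := prime_powers_ideal k hS'.
apply: comaximalC; rewrite -prime_powers_cons; last by case: idQ.
apply: (@comaximal_sub (Q ^^ k ** prime_powers k S)).
  by move=> x hx; split; [exact: (ideal_mul_subl phiP idQ idS hx)|exact: (ideal_mul_subr phiP idQ idS hx)].
apply: comaximal_mul => //; last by apply: comaximalC; apply: ih.
by apply: nzprime_comaximal => // e; rewrite e eqxx in nPQ.
Qed.

Lemma transversal_count1 H s : subgroup H -> transversal O H s ->
  count (fun x => `[< H x >]) s = 1%N.
Proof.
move=> sH [sO hs cs]; have [r rs hr] := cs 0 (O_subgroup phiP).1.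
have Hr : H r by rewrite -[r]subr0; apply: subgroup_swap.
rewrite (@eq_in_count _ _ (pred1 r)); first by rewrite count_uniq_mem ?rs ?hs.1.
move=> x xs /=; apply/asboolP/eqP => [Hx|->//].
by apply: hs.2 => //; apply: subgroupB.
Qed.

Definition avoids (k : nat) (S : seq (set K)) (x : K) : Prop :=
  forall P, P \in S -> ~ (P ^^ k) x.

Lemma avoids_mod k S x y : (forall P, P \in S -> nzprime P) ->
  prime_powers k S (x - y) -> avoids k S x -> avoids k S y.
Proof.
move=> hS [_ h] ax P PS Py; apply: (ax _ PS).
by rewrite -[x](subrK y); apply: (idealD (ideal_exp_nz k (hS _ PS)).1) => //; apply: h.
Qed.

(** Modulo each [P ^^ k] exactly one class is forbidden, that of 0, and the Chinese remainder
    theorem multiplies the numbers of allowed classes. *)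
Lemma prime_powers_transversal k S : uniq S -> (forall P, P \in S -> nzprime P) ->
  exists s, [/\ transversal O (prime_powers k S) s,
     size s = (\prod_(P <- S) ideal_norm O P ^ k)%N &
     count (fun x => `[< avoids k S x >]) s =
       (\prod_(P <- S) (ideal_norm O P ^ k).-1)%N].
Proof.
elim: S => [|P S ih] /= uS hS.
  exists [:: 0]; rewrite !big_nil; split => //; last first.
    by rewrite /= addn0; case: asboolP => // -[].
  split.
  - by move=> x /=; rewrite inE => /eqP ->; apply: (O_subgroup phiP).1.
  - by split => // r r'; rewrite !inE => /eqP -> /eqP ->.
  - by move=> x Ox; exists 0; rewrite ?inE ?subr0//; split.
move: uS => /andP[nPS uS].
have pP : nzprime P by apply: hS; rewrite inE eqxx.
have hS' R : R \in S -> nzprime R by move=> RS; apply: hS; rewrite inE RS orbT.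
have [t [ht szt ct]] := ih uS hS'.
have nzP := ideal_exp_nz k pP; have idP := nzP.1; have idS := prime_powers_ideal k hS'.
have [s hs szs] := ideal_norm_index nzP.
pose W1 x := ~~ `[< (P ^^ k) x >]; pose W2 x := `[< avoids k S x >].
have hW1 x y : (P ^^ k) (x - y) -> W1 x -> W1 y.
  move=> h /asboolPn nx; apply/asboolPn => hy; apply: nx.
  by rewrite -[x](subrK y); apply: (idealD idP).
have hW2 x y : prime_powers k S (x - y) -> W2 x -> W2 y.
  by move=> h /asboolP ax; apply/asboolP; apply: avoids_mod h ax.
have [u [hu szu cu]] := crt_transversal idP idS
  (comaximal_prime_powers k pP hS' nPS) hs ht hW1 hW2.
exists u; rewrite prime_powers_cons in hu; last by case: idP.
rewrite !big_cons -(ideal_norm_exp k pP); split => //.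
  by rewrite szu szs szt.
rewrite (@eq_count _ _ (fun x => W1 x && W2 x)) ?cu.
  rewrite ct; congr (_ * _)%N; rewrite -szs -(count_predC (fun x => `[< (P ^^ k) x >])).
  by rewrite (transversal_count1 (ideal_subgroup phiP idP) hs).
move=> x /=; apply/asboolP/andP => [h|[/asboolPn nx /asboolP h] Q].
  split; first by apply/asboolPn; apply: h; rewrite inE eqxx.
  by apply/asboolP => Q QS; apply: h; rewrite inE QS orbT.
by rewrite inE => /predU1P[->|/h].
Qed.

(** For the invertible ideal [P ^^ k], to divide is to contain; so divisibility of the principal
    ideal becomes membership of [x]. *)
Lemma kfreeE k x : kfree O k x <->
  [/\ O x, x != 0 & forall P, nzprime P -> ~ (P ^^ k) x].
Proof.
suff h P : O x -> x != 0 -> nzprime P ->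
    ideal_dvd O (P ^^ k) (principal_ideal O x) <-> (P ^^ k) x.
  split=> -[Ox x0 hx]; split => // P.
    by move=> pP; rewrite -h//; case: pP; apply: hx.
  by move=> p1 p2; rewrite h//; apply: hx.
move=> Ox x0 pP; have [idP _] := ideal_exp_nz k pP; split.
  move=> [Q idQ e]; apply: (ideal_mul_subl phiP idP idQ); rewrite -e.
  by exists 1; rewrite ?mul1r//; apply: O1.
move=> Px; have idx := principal_is_ideal phiP Ox.
have [|Q idQ e] := ideal_sub_dvd phiP idP idx (nzideal_invertible (ideal_exp_nz k pP)).
  by move=> _ [a Oa <-]; apply: (idealM idP).
by exists Q.
Qed.

End Dedekind.

(** * The zeta function and its Euler product *)

Section UnorderedSums.
Variables (R : realType) (T : choiceType) (f : T -> R).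
Implicit Types (A B : set T) (s : seq T) (z : R).

(** Least upper bound of the finite partial sums. It is the value of [\esum], but kept in [R], where
    sums can be subtracted and scaled freely. *)
Definition is_sum A z :=
  (forall s, uniq s -> [set` s] `<=` A -> \sum_(x <- s) f x <= z) /\
  (forall e, 0 < e -> exists s,
     [/\ uniq s, [set` s] `<=` A & z - e < \sum_(x <- s) f x]).

Lemma is_sum_ex A C : (forall s, uniq s -> [set` s] `<=` A -> \sum_(x <- s) f x <= C) ->
  exists z, is_sum A z.
Proof.
move=> hC; pose X := [set \sum_(x <- s) f x | s in [set s | uniq s /\ [set` s] `<=` A]].
have hX : has_sup X.
  split; first by exists 0, [::]; rewrite ?big_nil//; split.
  by exists C => _ [s [us sA] <-]; apply: hC.
exists (sup X); split.
  by move=> s us sA; apply: ub_le_sup; [case: hX|exists s].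
move=> e e0; have [_ [s [us sA] <-] h] := sup_adherent e0 hX.
by exists s.
Qed.

Lemma is_sum_esum A z : is_sum A z -> (\esum_(x in A) (f x)%:E = z%:E)%E.
Proof.
move=> [h1 h2]; apply/eqP; rewrite eq_le; apply/andP; split.
  apply: ge_ereal_sup => _ [F [finF FA] <-].
  rewrite fsbig_finite// sumEFin lee_fin; apply: h1; first exact: fset_uniq.
  by move=> x /=; rewrite in_fset_set// inE => /FA.
apply/lee_addgt0Pr => e e0; have [s [us sA hs]] := h2 e e0.
rewrite -leeBlDr// -EFinB; apply: esum_ge; exists [set` s].
  by split => //; apply: finite_seq.
by rewrite -fsbig_seq// sumEFin lee_fin ltW.
Qed.

Lemma is_sum_ub A z z' : is_sum A z ->
  (forall s, uniq s -> [set` s] `<=` A -> \sum_(x <- s) f x <= z') -> z <= z'.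
Proof.
move=> [_ h] hz'; apply/ler_addgt0Pr => e e0; have [s [us sA hs]] := h e e0.
by have := hz' s us sA; lra.
Qed.

Lemma is_sum_sub A B z : B `<=` A -> is_sum A z -> exists y, is_sum B y.
Proof.
by move=> BA [h _]; apply: (@is_sum_ex _ z) => s us sB; apply: h => // x /sB /BA.
Qed.

Lemma is_sum_image A z c (g : T -> T) : is_sum A z ->
  (forall x y, A x -> A y -> g x = g y -> x = y) -> 0 <= c ->
  (forall x, A x -> f (g x) = c * f x) -> is_sum (g @` A) (c * z).
Proof.
move=> [h1 h2] ig c0 hg; split.
  move=> s us sA; pose h y := xget y [set x | A x /\ g x = y].
  have hP y : y \in s -> A (h y) /\ g (h y) = y.
    by move=> /sA [x Ax <-]; rewrite /h; case: xgetP => [y' _ //|/(_ x)[]].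
  have -> : \sum_(y <- s) f y = c * \sum_(x <- map h s) f x.
    rewrite big_map mulr_sumr big_seq [RHS]big_seq; apply: eq_bigr => y /hP [Ay e].
    by rewrite -hg// e.
  rewrite ler_wpM2l//; apply: h1.
    by rewrite map_inj_in_uniq// => y y' /hP[_ e] /hP[_ e'] ee; rewrite -e -e' ee.
  by move=> _ /mapP[y /hP[? _] ->].
(* Dividing [e] by [c + 1] instead of [c] covers the case [c = 0]. *)
move=> e e0; have c1 : 0 < c + 1 by lra.
have [|s [us sA hs]] := h2 (e / (c + 1)); first exact: divr_gt0.
exists (map g s); split.
- by rewrite map_inj_in_uniq// => x y /sA Ax /sA Ay; apply: ig.
- by move=> _ /mapP[x /sA Ax ->]; exists x.
rewrite big_map big_seq (eq_bigr (fun x => c * f x)); last by move=> x /sA/hg.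
rewrite -big_seq -mulr_sumr; set S := \sum_(x <- s) f x in hs *.
have hce : c * (e / (c + 1)) < e.
  by rewrite mulrA ltr_pdivrMr// mulrC ltr_pM2l//; lra.
have : c * (z - e / (c + 1)) <= c * S by rewrite ler_wpM2l// ltW.
by rewrite mulrBr; lra.
Qed.

Lemma is_sum_split A B z u v : is_sum A z -> is_sum (A `&` B) u ->
  is_sum (A `\` B) v -> z = u + v.
Proof.
move=> hz hu hv; apply/eqP; rewrite eq_le; apply/andP; split.
  apply: (is_sum_ub hz) => s us sA; rewrite (bigID (fun x => `[< B x >]))/=.
  rewrite -!(big_filter s) lerD//.
    apply: hu.1; first exact: filter_uniq.
    by move=> x /=; rewrite mem_filter => /andP[/asboolP Bx /sA].
  apply: hv.1; first exact: filter_uniq.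
  by move=> x /=; rewrite mem_filter => /andP[/asboolPn Bx /sA].
rewrite -lerBrDr; apply: (is_sum_ub hu) => s us sA.
rewrite lerBrDr addrC -lerBrDr; apply: (is_sum_ub hv) => t ut tA.
rewrite lerBrDr addrC -big_cat; apply: hz.1.
  rewrite cat_uniq us ut andbT; apply/hasPn => x /tA[_ Bx]; apply/negP => /sA[_].
  exact: Bx.
by move=> x /=; rewrite mem_cat => /orP[/sA[]|/tA[]].
Qed.

End UnorderedSums.

Section Zeta.
Variables (R : realType) (K : fieldType) (d : nat) (phi : 'rV[int]_d -> K) (k : nat).
Hypothesis phiD : is_dedekind phi.
Hypothesis k2 : (2 <= k)%N.
Let phiP := dedekind_order phiD.
Local Notation O := (range phi).
Local Notation nzideal := (nonzero_ideal O).
Local Notation nzprime := (nzprime phi).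
Implicit Types (I J P : set K) (S T : seq (set K)).

Definition norm_weight I : R := ((ideal_norm O I)%:R ^+ k)^-1.
Local Notation w := norm_weight.

Lemma norm_weight_ge0 I : 0 <= w I.
Proof. by rewrite invr_ge0 exprn_ge0. Qed.

Lemma geometric_half_sum n : \sum_(j < n) (2^-1 : R) ^+ j <= 2.
Proof.
suff -> : \sum_(j < n) (2^-1 : R) ^+ j = 2 - 2 * 2^-1 ^+ n.
  have : 0 <= (2^-1 : R) ^+ n by apply: exprn_ge0; lra.
  by lra.
elim: n => [|n ih]; first by rewrite big_ord0 expr0; lra.
by rewrite big_ord_recr /= ih exprS; lra.
Qed.

(** Dyadic decomposition: at most [C * 2 ^ j.+1] ideals have a norm with binary logarithm [j], each
    of weight at most [4^-1 ^+ j] since [k >= 2]. The blocks are dominated by a geometric series of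
    ratio 1/2. *)
Lemma norm_weight_sum_bounded : exists C : R, forall T, uniq T ->
  [set` T] `<=` nzideal -> \sum_(I <- T) w I <= C.
Proof.
have [C C0 hC] := ideal_count phiP.
exists (4 * C%:R) => T uT hT; pose lg I := trunc_log 2 (ideal_norm O I).
pose n := (\max_(I <- T) lg I).+1.
have lgn I : I \in T -> (lg I < n)%N.
  by move=> IT; rewrite ltnS /n (big_rem I)//= leq_maxl.
have hw I : I \in T -> w I <= 4^-1 ^+ lg I.
  move=> /hT/(ideal_norm_gt0 phiD) N0; rewrite /w exprVn lef_pV2 ?posrE ?exprn_gt0 ?ltr0n//.
  rewrite -!natrX ler_nat; apply: (@leq_trans (ideal_norm O I ^ 2)); last exact: leq_pexp2l.
  by rewrite -[4%N]/(2 ^ 2)%N -expnM mulnC expnM leq_exp2r// /lg trunc_logP.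
apply: (@le_trans _ _ (\sum_(I <- T) \sum_(j < n | j == lg I :> nat) 4^-1 ^+ j)).
  rewrite big_seq [leRHS]big_seq; apply: ler_sum => I IT.
  by rewrite (big_pred1 (Ordinal (lgn _ IT)))//; exact: hw.
under eq_bigr do rewrite big_mkcond; rewrite exchange_big/=.
apply: (@le_trans _ _ (\sum_(j < n) (2 * C%:R) * (2^-1 : R) ^+ j)); last first.
  rewrite -mulr_sumr; have := geometric_half_sum n => h.
  have : (2 * C%:R) * \sum_(j < n) (2^-1 : R) ^+ j <= (2 * C%:R) * 2.
    by rewrite ler_wpM2l// mulr_ge0.
  lra.
apply: ler_sum => j _; rewrite -big_mkcond -big_filter.
rewrite big_const_seq count_predT iter_addr_0.
have sz : (size [seq L <- T | (j : nat) == lg L] <= C * 2 ^ j.+1)%N.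
  apply: hC; first exact: filter_uniq.
  move=> I; rewrite mem_filter => /andP[/eqP jE /hT hI]; split; first by case: hI.
  exists (ideal_norm O I); first exact: ideal_norm_index phiD _ hI.
  by rewrite jE ltnW// trunc_log_ltn.
rewrite -[_ *+ _]mulr_natl; apply: (@le_trans _ _ ((C * 2 ^ j.+1)%:R * 4^-1 ^+ j)).
  by rewrite ler_wpM2r// ?ler_nat// exprn_ge0//; lra.
have -> : (4^-1 : R) = 2^-1 * 2^-1 by lra.
rewrite exprMn natrM natrX exprS.
have -> : (C%:R * (2 * 2 ^+ j) * (2^-1 ^+ j * 2^-1 ^+ j) : R) =
    2 * C%:R * 2^-1 ^+ j * (2 * 2^-1) ^+ j by rewrite exprMn; ring.
by rewrite divff ?expr1n ?mulr1// pnatr_eq0.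
Qed.

Lemma norm_weight1 : w O = 1.
Proof.
have [P [pP P0 _]] := inf_primes phiP [::].
have hP : nzprime P by [].
have := ideal_norm_exp phiD 0 hP; rewrite /= expn0 /w => ->.
by rewrite expr1n invr1.
Qed.

Definition coprime_to S : set (set K) :=
  [set I | nzideal I /\ forall P, P \in S -> ~ I `<=` P].

Lemma norm_weight_prime_mul P I : nzprime P -> nzideal I ->
  w (ideal_mul P I) = w P * w I.
Proof. by move=> pP hI; rewrite /w ideal_normM// natrM exprMn invfM. Qed.

(** Among the ideals coprime to [S], those contained in [P] are exactly the products of [P] with an
    ideal coprime to [S], because [P] is not in [S]. Their weights sum to [w P * z]. *)
Lemma euler_step S P z : nzprime P -> (forall Q, Q \in S -> nzprime Q) -> P \notin S ->
  is_sum w (coprime_to S) z -> is_sum w (coprime_to (P :: S)) ((1 - w P) * z).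
Proof.
move=> pP hS nPS hz; have [idP _] := nzprime_nz pP.
have iP := nzprime_invertible phiD pP.
have hPz : is_sum w (coprime_to S `&` [set I | I `<=` P]) (w P * z).
  have -> : coprime_to S `&` [set I | I `<=` P] = ideal_mul P @` coprime_to S.
    apply/seteqP; split => [I [[hI cI] IP]|_ [J [hJ cJ] <-]].
      have [idI I0] := hI; have [J idJ IE] := ideal_sub_dvd phiP idP idI iP IP.
      exists J => //; split.
        split => // J0; apply: I0; rewrite IE J0; apply/seteqP; split => [x|_ ->].
          have id0 : is_ideal O [set 0 : K] by rewrite -J0.
          exact: (ideal_mul_subr phiP idP id0).
        by rewrite -J0; case: (ideal_mul_ideal phiP idP idJ).
      move=> Q QS JQ; apply: (cI Q QS); rewrite IE.
      by apply: subset_trans JQ; apply: (ideal_mul_subr phiP idP idJ).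
    have [idJ _] := hJ; split; last exact: (ideal_mul_subl phiP idP idJ).
    split; first exact: (nonzero_ideal_mul phiP (nzprime_nz pP) hJ).
    move=> Q QS PJQ; have pQ := hS _ QS.
    have [PQ|JQ] := prime_mul_sub pQ.1 idP idJ PJQ; last exact: cJ QS JQ.
    have PQ' := prime_sub phiP pP.1 pP.2 pQ.1 PQ.
    by rewrite PQ' QS in nPS.
  apply: (is_sum_image hz).
  - move=> I J [[idI _] _] [[idJ _] _].
    exact: (invertible_cancel_eq phiP idP idI idJ iP).
  - exact: norm_weight_ge0.
  - by move=> I [hI _]; apply: norm_weight_prime_mul.
have -> : coprime_to (P :: S) = coprime_to S `\` [set I | I `<=` P].
  apply/seteqP; split => [I [hI cI]|I [[hI cI] nIP]].
    split; last by apply: cI; rewrite inE eqxx.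
    by split => // Q QS; apply: cI; rewrite inE QS orbT.
  by split => // Q; rewrite inE => /predU1P[->//|/cI].
have [v hv] : exists v, is_sum w (coprime_to S `\` [set I | I `<=` P]) v.
  by apply: (is_sum_sub _ hz) => I [].
have -> : (1 - w P) * z = v; last by [].
by rewrite mulrBl mul1r {1}(is_sum_split hz hPz hv) addrAC subrr add0r.
Qed.

Lemma euler_product S z : uniq S -> (forall Q, Q \in S -> nzprime Q) ->
  is_sum w nzideal z ->
  is_sum w (coprime_to S) (\prod_(P <- S) (1 - w P) * z).
Proof.
move=> + + hz; elim: S => [|P S ih] uS hS.
  rewrite big_nil mul1r; have -> : coprime_to [::] = nzideal; last by [].
  by apply/seteqP; split => [I []//|I hI]; split.
rewrite big_cons -mulrA; move: uS => /= /andP[nPS uS].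
apply: euler_step => //; first by apply: hS; rewrite inE eqxx.
  by move=> Q QS; apply: hS; rewrite inE QS orbT.
by apply: ih => // Q QS; apply: hS; rewrite inE QS orbT.
Qed.

Lemma zeta_sum : exists2 z, is_sum w nzideal z & 1 <= z.
Proof.
have [C hC] := norm_weight_sum_bounded; have [z hz] := is_sum_ex hC.
exists z => //; have := hz.1 [:: O] isT; rewrite big_seq1 norm_weight1; apply.
by move=> I /=; rewrite inE => /eqP ->; apply: nonzero_idealO.
Qed.

(** The unit ideal is coprime to [S] and has weight 1, so the sum over the coprime ideals is at
    least 1. *)
Lemma euler_product_ge S z : uniq S -> (forall Q, Q \in S -> nzprime Q) ->
  is_sum w nzideal z -> 1 <= z -> z^-1 <= \prod_(P <- S) (1 - w P).
Proof.
move=> uS hS hz z1; have [h _] := euler_product uS hS hz.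
rewrite -[z^-1]mul1r ler_pdivrMr; last lra.
have := h [:: O] isT; rewrite big_seq1 norm_weight1; apply.
move=> I /=; rewrite inE => /eqP ->; split; first exact: nonzero_idealO.
by move=> P /hS/nzprime_not1 n1 /(_ _ (O1 phiP)).
Qed.

(** A finite list [s] of ideals carries all of the sum but [e]; [S] takes one prime above each
    proper ideal of [s]. An ideal coprime to [S] other than [O] is then outside [s], and so is a
    prime not in [S]: both sums are tails bounded by [e]. *)
Lemma euler_product_approx z e : is_sum w nzideal z -> 1 <= z -> 0 < e ->
  exists S, [/\ uniq S, forall Q, Q \in S -> nzprime Q,
    \prod_(P <- S) (1 - w P) <= z^-1 + e &
    forall T, uniq T -> (forall P, P \in T -> nzprime P /\ P \notin S) ->
      \sum_(P <- T) w P <= e].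
Proof.
move=> hz z1 e0; have [s [us sN hs]] := hz.2 _ e0.
have /choice[g hg] : forall I, exists P, nzideal I -> I <> O -> nzprime P /\ I `<=` P.
  move=> I; have [[hI IO]|h] := pselect (nzideal I /\ I <> O).
    by have [P [? ? ?]] := maximal_ideal_ex phiP hI IO; exists P.
  by exists O => ? ?; exfalso; apply: h.
pose S := undup [seq g L | L <- s & L != O].
have hS Q : Q \in S -> nzprime Q.
  rewrite mem_undup => /mapP[I]; rewrite mem_filter => /andP[/eqP IO /sN hI] ->.
  by have [] := hg I hI IO.
have uS : uniq S by apply: undup_uniq.
have rest t : uniq t -> [set` t] `<=` nzideal -> (forall I, I \in t -> I \notin s) ->
    \sum_(I <- t) w I <= e.
  move=> ut tN ts; have := hz.1 (t ++ s); rewrite big_cat /= => h.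
  have : \sum_(I <- t) w I + \sum_(I <- s) w I <= z.
    apply: h; last by move=> I /=; rewrite mem_cat => /orP[/tN|/sN].
    rewrite cat_uniq ut us andbT; apply/hasPn => I Is; apply/negP => /ts.
    by rewrite Is.
  by lra.
exists S; split => //.
  have hE := euler_product uS hS hz.
  suff h : \prod_(P <- S) (1 - w P) * z <= 1 + e.
    rewrite -[leLHS](mulfK (_ : z != 0)); last by rewrite gt_eqF//; lra.
    rewrite ler_pdivrMr; last lra.
    apply: le_trans h _; rewrite mulrDl mulVf ?gt_eqF//; last lra.
    by rewrite lerD2l ler_peMr// ltW.
  apply: (is_sum_ub hE) => t ut tE.
  rewrite (bigID (fun I => I == O)) /= lerD//.
    rewrite -big_filter; have u1 : uniq [seq L <- t | L == O] by rewrite filter_uniq.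
    case E : [seq L <- t | L == O] u1 => [|I [|J l]]; rewrite ?big_nil// ?big_seq1.
      have : I \in [seq L <- t | L == O] by rewrite E inE.
      by rewrite mem_filter => /andP[/eqP -> _]; rewrite norm_weight1.
    have : I \in [seq L <- t | L == O] by rewrite E inE eqxx.
    have : J \in [seq L <- t | L == O] by rewrite E !inE eqxx orbT.
    by rewrite !mem_filter => /andP[/eqP -> _] /andP[/eqP -> _]; rewrite /= inE eqxx.
  rewrite -big_filter; apply: rest; first exact: filter_uniq.
    by move=> I /=; rewrite mem_filter => /andP[_ /tE[]].
  move=> I; rewrite mem_filter => /andP[IO /tE[hI cI]]; apply/negP => Is.
  have [pg Ig] := hg I hI (elimN eqP IO); apply: (cI (g I)) Ig.
  by rewrite mem_undup; apply: map_f; rewrite mem_filter IO.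
move=> T uT hT; apply: rest => //.
  by move=> P /hT[/nzprime_nz].
move=> P /hT[pP nPS]; apply/negP => Ps.
have PO : P <> O by move=> e1; apply: (nzprime_not1 pP); rewrite e1; apply: (O1 phiP).
have [pg Pg] := hg P (nzprime_nz pP) PO.
have PE := prime_sub phiP pP.1 pP.2 pg.1 Pg.
move: nPS; rewrite mem_undup => /negP; apply; apply/mapP; exists P => //.
by rewrite mem_filter Ps andbT; apply/eqP.
Qed.

End Zeta.

(** * Windows and averaging *)

Lemma count_split (T : Type) (a b : pred T) (s : seq T) :
  count a s = (count (predI b a) s + count (predI (predC b) a) s)%N.
Proof. by elim: s => //= x s ->; case: (a x); case: (b x) => /=; lia. Qed.

Lemma sum_cst_seq (T : Type) (s : seq T) n : (\sum_(x <- s) n)%N = (size s * n)%N.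
Proof. by rewrite big_const_seq count_predT iter_addn_0 mulnC. Qed.

Section Windows.
Variable d : nat.
Implicit Types (F : {fset 'rV[int]_d}) (v w t z : 'rV[int]_d).

Definition unit_row i : 'rV[int]_d := delta_mx 0 i.

(** The property, shared by cubes and balls, that controls the boundary of a window. *)
Definition line_convex F := forall i v m n,
  v \in F -> v + unit_row i *+ n \in F -> (m <= n)%N -> v + unit_row i *+ m \in F.

Definition window F B := line_convex F /\ forall v, v \in F -> inbox B v.

Definition exits F t := count (fun v => (v + t)%R \notin F) F.

Lemma unit_rowE i j n : (unit_row i *+ n) 0 j = if i == j then n%:Z else 0.
Proof.
rewrite mulmxnE mxE eqxx /= eq_sym; case: eqP => _; last by rewrite mul0rn.
by rewrite /= mulr1n natz.
Qed.

(** A line in direction [i] leaves [F] at most once, by convexity, and the lines that meet the box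
    are indexed by the other [d.-1] coordinates. *)
Lemma exits_unit F B i : window F B -> (exits F (unit_row i) <= B.*2.+1 ^ d.-1)%N.
Proof.
move=> [cF hF].
pose f v : {ffun 'I_d.-1 -> 'I_(B.*2.+1)} :=
  [ffun j => inord (`|(v 0 (lift i j) + B%:Z)%R|)%N].
pose s := [seq v <- F | v + unit_row i \notin F].
have key v w : v \in s -> w \in s -> f v = f w -> v 0 i <= w 0 i -> v = w.
  rewrite !mem_filter => /andP[vt vF] /andP[wt wF] /ffunP fvw le.
  have e j : j != i -> v 0 j = w 0 j.
    move=> ji; have [j' ->] : exists j', j = lift i j'.
      by rewrite eq_sym in ji; have [j' -> _] := unlift_some ji; exists j'.
    have := fvw j'; rewrite !ffunE => /(congr1 val) /=.
    have := hF v vF (lift i j'); have := hF w wF (lift i j') => /= h1 h2.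
    by rewrite !inordK; lia.
  have wE : w = v + unit_row i *+ `|w 0%R i - v 0%R i|%N.
    apply/rowP => j; rewrite mxE unit_rowE; case: eqVneq => [<-|ij].
      by rewrite gez0_abs ?subr_ge0// addrC subrK.
    by rewrite e ?addr0// eq_sym.
  have [e0|e0] := posnP (`|w 0%R i - v 0%R i|%N); first by rewrite wE e0 mulr0n addr0.
  have := cF i v 1%N _ vF; rewrite mulr1n (negPf vt) => /(_ `|w 0%R i - v 0%R i|%N).
  by rewrite -wE wF e0 => /(_ isT isT).
have fi : {in s &, injective f}.
  move=> v w vs ws fvw; have [le|le] := leP (v 0 i) (w 0 i); first exact: key.
  by apply/esym; apply: key => //; apply: ltW.
rewrite /exits -size_filter -/s -(size_map f).
have us : uniq (map f s) by rewrite map_inj_in_uniq// filter_uniq// fset_uniq.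
rewrite -(card_uniqP us) (leq_trans (max_card _))//.
by rewrite card_ffun !card_ord.
Qed.

Lemma exits0 F : exits F 0 = 0%N.
Proof.
by apply/eqP; rewrite eqn0Ngt -has_count; apply/hasPn => v vF; rewrite addr0 vF.
Qed.

(** Adding [t] is a bijection from the points that stay in [F] under [t] to those that stay under
    [- t]; hence as many leave. *)
Lemma exitsN F t : exits F (- t) = exits F t.
Proof.
have h u : (count (fun v => (v + u)%R \in F) F <= count (fun v => (v - u)%R \in F) F)%N.
  rewrite -!size_filter -[X in (X <= _)%N](size_map (fun v => v + u)); apply: uniq_leq_size.
    by rewrite map_inj_uniq ?filter_uniq ?fset_uniq//; apply: addIr.
  by move=> _ /mapP[v + ->]; rewrite !mem_filter addrK => /andP[-> ->].
have e : count (fun v => (v + t)%R \in F) F = count (fun v => (v - t)%R \in F) F.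
  by apply/eqP; rewrite eqn_leq h/=; have := h (- t); rewrite opprK.
have h1 := count_predC (fun v => (v + t)%R \in F) F.
have h2 := count_predC (fun v => (v - t)%R \in F) F.
move: h1 h2; rewrite e /exits /predC /= => h1 h2.
by apply/eqP; rewrite -(eqn_add2l (count (fun v => (v - t)%R \in F) F)) h1 h2.
Qed.

Lemma exitsD F s t : (exits F (s + t) <= exits F s + exits F t)%N.
Proof.
rewrite {1}/exits (count_split _ (fun v => (v + s)%R \notin F)); apply: leq_add.
  by apply: sub_count => v /= /andP[].
rewrite /exits -!size_filter -[X in (X <= _)%N](size_map (fun v => v + s)); apply: uniq_leq_size.
  by rewrite map_inj_uniq ?filter_uniq ?fset_uniq//; apply: addIr.
move=> _ /mapP[v + ->]; rewrite !mem_filter /= negbK -addrA.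
by move=> /andP[/andP[-> ->] _].
Qed.

Lemma exits_bound F B t : window F B ->
  (exits F t <= (\sum_i `|t 0%R i|) * B.*2.+1 ^ d.-1)%N.
Proof.
move=> hF; rewrite {1}[t]row_sum_delta big_distrl /=.
elim/big_rec2: _ => [|i u v _ ih]; first by rewrite exits0.
apply: leq_trans (exitsD _ _ _) _; apply: leq_add => //.
have h n : (exits F (unit_row i *+ n) <= n * B.*2.+1 ^ d.-1)%N.
  elim: n => [|n ihn]; first by rewrite mulr0n exits0.
  rewrite mulrS mulSn; apply: leq_trans (exitsD _ _ _) _.
  by apply: leq_add => //; apply: exits_unit.
rewrite -/(unit_row i); case: (t 0 i) => n.
  rewrite (_ : Posz n *: _ = unit_row i *+ n); first exact: h.
  by rewrite -scaler_nat natz.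
rewrite (_ : Negz n *: _ = - (unit_row i *+ n.+1)); first by rewrite exitsN; apply: h.
by rewrite NegzE scaleNr -scaler_nat natz.
Qed.

Lemma count_shift_le F (W : pred 'rV[int]_d) t :
  (count (fun v => W (v + t)%R) F <= count W F + exits F t)%N.
Proof.
rewrite (count_split _ (fun v => (v + t)%R \notin F)) addnC; apply: leq_add; last first.
  by apply: sub_count => v /= /andP[].
rewrite -!size_filter -[X in (X <= _)%N](size_map (fun v => v + t)); apply: uniq_leq_size.
  by rewrite map_inj_uniq ?filter_uniq ?fset_uniq//; apply: addIr.
by move=> _ /mapP[v + ->]; rewrite !mem_filter /= negbK => /andP[/andP[-> ->] _].
Qed.

Lemma count_shift_ge F (W : pred 'rV[int]_d) t :
  (count W F <= count (fun v => W (v + t)%R) F + exits F t)%N.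
Proof.
have := count_shift_le F (predC W) t.
have h1 := count_predC W F; have h2 := count_predC (fun v => W (v + t)%R) F.
have e : count (predC (fun v => W (v + t)%R)) F = count (fun v => predC W (v + t)%R) F.
  exact: eq_count.
by rewrite e in h2; move: h1 h2; lia.
Qed.

End Windows.

Section Averaging.
Variables (K : fieldType) (d : nat) (phi : 'rV[int]_d -> K).
Hypothesis phiP : is_order phi.
Local Notation O := (range phi).
Implicit Types (F : {fset 'rV[int]_d}) (v w t z : 'rV[int]_d).

Lemma transversal_shift (L : set K) s x : subgroup L -> O x ->
  transversal O L s -> transversal O L [seq r + x | r <- s].
Proof.
move=> sL Ox [sO hs cs]; split.
- by move=> _ /mapP[r /sO Or ->]; apply: (OD phiP).
- split; first by rewrite map_inj_uniq ?hs.1//; apply: addIr.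
  move=> _ _ /mapP[r rs ->] /mapP[r' rs' ->]; rewrite opprD addrACA subrr addr0.
  by move=> /(hs.2 _ _ rs rs') ->.
- move=> y Oy; have [r rs hr] := cs (y - x) (OB phiP Oy Ox).
  by exists (r + x); [apply: map_f|rewrite opprD addrA addrAC].
Qed.

(* Average over the translates of [F] by a transversal of [L]: each point of [F]
   contributes [count W s]. *)
Lemma density_bounds (L : set K) s (W : pred K) : subgroup L -> transversal O L s ->
  (forall x y, L (x - y) -> W x -> W y) ->
  exists C, forall F B z, window F B ->
    (size s * count (fun v => W (phi (v + z)%R)) F <=
       count W s * #|` F| + C * B.*2.+1 ^ d.-1)%N /\
    (count W s * #|` F| <=
       size s * count (fun v => W (phi (v + z)%R)) F + C * B.*2.+1 ^ d.-1)%N.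
Proof.
move=> sL hs hW.
have [t tE] : exists t : seq 'rV[int]_d, s = map phi t.
  have [sO _ _] := hs; elim: (s) sO => [|x l ih] sO; first by exists [::].
  have [|t ->] := ih; first by move=> y yl; apply: sO; rewrite /= inE yl orbT.
  have [v _ <-] : O x by apply: sO; rewrite /= inE eqxx.
  by exists (v :: t).
exists (\sum_(u <- t) \sum_i `|u 0%R i|)%N => F B z hF.
have e : (\sum_(u <- t) count (fun v => W (phi (v + u + z)%R)) F = count W s * #|` F|)%N.
  under eq_bigr do rewrite -sum1_count big_mkcond; rewrite exchange_big /=.
  rewrite (eq_bigr (fun=> count W s)); first by rewrite big_const_seq count_predT iter_addn_0.
  move=> v _; rewrite -big_mkcond sum1_count.
  have Ovz : O (phi (v + z)) by exists (v + z).
  rewrite (count_transversal sL hW hs (transversal_shift sL Ovz hs)) tE -map_comp count_map.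
  by apply: eq_count => u /=; rewrite -(orderD phiP) addrAC addrC addrA.
have sz : size s = size t by rewrite tE size_map.
rewrite -e sz; split.
  rewrite -[(size t * _)%N]sum_cst_seq [X in (_ + X)%N]big_distrl -big_split /=; apply: leq_sum => u _.
  apply: leq_trans (count_shift_ge F (fun v => W (phi (v + z)%R)) u) _.
  by rewrite leq_add2l; apply: exits_bound.
rewrite -[(size t * _)%N]sum_cst_seq [X in (_ + X)%N]big_distrl -big_split /=; apply: leq_sum => u _.
apply: leq_trans (count_shift_le F (fun v => W (phi (v + z)%R)) u) _.
by rewrite leq_add2l; apply: exits_bound.
Qed.

End Averaging.

(** * The sieve *)

Lemma sum_count_fibers (T1 : Type) (T2 : eqType) (g : T1 -> T2) (s : seq T1) (t : seq T2) :
  uniq t -> all (fun x => g x \in t) s ->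
  (\sum_(y <- t) count (fun x => g x == y) s)%N = size s.
Proof.
move=> ut; elim: s => [|x s ih] /=; first by rewrite sum_cst_seq muln0.
move=> /andP[xt /ih <-]; rewrite big_split /= -add1n; congr (_ + _)%N.
transitivity (count_mem (g x) t); last by rewrite count_uniq_mem// xt.
rewrite -sum1_count [RHS]big_mkcond; apply: eq_bigr => y _.
by rewrite /= eq_sym; case: eqP.
Qed.

Section Sieve.
Variables (R : realType) (K : fieldType) (d : nat) (phi : 'rV[int]_d -> K) (k : nat).
Hypothesis phiD : is_dedekind phi.
Hypothesis k2 : (2 <= k)%N.
Let phiP := dedekind_order phiD.
Local Notation O := (range phi).
Local Notation nzprime := (nzprime phi).
Local Notation "P ^^ k" := (ideal_exp O P k) (at level 30).
Local Notation w := (norm_weight R phi k).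
Implicit Types (P : set K) (S T : seq (set K)) (v z u : 'rV[int]_d).

Definition kfree_vectors : set 'rV[int]_d := [set v | kfree O k (phi v)].
Local Notation V := kfree_vectors.

Lemma big_prime X S : exists P, [/\ nzprime P, P \notin S & (X < ideal_norm O P)%N].
Proof.
apply: contrapT => hn; have [C C0 hC] := ideal_count phiP.
have small P : nzprime P -> P \notin S -> (ideal_norm O P <= X)%N.
  by move=> pP nPS; rewrite leqNgt; apply/negP => h; apply: hn; exists P.
have [T [uT sT hT]] : exists T, [/\ uniq T, size T = (C * X).+1 &
    forall P, P \in T -> nzprime P /\ P \notin S].
  elim: (C * X).+1 => [|n [T [uT sT hT]]]; first by exists [::].
  have [P [pP P0]] := inf_primes phiP (S ++ T).
  rewrite mem_cat negb_or => /andP[nPS nPT].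
  exists (P :: T); rewrite /= nPT uT sT; split => // Q.
  by rewrite inE => /predU1P[->|/hT//].
have := hC X T uT; rewrite sT ltnn => h; suff : false by [].
apply: h => P /hT[pP nPS]; have hP := nzprime_nz pP.
split; first by case: hP.
exists (ideal_norm O P); first exact: (ideal_norm_index phiD hP).
exact: small.
Qed.

Lemma crt_solution S (a : set K -> K) : uniq S -> (forall P, P \in S -> nzprime P) ->
  (forall P, O (a P)) -> exists z, forall P, P \in S -> (P ^^ k) (phi z - a P).
Proof.
move=> + + ha; elim: S => [|P S ih] /= uS hS; first by exists 0.
move: uS => /andP[nPS uS].
have pP : nzprime P by apply: hS; rewrite inE eqxx.
have hS' Q : Q \in S -> nzprime Q by move=> QS; apply: hS; rewrite inE QS orbT.
have [z hz] := ih uS hS'.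
have [b [c [Pb [Oc Sc] bc]]] := comaximal_prime_powers phiD k pP hS' nPS.
have idP := (ideal_exp_nz phiD k pP).1; have Ob := idealO idP Pb.
have [v _ vE] : O (c * a P + b * phi z).
  by apply: (OD phiP); apply: (OM phiP) => //; exists z.
exists v => Q; rewrite inE vE => /predU1P[->|QS].
  have -> : c * a P + b * phi z - a P = (phi z - a P) * b.
    by rewrite -[X in _ - X]mul1r -bc; ring.
  by apply: (idealM idP) => //; apply: (OB phiP) => //; exists z.
have idQ := (ideal_exp_nz phiD k (hS' _ QS)).1.
have -> : c * a P + b * phi z - a Q = (a P - phi z) * c + (phi z - a Q).
  have -> : b = 1 - c by rewrite -bc addrK.
  by ring.
apply: (idealD idQ); last exact: hz.
by apply: (idealM idQ); [apply: (OB phiP) => //; exists z|apply: Sc].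
Qed.

Lemma prime_powers_index S : uniq S -> (forall P, P \in S -> nzprime P) ->
  has_index O (prime_powers phi k S) (\prod_(P <- S) ideal_norm O P ^ k)%N.
Proof.
by move=> uS hS; have [s [hs sz _]] := prime_powers_transversal phiD k uS hS; exists s.
Qed.

Lemma prime_norm_prod_gt0 S : (forall P, P \in S -> nzprime P) ->
  (0 < \prod_(P <- S) ideal_norm O P ^ k)%N.
Proof.
move=> hS; rewrite big_seq; apply: prodn_cond_gt0 => P /hS/nzprime_nz.
by move=> /(ideal_norm_gt0 phiD) h; rewrite expn_gt0 h.
Qed.

Lemma norm_weightE P : w P = ((ideal_norm O P ^ k)%N%:R)^-1.
Proof. by rewrite /norm_weight natrX. Qed.

Lemma not_kfree_prime v : v != 0 -> ~ V v -> exists2 P, nzprime P & (P ^^ k) (phi v).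
Proof.
move=> v0 nV; apply: contrapT => hn; apply: nV; apply/(kfreeE phiD); split.
- by exists v.
- by rewrite (order_eq0 phiP).
- by move=> P pP Pv; apply: hn; exists P.
Qed.

(** Each bad [z] with [z + u] nonzero is charged to a prime [P] outside [S] with [z + u] in
    [P ^^ k]. The points charged to [P] lie in one coset modulo [P ^^ k] and the prime powers of
    [S'], and [packing] bounds them by a multiple of density plus 1; the leading 1 is for
    [z + u = 0]. [S'] will be [S] when a residue class is prescribed, and empty for plain
    densities. *)
Lemma bad_primes : exists C : nat, forall S S' u z0 L (Z : seq 'rV[int]_d),
  uniq S' -> (forall P, P \in S' -> nzprime P) -> {subset S' <= S} ->
  inbox L u -> (0 < L)%N -> uniq Z ->
  (forall z, z \in Z -> [/\ inbox L z, prime_powers phi k S' (phi z - phi z0),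
     avoids phi k S (phi (z + u)) & ~ V (z + u)]) ->
  exists T, [/\ uniq T,
    forall P, P \in T -> [/\ nzprime P, P \notin S & (ideal_norm O P ^ k <= C * L ^ d)%N] &
    (size Z)%:R <= 1 + \sum_(P <- T)
      C%:R * (w P * ((L ^ d)%N%:R / (\prod_(P <- S') ideal_norm O P ^ k)%N%:R) + 1) :> R].
Proof.
have [C1 C10 hC1] := index_inbox phiP; have [Cp Cp0 hCp] := packing phiP.
(* The factor [2 ^ d] enters because [z + u] is only known to lie in the box of radius [L + L]. *)
exists (Cp + C1 * 2 ^ d)%N => S S' u z0 L Z uS' hS' sS hu L0 uZ hZ.
have /choice[g hg] : forall z, exists P, z \in Z -> z + u != 0 ->
    nzprime P /\ (P ^^ k) (phi (z + u)).
  move=> z; have [[zZ zu]|h] := pselect (z \in Z /\ z + u != 0).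
    by have [_ _ _ nV] := hZ z zZ; have [P pP hP] := not_kfree_prime zu nV; exists P.
  by exists O => ? ?; exfalso; apply: h.
pose Z' := [seq z <- Z | z + u != 0].
have hg' z : z \in Z' -> nzprime (g z) /\ (g z ^^ k) (phi (z + u)).
  by rewrite mem_filter => /andP[zu zZ]; apply: hg.
have sZ' z : z \in Z' -> z \in Z by rewrite mem_filter => /andP[].
pose T := undup (map g Z').
have uT : uniq T by apply: undup_uniq.
have hT P : P \in T -> [/\ nzprime P, P \notin S &
    (ideal_norm O P ^ k <= (Cp + C1 * 2 ^ d) * L ^ d)%N].
  rewrite mem_undup => /mapP[z zZ' ->]; have [pP hP] := hg' z zZ'.
  have [hz _ av _] := hZ z (sZ' _ zZ').
  split => //; first by apply/negP => /av.
  have nz := ideal_exp_nz phiD k pP.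
  rewrite -(ideal_norm_exp phiD k pP).
  have zu0 : z + u != 0 by move: zZ'; rewrite mem_filter => /andP[].
  apply: leq_trans (hC1 _ _ _ _ nz.1 (ideal_norm_index phiD nz) zu0 hP (inboxD hz hu)) _.
  by rewrite addnn -muln2 expnMn [(L ^ d * _)%N]mulnC mulnA leq_mul2r leq_addl orbT.
exists T; split => //.
have -> : size Z = (count (fun z => z + u == 0)%R Z + size Z')%N.
  by rewrite size_filter -(count_predC (fun z => z + u == 0)%R).
have c1 : (count (fun z => z + u == 0)%R Z <= 1)%N.
  have -> : count (fun z => z + u == 0)%R Z = count_mem (- u) Z.
    by apply: eq_count => z /=; rewrite addr_eq0.
  by rewrite count_uniq_mem//; case: (_ \in _).
rewrite natrD lerD//; first by rewrite -[leRHS]/(1%:R) ler_nat.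
have sz : (\sum_(P <- T) count (fun z => g z == P) Z')%N = size Z'.
  apply: sum_count_fibers => //; apply/allP => z zZ'.
  by rewrite mem_undup map_f.
rewrite -sz natr_sum big_seq [leRHS]big_seq; apply: ler_sum => P PT.
have [pP nPS _] := hT P PT.
set n := (\prod_(P <- S') ideal_norm O P ^ k)%N.
have nPS' : P \notin S' by apply/negP => /sS; apply/negP.
pose A := [seq z <- Z' | g z == P].
rewrite -size_filter -/A.
have hPS Q : Q \in P :: S' -> nzprime Q by rewrite inE => /predU1P[->|/hS'].
have uPS : uniq (P :: S') by rewrite /= nPS' uS'.
have hidx := prime_powers_index uPS hPS; rewrite big_cons -/n in hidx.
have idPS := prime_powers_ideal phiD k hPS.
have uA : uniq A by rewrite !filter_uniq.
have [z1 hz1] : exists z1, forall z, z \in A ->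
    inbox L z /\ prime_powers phi k (P :: S') (phi z - phi z1).
  case E : A uA => [|z1 A'] uA; first by exists 0.
  exists z1 => z; rewrite -E mem_filter => /andP[/eqP gz zZ'].
  have : z1 \in A by rewrite E inE eqxx.
  rewrite mem_filter => /andP[/eqP gz1 zZ1'].
  have [hz [Oz lz] _ _] := hZ z (sZ' _ zZ'); have [_ [Oz1 lz1] _ _] := hZ z1 (sZ' _ zZ1').
  split => //; split; first by rewrite -(orderB phiP); exists (z - z1).
  move=> Q; rewrite inE => /predU1P[->|QS'].
    have [_ h] := hg' z zZ'; have [_ h1] := hg' z1 zZ1'; rewrite gz in h; rewrite gz1 in h1.
    rewrite -(orderB phiP) -[z](addrK u) -addrA -opprD [(u + z1)]addrC (orderB phiP).
    exact: (idealB phiP (ideal_exp_nz phiD k pP).1).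
  have -> : phi z - phi z1 = (phi z - phi z0) - (phi z1 - phi z0).
    by rewrite opprB addrA subrK.
  by apply: (idealB phiP (ideal_exp_nz phiD k (hS' _ QS')).1); [apply: lz|apply: lz1].
have := hCp _ _ _ _ _ idPS hidx uA L0 hz1.
rewrite norm_weightE; set q := (ideal_norm O P ^ k)%N.
have q0 : (0 < q)%N by rewrite expn_gt0 (ideal_norm_gt0 phiD (nzprime_nz pP)).
have n0 : (0 < n)%N by apply: prime_norm_prod_gt0.
move=> h; apply: (@le_trans _ _ (Cp%:R * (q%:R^-1 * ((L ^ d)%N%:R / n%:R) + 1))).
  have qn0 : 0 < (q * n)%N%:R :> R by rewrite ltr0n muln_gt0 q0.
  have -> : Cp%:R * (q%:R^-1 * ((L ^ d)%N%:R / n%:R) + 1) =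
      (Cp * (L ^ d + q * n))%N%:R / (q * n)%N%:R :> R.
    rewrite !natrM natrD natrM; field.
    by rewrite !pnatr_eq0 -!lt0n q0 n0.
  by rewrite ler_pdivlMr// -natrM ler_nat mulnC.
by rewrite ler_wpM2r// ler_nat leq_addr.
Qed.

End Sieve.

Definition box_fset (d L : nat) : {fset 'rV[int]_d} := [fset v in box_seq d L]%fset.

Lemma mem_box_fset d L (v : 'rV[int]_d) : v \in box_fset d L <-> inbox L v.
Proof. by rewrite inE; apply: mem_box_seq. Qed.

Lemma box_fset_window d L : window (box_fset d L) L.
Proof.
split; last by move=> v /mem_box_fset.
move=> i v m n /mem_box_fset hv /mem_box_fset hn mn; apply/mem_box_fset => j.
have := hv j; have := hn j; rewrite !mxE !unit_rowE; case: eqP => _; last by rewrite addr0.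
by move=> /= h1 h2; lia.
Qed.

Lemma card_box_fset d L : #|` box_fset d L| = (L.*2.+1 ^ d)%N.
Proof. by rewrite card_fseq undup_id ?box_seq_uniq// size_box_seq. Qed.

Lemma fset_inbox d (F : {fset 'rV[int]_d}) : exists2 B, (0 < B)%N & forall v, v \in F -> inbox B v.
Proof.
suff [B hB] : exists B, forall v, v \in enum_fset F -> inbox B v.
  by exists B.+1 => // v vF; apply: (inbox_le (leqnSn B)); apply: hB.
elim: (enum_fset F) => [|x s [B hB]]; first by exists 0%N.
have [B' _ hB'] := inbox_ex x; exists (B + B')%N => v.
rewrite inE => /predU1P[->|/hB h]; first exact: (inbox_le (leq_addl _ _)).
exact: (inbox_le (leq_addr _ _)).
Qed.

(** * Realizing every subset of a patch, and the density of k-free vectors *)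

Section Hereditary.
Variables (R : realType) (K : fieldType) (d : nat) (phi : 'rV[int]_d -> K) (k : nat).
Hypothesis phiD : is_dedekind phi.
Hypothesis k2 : (2 <= k)%N.
Let phiP := dedekind_order phiD.
Local Notation O := (range phi).
Local Notation nzprime := (nzprime phi).
Local Notation "P ^^ k" := (ideal_exp O P k) (at level 30).
Local Notation w := (norm_weight R phi k).
Local Notation V := (kfree_vectors phi k).
Implicit Types (P : set K) (S T : seq (set K)) (v z u : 'rV[int]_d) (F X : {fset 'rV[int]_d}).

Definition small_tail S (e : R) := forall T, uniq T ->
  (forall P, P \in T -> nzprime P /\ P \notin S) -> \sum_(P <- T) w P <= e.

(** Each point to be removed gets its own prime, of norm large enough that this prime contains no
    short nonzero vector. *)
Lemma primes_for_removal (X0 : nat) S (D : seq 'rV[int]_d) : uniq D -> exists g : 'rV[int]_d -> set K,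
  (forall x, x \in D -> [/\ nzprime (g x), g x \notin S & (X0 < ideal_norm O (g x))%N]) /\
  {in D &, injective g}.
Proof.
elim: D => [|x D ih] /=; first by exists (fun=> O); split.
move=> /andP[xD /ih[g [hg ig]]].
have [P [pP]] := big_prime phiD X0 (S ++ map g D).
rewrite mem_cat negb_or => /andP[nPS nPD] XP.
exists (fun y => if y == x then P else g y); split.
  by move=> y; rewrite inE; case: eqP => //= _ /hg.
have gP y : y \in D -> g y <> P.
  by move=> yD e; move/negP: nPD; apply; rewrite -e map_f.
move=> y y'; rewrite !inE; case: eqP => [->|_]; case: eqP => [->|_] //=.
- by move=> _ /gP h /esym.
- by move=> /gP h _.
- exact: ig.
Qed.

(** From [N ^ 2 <= N ^ k <= C * M ^ 2] the norm is at most [C * M]. With [M ^ 2] the volume scale of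
    a box, the rounding errors have the order of its square root. They must be negligible against a
    residue class whose modulus depends on the primes already chosen, so a small proportion of the
    volume would not do. *)
Lemma few_small_primes C : exists C', forall M T, uniq T ->
  (forall P, P \in T -> nzprime P /\ (ideal_norm O P ^ k <= C * M ^ 2)%N) ->
  (size T <= C' * M)%N.
Proof.
have [C3 C30 hC3] := ideal_count phiP; exists (C3 * C)%N => M T uT hT.
rewrite -mulnA; apply: hC3 => // P /hT[pP hP]; have nz := nzprime_nz pP.
split; first by case: nz.
exists (ideal_norm O P); first exact: (ideal_norm_index phiD nz).
have N0 := ideal_norm_gt0 phiD nz; rewrite leqNgt; apply/negP => h.
have : (ideal_norm O P ^ 2 <= C * M ^ 2)%N by apply: leq_trans hP; apply: leq_pexp2l.
rewrite leqNgt => /negP; apply; apply: (@leq_ltn_trans ((C * M) ^ 2)).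
  by rewrite expnMn leq_mul2r; case: (C) => [|c]; rewrite ?orbT// leq_expn_self ?orbT.
by rewrite ltn_exp2r.
Qed.

(* By the Chinese remainder theorem, a whole coset of vectors [z] makes [v + z]
   divisible by the [k]-th power of a private prime for each [v] outside [X], and
   keeps [x + z] free of the primes in a finite set [S] for [x] in [X]. In a box of
   side [m ^ 2] (so that the square root of its volume is an integer), the
   divisors outside [S] destroy only a fraction of that coset. *)
Lemma kfree_hereditary F X : {subset X <= F} -> (forall x, x \in X -> V x) ->
  exists z, forall v, v \in F -> V (v + z) <-> v \in X.
Proof.
move=> XF XV; have [B B0 hB] := fset_inbox F.
have [C1 C10 hC1] := index_inbox phiP.
have [Cb hCb] := bad_primes R k phiD.
have [C3 hC3] := few_small_primes Cb.
have [zt hzt zt1] := zeta_sum R phiD k2.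
pose a := #|` X|.
(* Makes [a * Cb * e] at most 1/2: up to terms of lower order, the primes outside [S] then destroy
   at most half of the guaranteed [M ^ 2 / n] points of the class. *)
pose e : R := (2 * (a.+1 * Cb.+1)%N%:R)^-1.
have e0 : 0 < e by rewrite invr_gt0 mulr_gt0// ltr0n muln_gt0.
have [S0 [uS0 hS0 _ tS0]] := euler_product_approx phiD hzt zt1 e0.
pose D := [seq x <- F | x \notin X].
have uD : uniq D by rewrite filter_uniq// fset_uniq.
(* By [index_inbox], a prime of such norm contains no nonzero difference of two points of [F], so
   removing one point harms no point of [X]. *)
have [g [hg ig]] := primes_for_removal (C1 * (B + B) ^ d) S0 uD.
pose S := S0 ++ map g D.
have hS P : P \in S -> nzprime P.
  by rewrite mem_cat => /orP[/hS0//|/mapP[x /hg[? _ _] ->]].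
have uS : uniq S.
  rewrite cat_uniq uS0 map_inj_in_uniq// uD andbT.
  by apply/hasPn => _ /mapP[x /hg[_ + _] ->].
(* Modulo the primes of [S0] the shift is 0, so that a point of [X] stays outside [P ^^ k]; modulo
   the private prime of a removed [x] it is [- x]. *)
pose aim P := if P \in S0 then 0 else - phi (nth 0 D (index P (map g D))).
have Oaim P : O (aim P).
  rewrite /aim; case: ifP => _; first exact: (O_subgroup phiP).1.
  by rewrite -(orderN phiP); exists (- nth 0 D (index P (map g D))).
have [z0 hz0] := crt_solution k phiD uS hS Oaim.
have aimg x : x \in D -> aim (g x) = - phi x.
  move=> xD; have [_ /negPf h _] := hg x xD; rewrite /aim h; congr (- phi _).
  rewrite -(nth_index 0 xD) -(nth_map 0 (g 0)) ?index_mem//.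
  by rewrite index_uniq ?size_map ?index_mem// map_inj_in_uniq.
have [s [hs szs _]] := prime_powers_transversal phiD k uS hS.
have idS := prime_powers_ideal phiD k hS; have sS := ideal_subgroup phiP idS.
pose W x := `[< prime_powers phi k S (x - phi z0) >].
have hW x y : prime_powers phi k S (x - y) -> W x -> W y.
  move=> h /asboolP Wx; apply/asboolP; rewrite -[y](subrK x) -addrA.
  by apply: subgroupD => //; apply: subgroup_swap.
have cW : count W s = 1%N.
  have Oz : O (- phi z0) by rewrite -(orderN phiP); exists (- z0).
  have := transversal_count1 phiD sS (transversal_shift phiP sS Oz hs).
  by rewrite count_map.
have [CS hCS] := density_bounds phiP sS hs hW.
rewrite cW szs in hCS; set n := (\prod_(P <- S) ideal_norm O P ^ k)%N in hCS.
have n0 : (0 < n)%N by apply: prime_norm_prod_gt0.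
(* Large enough that [F] fits in the box, that the boundary error with [CS] takes at most half of
   the box, and that the terms of order [M] stay below half of [M ^ 2]. *)
pose m := (B + CS + 2 * (n * a * (1 + Cb * C3)))%N.+1.
pose L := (m ^ 2)%N; pose M := (m ^ d)%N.
have d0 := order_dim_gt0 phiP.
have LM : (L ^ d = M ^ 2)%N by rewrite /L /M -!expnM mulnC.
have mL : (m <= L)%N by rewrite /L -mulnn leq_pmulr.
have L0 : (0 < L)%N by apply: leq_trans mL.
have mM : (m <= M)%N by apply: leq_expn_self.
pose Z := [seq z <- box_fset d L | W (phi z)].
have uZ : uniq Z by rewrite filter_uniq// fset_uniq.
have szZ : (M ^ 2 <= n * size Z)%N.
  have [_ h] := hCS _ _ 0 (box_fset_window d L); rewrite card_box_fset mul1n in h.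
  have -> : size Z = count (fun v => W (phi (v + 0)%R)) (box_fset d L).
    by rewrite size_filter; apply: eq_count => v /=; rewrite addr0.
  move: h; set c := count _ _ => h; rewrite -LM.
  have hL : (2 * L ^ d <= L.*2.+1 ^ d)%N.
    apply: (@leq_trans ((2 * L) ^ d)); last by rewrite leq_exp2r// mul2n.
    by rewrite expnMn leq_mul2r leq_expn_self ?orbT.
  have hC : (2 * (CS * L.*2.+1 ^ d.-1) <= L.*2.+1 ^ d)%N.
    rewrite -(prednK d0) [d.-1.+1.-1]/= expnS mulnA leq_mul2r; apply/orP; right.
    have h1 : (CS <= m)%N by rewrite /m; lia.
    have h2 : (CS <= L)%N by apply: leq_trans mL.
    by rewrite -muln2 mulnC; apply: leqW; rewrite leq_mul2r h2 orbT.
  lia.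
have hZ z : z \in Z -> [/\ inbox L z & prime_powers phi k S (phi z - phi z0)].
  by rewrite mem_filter => /andP[/asboolP ? /mem_box_fset].
have bad_g z x : z \in Z -> x \in D -> (g x ^^ k) (phi (x + z)).
  move=> /hZ[_ [_ h]] xD; have gS : g x \in S by rewrite mem_cat map_f ?orbT.
  have := hz0 _ gS; rewrite aimg// opprK => h0.
  have -> : phi (x + z) = (phi z - phi z0) + (phi z0 + phi x).
    by rewrite (orderD phiP) addrA subrK addrC.
  by apply: (idealD (ideal_exp_nz phiD k (hS _ gS)).1) => //; apply: h.
have inF x : x \in D -> x \in F by rewrite mem_filter => /andP[].
have avS z x : z \in Z -> x \in X -> avoids phi k S (phi (z + x)).
  move=> zZ xX P PS Pzx; have idP := (ideal_exp_nz phiD k (hS _ PS)).1.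
  move: (PS); rewrite mem_cat => /orP[PS0|/mapP[y yD PE]].
    have [_ _ /(_ P (hS _ PS))] := (kfreeE phiD k _).1 (XV x xX); apply.
    have -> : phi x = phi (z + x) - (phi z - phi z0) - (phi z0 - 0).
      by rewrite (orderD phiP); ring.
    apply: (idealB phiP idP); last by have := hz0 _ PS; rewrite /aim PS0.
    by apply: (idealB phiP idP) => //; have [_ [_ h]] := hZ z zZ; apply: h.
  rewrite PE in Pzx idP PS *; have [pg _] := hg y yD; rewrite ltnNge => /negP; apply.
  have nz := nzprime_nz pg; have yx : x - y != 0.
    rewrite subr_eq0; apply/eqP => e1; move: yD; rewrite mem_filter -e1 xX.
    by [].
  apply: (hC1 _ _ _ _ nz.1 (ideal_norm_index phiD nz) yx).
    have h : (g y ^^ k) (phi (x - y)).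
      have -> : phi (x - y) = phi (z + x) - phi (y + z).
        by rewrite -(orderB phiP); congr phi; rewrite opprD [z + x]addrC addrACA subrr addr0.
      by apply: (idealB phiP idP) => //; apply: bad_g.
    case: (k) k2 h => // k' _ /=.
    by apply: (ideal_mul_subl phiP nz.1); apply: (ideal_exp_nz phiD k' pg).1.
  by apply: inboxD; [apply: hB; apply: XF|apply: inboxN; apply: hB; apply: inF].
have [z zZ hz] : exists2 z, z \in Z & forall x, x \in X -> V (z + x).
  (* If every [z] of the class fails at some [x] in [X], the class is covered by the [a] sets [Zx],
     which are too small together. *)
  apply: contrapT => hn.
  pose Zx x := [seq z <- Z | ~~ `[< V (z + x) >]].
  have le1 : (size Z <= \sum_(x <- X) size (Zx x))%N.
    under eq_bigr do rewrite size_filter -sum1_count big_mkcond.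
    rewrite exchange_big /= -sum1_size big_seq [X in (_ <= X)%N]big_seq.
    apply: leq_sum => z zZ; rewrite -big_mkcond sum1_count -has_count.
    apply/hasP; apply: contrapT => hz; apply: hn; exists z => // x xX.
    by apply: contrapT => nV; apply: hz; exists x => //; apply/asboolPn.
  have le2 x : x \in X -> (size (Zx x))%:R <=
      1 + Cb%:R * (e * ((M ^ 2)%N%:R / n%:R) + (C3 * M)%N%:R) :> R.
    move=> xX; have xL : inbox L x.
      by apply: inbox_le (hB _ (XF _ xX)); apply: leq_trans mL; rewrite /m; lia.
    have [||T [uT hT hT2]] := hCb S S x z0 L (Zx x) uS hS (fun _ h => h) xL L0.
    - by rewrite filter_uniq.
    - move=> z; rewrite mem_filter => /andP[/asboolPn nV zZ].
      by have [h1 h2] := hZ z zZ; split => //; apply: avS.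
    apply: le_trans hT2 _; rewrite lerD2l -mulr_sumr ler_wpM2l// big_split /=.
    rewrite -mulr_suml -/n LM lerD//.
      rewrite ler_wpM2r// ?divr_ge0// tS0// => P PT; have [pP + _] := hT P PT.
      by rewrite mem_cat negb_or => /andP[].
    rewrite big_const_seq count_predT iter_addr_0 ler_nat; apply: hC3 => // P PT.
    by have [pP _ h] := hT P PT; rewrite -LM.
  have : (size Z)%:R <= a%:R * (1 + Cb%:R * (e * ((M ^ 2)%N%:R / n%:R) + (C3 * M)%N%:R)) :> R.
    apply: (@le_trans _ _ (\sum_(x <- X) (size (Zx x))%:R)).
      by rewrite -natr_sum ler_nat.
    rewrite big_seq; apply: le_trans (ler_sum _ le2) _.
    by rewrite -big_seq big_const_seq count_predT iter_addr_0 -[X in X <= _]mulr_natl.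
  have nR : 0 < n%:R :> R by rewrite ltr0n.
  move=> h; have : (M ^ 2)%N%:R <= n%:R * (a%:R * (1 + Cb%:R * (e * ((M ^ 2)%N%:R / n%:R) + (C3 * M)%N%:R))) :> R.
    apply: (@le_trans _ _ (n%:R * (size Z)%:R)); first by rewrite -natrM ler_nat.
    by rewrite ler_wpM2l// ltW.
  have -> : n%:R * (a%:R * (1 + Cb%:R * (e * ((M ^ 2)%N%:R / n%:R) + (C3 * M)%N%:R))) =
     (n * a)%N%:R + (a * Cb)%N%:R * e * (M ^ 2)%N%:R + (n * a * Cb * C3)%N%:R * M%:R :> R.
    by rewrite !natrM; field; rewrite gt_eqF.
  have he : (a * Cb)%N%:R * e <= 2^-1.
    rewrite /e invfM mulrCA -[leRHS]mulr1 ler_wpM2l// ?invr_ge0// ler_pdivrMr.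
      by rewrite mul1r ler_nat leq_mul.
    by rewrite ltr0n muln_gt0.
  have hM : (2 * (n * a * (1 + Cb * C3)) < M)%N by apply: leq_trans mM; rewrite /m; lia.
  have h2 : (2 * (n * a * (1 + Cb * C3)))%N%:R < M%:R :> R by rewrite ltr_nat.
  have M1 : 1 <= M%:R :> R by rewrite ler1n (leq_trans _ hM).
  have le3 : (a * Cb)%N%:R * e * (M ^ 2)%N%:R <= 2^-1 * (M ^ 2)%N%:R :> R by rewrite ler_wpM2r.
  have h4 : (2 * (n * a * (1 + Cb * C3)))%N%:R * M%:R < (M ^ 2)%N%:R :> R.
    by rewrite natrX expr2 ltr_pM2r// (lt_le_trans _ M1).
  have h5 : (n * a)%N%:R <= (n * a)%N%:R * M%:R :> R by rewrite ler_peMr.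
  have E : (2 * (n * a * (1 + Cb * C3)))%N%:R =
      2 * ((n * a)%N%:R + (n * a * Cb * C3)%N%:R) :> R.
    by rewrite -natrD -natrM; congr (_%:R); rewrite mulnDr muln1 !mulnA.
  rewrite E in h4; move: h4 h5 le3.
  move: ((n * a)%N%:R : R) ((n * a * Cb * C3)%N%:R : R) (M%:R : R) ((M ^ 2)%N%:R : R) => p q r t.
  move: ((a * Cb)%N%:R * e * t) => y h4 h5 le3 h6.
  have E2 : 2 * (p + q) * r = 2 * (p * r + q * r) by ring.
  by rewrite E2 in h4; lra.
exists z => v vF; rewrite addrC; split=> [hV|]; last exact: hz.
apply: contrapT => /negP vX.
have vD : v \in D by rewrite mem_filter vX.
have [_ _ /(_ (g v))] := (kfreeE phiD k _).1 hV; apply; first by have [] := hg v vD.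
by rewrite addrC; apply: bad_g.
Qed.

(** [bad_primes] with no prescribed residue. Here the rounding term can be absorbed:
    [N(P)^k <= Cb * B ^ d] means [1 <= Cb * B ^ d * w P], whence the constant [Cb * (1 + Cb)]. *)
Lemma density_gap : exists C : nat, forall S (e : R) F B, small_tail S e -> (0 < B)%N ->
  (forall v, v \in F -> inbox B v) ->
  (count (fun v => `[< avoids phi k S (phi v) >]) F)%:R <=
  (count (fun v => `[< V v >]) F)%:R + 1 + C%:R * e * (B ^ d)%N%:R.
Proof.
have [Cb hCb] := bad_primes R k phiD; exists (Cb * (1 + Cb))%N => S e F B hS B0 hF.
pose Z := [seq v <- F | `[< avoids phi k S (phi v) >] && ~~ `[< V v >]].
have h0 P : P \in [::] -> nzprime P by [].
have hs : {subset ([::] : seq (set K)) <= S} by [].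
have hu : inbox B (0 : 'rV[int]_d) by move=> i; rewrite mxE.
have uZ : uniq Z by rewrite filter_uniq// fset_uniq.
have [|T [uT hT hT2]] := hCb S [::] 0 0 B Z isT h0 hs hu B0 uZ.
  move=> z; rewrite mem_filter addr0 => /andP[/andP[/asboolP ? /asboolPn ?] zF].
  split => //; first exact: hF.
  by split => //; rewrite -(orderB phiP); exists (z - 0).
have le : (count (fun v => `[< avoids phi k S (phi v) >]) F <=
    count (fun v => `[< V v >]) F + size Z)%N.
  rewrite size_filter (count_split _ (fun v => `[< V v >])); apply: leq_add.
    by apply: sub_count => v /= /andP[].
  by apply: sub_count => v /= /andP[-> ->].
have : (count (fun v => `[< avoids phi k S (phi v) >]) F)%:R <=
    (count (fun v => `[< V v >]) F)%:R + (size Z)%:R :> R by rewrite -natrD ler_nat.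
move=> h; apply: le_trans h _; rewrite -addrA lerD2l; apply: le_trans hT2 _.
rewrite lerD2l big_nil divr1.
have B1 : 0 <= (B ^ d)%N%:R :> R by [].
apply: (@le_trans _ _ (\sum_(P <- T) (Cb * (1 + Cb))%N%:R * (B ^ d)%N%:R * w P)).
  rewrite big_seq [leRHS]big_seq; apply: ler_sum => P /hT[pP _ hP].
  have q0 : 0 < (ideal_norm O P ^ k)%N%:R :> R.
    by rewrite ltr0n expn_gt0 (ideal_norm_gt0 phiD (nzprime_nz pP)).
  have h1 : 1 <= Cb%:R * (B ^ d)%N%:R * w P.
    by rewrite norm_weightE -natrM ler_pdivlMr// mul1r ler_nat.
  rewrite natrM natrD -!mulrA ler_wpM2l// mulrDl mul1r mulrC lerD2l.
  by rewrite mulrA.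
rewrite -mulr_sumr; apply: (@le_trans _ _ ((Cb * (1 + Cb))%N%:R * (B ^ d)%N%:R * e)).
  rewrite ler_wpM2l ?mulr_ge0//; apply: hS => // P /hT[pP nPS _]; by [].
by rewrite mulrAC.
Qed.

End Hereditary.

(** * Counting patches *)

Definition patch_set (d : nat) (V D : set 'rV[int]_d) (z : 'rV[int]_d) : set 'rV[int]_d :=
  [set m | V (m + z) /\ D m].

Definition patch_count (d : nat) (V D : set 'rV[int]_d) : nat :=
  #|` fset_set [set patch_set V D z | z in [set: 'rV[int]_d]]|.

Section PatchCount.
Variable d : nat.
Implicit Types (V D : set 'rV[int]_d) (F X : {fset 'rV[int]_d}).

Lemma card_fset_set_le (T : choiceType) (A : set T) (s : seq T) :
  A `<=` [set` s] -> (#|` fset_set A| <= size s)%N.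
Proof.
move=> As; have fA : finite_set A by apply: sub_finite_set As _; apply: finite_seq.
by apply: uniq_leq_size (fset_uniq _) _ => x; rewrite in_fset_set// inE => /As.
Qed.

Lemma card_fset_set_ge (T : choiceType) (A : set T) (s : seq T) :
  finite_set A -> uniq s -> [set` s] `<=` A -> (size s <= #|` fset_set A|)%N.
Proof.
move=> fA us sA; apply: uniq_leq_size us _ => x xs.
by rewrite in_fset_set// inE; apply: sA.
Qed.

Lemma patches_finite V F : finite_set [set patch_set V [set` F] z | z in [set: 'rV[int]_d]].
Proof.
apply: (@sub_finite_set _ _ [set` [seq [set` X] | X <- fpowerset F]]); last exact: finite_seq.
move=> _ [z _ <-] /=; apply/mapP; exists [fset v in F | `[< V (v + z)%R >]]%fset.
  by rewrite fpowersetE; apply/fsubsetP => v; rewrite !inE => /andP[].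
apply/seteqP; split => v /=; rewrite !inE.
  by move=> [hV vF]; rewrite vF; apply/asboolP.
by move=> /andP[vF /asboolP hV].
Qed.

Lemma set_fset_inj : injective (fun X : {fset 'rV[int]_d} => [set` X]).
Proof. by move=> X Y e; rewrite -[X]set_fsetK e set_fsetK. Qed.

End PatchCount.

Section PatchRate.
Variables (R : realType) (K : fieldType) (d : nat) (phi : 'rV[int]_d -> K) (k : nat).
Hypothesis phiD : is_dedekind phi.
Hypothesis k2 : (2 <= k)%N.
Let phiP := dedekind_order phiD.
Local Notation O := (range phi).
Local Notation nzprime := (nzprime phi).
Local Notation w := (norm_weight R phi k).
Local Notation V := (kfree_vectors phi k).
Implicit Types (S T : seq (set K)) (v z u : 'rV[int]_d) (F X : {fset 'rV[int]_d}).

Lemma patch_count_ge F : (2 ^ count (fun v => `[< V v >]) F <= patch_count V [set` F])%N.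
Proof.
pose G := [fset v in F | `[< V v >]]%fset.
have GF : {subset G <= F} by move=> v; rewrite !inE => /andP[].
have -> : count (fun v => `[< V v >]) F = #|` G|.
  rewrite -size_filter; apply/eqP; rewrite eqn_leq; apply/andP; split.
    apply: uniq_leq_size; first by rewrite filter_uniq// fset_uniq.
    by move=> v; rewrite mem_filter !inE => /andP[-> ->].
  apply: uniq_leq_size; first exact: fset_uniq.
  by move=> v; rewrite mem_filter !inE => /andP[-> ->].
rewrite -card_fpowerset -(size_map (fun X : {fset 'rV[int]_d} => [set` X])).
apply: card_fset_set_ge; first exact: patches_finite.
  by rewrite map_inj_uniq ?fset_uniq//; apply: set_fset_inj.
move=> _ /mapP[X + ->]; rewrite fpowersetE => /fsubsetP XG.
have XF : {subset X <= F} by move=> v /XG/GF.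
have XV v : v \in X -> V v by move=> /XG; rewrite !inE => /andP[_ /asboolP].
have [z hz] := kfree_hereditary R phiD k2 XF XV.
exists z => //; apply/seteqP; split => v /=; first by move=> [hv vF]; apply/hz.
by move=> vX; split; [apply/hz => //; apply: XF|apply: XF].
Qed.

Lemma kfree_avoids S v : (forall P, P \in S -> nzprime P) -> V v -> avoids phi k S (phi v).
Proof. by move=> hS /(kfreeE phiD k)[_ _ h] P /hS/h. Qed.

(** If [x] represents [z] modulo the prime powers, the patch at [z] is a subset of the points of [F]
    that the sieve allows after a shift by [x]: [size s] choices of [x], then at most [2 ^ M]
    subsets. *)
Lemma patch_count_le S s F M : (forall P, P \in S -> nzprime P) ->
  transversal O (prime_powers phi k S) s ->
  (forall z, (count (fun v => `[< avoids phi k S (phi (v + z)%R) >]) F <= M)%N) ->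
  (patch_count V [set` F] <= size s * 2 ^ M)%N.
Proof.
move=> hS hs hM; have [sO _ cs] := hs.
have /choice[t ht] : forall x, exists z, O x -> phi z = x.
  by move=> x; have [[z _ <-]|h] := pselect (O x); [exists z|exists 0].
pose G x := [fset v in F | `[< avoids phi k S (phi (v + t x)%R) >]]%fset.
pose l := [seq [set` X] | X <- flatten [seq enum_fset (fpowerset (G x)) | x <- s]].
apply: (@leq_trans (size l)).
  apply: card_fset_set_le => _ [z _ <-] /=; apply/mapP.
  exists [fset v in F | `[< V (v + z)%R >]]%fset.
    have Oz : O (phi z) by exists z.
    have [x xs hx] := cs _ Oz; apply/flattenP; exists (enum_fset (fpowerset (G x))).
      exact: map_f.
    rewrite fpowersetE; apply/fsubsetP => v; rewrite !inE => /andP[vF /asboolP hV].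
    rewrite vF /=; apply/asboolP; apply: (avoids_mod phiD hS) (kfree_avoids hS hV).
    rewrite !(orderD phiP) (ht x (sO _ xs)) opprD addrACA subrr add0r; exact: hx.
  apply/seteqP; split => v /=; rewrite !inE.
    by move=> [hV vF]; rewrite vF; apply/asboolP.
  by move=> /andP[vF /asboolP hV].
rewrite size_map size_flatten /shape sumnE big_map big_map.
apply: (@leq_trans (\sum_(x <- s) 2 ^ M)%N); last by rewrite sum_cst_seq.
apply: leq_sum => x _; rewrite -/(card_fset _) card_fpowerset leq_pexp2l//.
apply: leq_trans (hM (t x)); rewrite -size_filter; apply: uniq_leq_size; first exact: fset_uniq.
by move=> v; rewrite mem_filter !inE => /andP[-> ->].
Qed.

Lemma prod_density S : (forall P, P \in S -> nzprime P) ->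
  (\prod_(P <- S) (ideal_norm O P ^ k).-1)%N%:R / (\prod_(P <- S) ideal_norm O P ^ k)%N%:R =
  \prod_(P <- S) (1 - w P) :> R.
Proof.
elim: S => [|P S ih] hS; first by rewrite !big_nil divr1.
rewrite !big_cons !natrM -ih; last by move=> Q QS; apply: hS; rewrite inE QS orbT.
have pP : nzprime P by apply: hS; rewrite inE eqxx.
have q0 : (0 < ideal_norm O P ^ k)%N.
  by rewrite expn_gt0 (ideal_norm_gt0 phiD (nzprime_nz pP)).
have n0 : (0 < \prod_(Q <- S) ideal_norm O Q ^ k)%N.
  by apply: (prime_norm_prod_gt0 k phiD) => Q QS; apply: hS; rewrite inE QS orbT.
rewrite norm_weightE -subn1 natrB//; field.
by rewrite !pnatr_eq0 -!lt0n q0 n0.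
Qed.

(** [C] depends on [eps] through the sieving set [S], but not on the window, so the boundary term
    disappears after division by the volume. The density [dn] of the sieve lies between [1 / zt] and
    [1 / zt + e]: the lower bound on patches uses the first inequality, the upper bound the
    second. *)
Lemma patch_asymptotics zt eps : is_sum w (nonzero_ideal O) zt -> 1 <= zt -> 0 < eps ->
  exists2 C : R, 0 <= C & forall F B, window F B -> (0 < B)%N ->
    `|ln (patch_count V [set` F])%:R - ln 2 / zt * #|` F|%:R| <=
      eps * (B ^ d)%N%:R + C * (B ^ d.-1)%N%:R.
Proof.
move=> hzt zt1 eps0; have [Cg hCg] := density_gap R k phiD.
have d0 := order_dim_gt0 phiP.
have l0 : 0 < ln 2 :> R by apply: ln_gt0; rewrite ltr1n.
(* Room for both errors proportional to [e]: [3 ^ d] from the bound [3 ^ d * B ^ d] on the size of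
   [F] in the upper estimate, [Cg] from [density_gap] in the lower one. *)
pose E : R := (3 ^ d + Cg.+1)%N%:R.
have E0 : 0 < E by rewrite ltr0n addnS.
pose e := eps / (ln 2 * E).
have e0 : 0 < e by rewrite divr_gt0// mulr_gt0.
have eE : ln 2 * e * E = eps by rewrite /e; field; rewrite !gt_eqF.
have [S [uS hS hup htail]] := euler_product_approx phiD hzt zt1 e0.
have hlow := euler_product_ge phiD uS hS hzt zt1.
have [s [hs szs cs]] := prime_powers_transversal phiD k uS hS.
have idS := prime_powers_ideal phiD k hS; have sS := ideal_subgroup phiP idS.
pose W x := `[< avoids phi k S x >].
have hW x y : prime_powers phi k S (x - y) -> W x -> W y.
  by move=> h /asboolP Wx; apply/asboolP; apply: (avoids_mod phiD hS) Wx.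
have [CS hCS] := density_bounds phiP sS hs hW.
rewrite cs szs in hCS.
set n := (\prod_(P <- S) ideal_norm O P ^ k)%N in szs hCS.
set c := (\prod_(P <- S) (ideal_norm O P ^ k).-1)%N in cs hCS.
have n0 : (0 < n)%N by apply: prime_norm_prod_gt0.
have n1 : 1 <= n%:R :> R by rewrite ler1n.
have := prod_density hS; rewrite -/n -/c => cn; rewrite -cn in hup hlow.
set dn := c%:R / n%:R in hup hlow.
pose C3 : R := CS%:R * 3 ^+ d.-1.
exists (ln n%:R + ln 2 * (C3 + 1)).
  by rewrite addr_ge0 ?ln_ge0// mulr_ge0 ?(ltW l0)// addr_ge0// mulr_ge0// exprn_ge0.
move=> F B hF B0; have hFB := hF.2.
have B3 : (B.*2.+1 <= 3 * B)%N by lia.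
have err : (CS * B.*2.+1 ^ d.-1)%N%:R / n%:R <= C3 * (B ^ d.-1)%N%:R.
  apply: (@le_trans _ _ ((CS * B.*2.+1 ^ d.-1)%N%:R)).
    by rewrite ler_pdivrMr ?ltr0n// ler_peMr.
  rewrite natrM -mulrA ler_wpM2l// -!natrX -natrM ler_nat -expnMn.
  by case: (d.-1) => [//|m]; rewrite leq_exp2r.
have cardF : #|` F|%:R <= (3 ^ d)%N%:R * (B ^ d)%N%:R :> R.
  rewrite -natrM ler_nat -expnMn; apply: (@leq_trans (B.*2.+1 ^ d)); last by rewrite leq_exp2r.
  rewrite -size_box_seq; apply: uniq_leq_size (fset_uniq _) _ => v vF.
  by apply/mem_box_seq; apply: hFB.
have Bd1 : 1 <= (B ^ d.-1)%N%:R :> R by rewrite ler1n expn_gt0 B0.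
have Bd0 : 0 <= (B ^ d)%N%:R :> R by [].
have F0 : 0 <= #|` F|%:R :> R by [].
have hdn (x y : nat) : (n * x <= c * #|` F| + y)%N -> x%:R <= dn * #|` F|%:R + y%:R / n%:R :> R.
  move=> h; have -> : dn * #|` F|%:R + y%:R / n%:R = (c * #|` F| + y)%N%:R / n%:R :> R.
    by rewrite /dn natrD natrM; field; rewrite gt_eqF// ltr0n.
  by rewrite ler_pdivlMr ?ltr0n// -natrM ler_nat mulnC.
have p0 : (0 < patch_count V [set` F])%N by apply: leq_trans (patch_count_ge F); rewrite expn_gt0.
rewrite ler_norml; apply/andP; split.
  have h1 : ln 2 * (count (fun v => `[< V v >]) F)%:R <= ln (patch_count V [set` F])%:R :> R.
    rewrite -[ln 2 * _]mulrC mulr_natl -lnXn// ler_ln ?posrE ?exprn_gt0 ?ltr0n//.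
    by rewrite -natrX ler_nat patch_count_ge.
  have h2 := hCg S e F B htail B0 hFB.
  have [_ h3] := hCS F B 0 hF.
  have h3' : dn * #|` F|%:R <= (count (fun v => W (phi v)) F)%:R + C3 * (B ^ d.-1)%N%:R.
    rewrite -lerBlDr; apply: (@le_trans _ _ (dn * #|` F|%:R - (CS * B.*2.+1 ^ d.-1)%N%:R / n%:R)).
      by rewrite lerB.
    rewrite lerBlDr (eq_count (a2 := fun v => W (phi (v + 0)%R))); last by move=> v /=; rewrite addr0.
    move: h3; set x := count _ _ => h3.
    have -> : x%:R + (CS * B.*2.+1 ^ d.-1)%N%:R / n%:R = (n * x + CS * B.*2.+1 ^ d.-1)%N%:R / n%:R :> R.
      by rewrite natrD natrM; field; rewrite gt_eqF// ltr0n.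
    by rewrite /dn mulrAC ler_wpM2r ?invr_ge0// -natrM ler_nat.
  have h4 : zt^-1 * #|` F|%:R <= dn * #|` F|%:R by rewrite ler_wpM2r.
  rewrite -/(W _) in h2.
  have h5 : zt^-1 * #|` F|%:R <= (count (fun v => `[< V v >]) F)%:R + 1 + Cg%:R * e * (B ^ d)%N%:R
      + C3 * (B ^ d.-1)%N%:R.
    by apply: le_trans h4 _; apply: le_trans h3' _; rewrite lerD2r.
  have h6 : ln 2 * (zt^-1 * #|` F|%:R) <= ln 2 * ((count (fun v => `[< V v >]) F)%:R + 1 +
      Cg%:R * e * (B ^ d)%N%:R + C3 * (B ^ d.-1)%N%:R) by rewrite ler_wpM2l// ltW.
  have h7 : ln 2 * (Cg%:R * e * (B ^ d)%N%:R) <= eps * (B ^ d)%N%:R.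
    rewrite mulrA ler_wpM2r// -eE [Cg%:R * e]mulrC mulrA ler_wpM2l ?(mulr_ge0 (ltW l0) (ltW e0))//.
    by rewrite /E ler_nat addnS leqW// leq_addl.
  have h8 : ln 2 <= ln 2 * (B ^ d.-1)%N%:R :> R by apply: ler_peMr; rewrite ?(ltW l0).
  have h9 : 0 <= ln n%:R * (B ^ d.-1)%N%:R :> R by rewrite mulr_ge0 ?ln_ge0.
  move: h1 h6 h7 h8 h9; rewrite !mulrDr !mulrDl; lra.
pose M := ((c * #|` F| + CS * B.*2.+1 ^ d.-1) %/ n)%N.
have hM z : (count (fun v => `[< avoids phi k S (phi (v + z)%R) >]) F <= M)%N.
  rewrite /M leq_divRL// mulnC; have [h _] := hCS F B z hF; exact: h.
have := patch_count_le hS hs hM; rewrite szs -/n => hp.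
have h1 : ln (patch_count V [set` F])%:R <= ln n%:R + ln 2 * M%:R :> R.
  rewrite -[ln 2 * _]mulrC mulr_natl -lnXn// -lnM ?posrE ?exprn_gt0 ?ltr0n//.
  by rewrite ler_ln ?posrE ?mulr_gt0 ?exprn_gt0 ?ltr0n// -natrX -natrM ler_nat.
have h2 : M%:R <= dn * #|` F|%:R + C3 * (B ^ d.-1)%N%:R.
  apply: (@le_trans _ _ (dn * #|` F|%:R + (CS * B.*2.+1 ^ d.-1)%N%:R / n%:R)); last by rewrite lerD2l.
  by apply: hdn; rewrite /M mulnC leq_trunc_div.
have h3 : dn * #|` F|%:R <= (zt^-1 + e) * #|` F|%:R by rewrite ler_wpM2r.
have h4 : e * #|` F|%:R <= e * ((3 ^ d)%N%:R * (B ^ d)%N%:R) by rewrite ler_wpM2l// ltW.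
have h5 : ln 2 * M%:R <= ln 2 * (zt^-1 * #|` F|%:R + e * ((3 ^ d)%N%:R * (B ^ d)%N%:R) +
   C3 * (B ^ d.-1)%N%:R).
  rewrite ler_wpM2l ?(ltW l0)//; apply: le_trans h2 _; rewrite lerD2r.
  by apply: le_trans h3 _; rewrite mulrDl lerD2l.
have h6 : ln 2 * (e * ((3 ^ d)%N%:R * (B ^ d)%N%:R)) <= eps * (B ^ d)%N%:R.
  rewrite [e * (_ * _)]mulrA mulrA ler_wpM2r// -eE -[leRHS]mulrA.
  rewrite ler_wpM2l ?(ltW l0)// ler_wpM2l ?(ltW e0)//.
  by rewrite /E ler_nat addnS leqW// leq_addr.
have h7 : ln n%:R <= ln n%:R * (B ^ d.-1)%N%:R :> R.
  by apply: ler_peMr => //; apply: ln_ge0.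
have h8 : 0 <= ln 2 * (B ^ d.-1)%N%:R :> R by apply: mulr_ge0; rewrite ?(ltW l0).
move: h1 h5 h6 h7 h8; rewrite !mulrDr !mulrDl; lra.
Qed.

End PatchRate.

(** * Volumes of balls *)

Section Volume.
Variable R : realType.
Local Open Scope ereal_scope.

(** The integral of a nonnegative function is a supremum over the simple functions below it, so
    monotonicity needs no measurability. The volume of the ball can thus be squeezed without proving
    its partial integrals measurable. *)
Lemma ge0_le_integral_nonmeasurable (f g : R -> \bar R) :
  (forall x, 0 <= f x) -> (forall x, f x <= g x) ->
  \int[lebesgue_measure]_(x in [set: R]) f x <= \int[lebesgue_measure]_(x in [set: R]) g x.
Proof.
move=> f0 fg; have g0 x : 0 <= g x by apply: le_trans (fg x).
rewrite !ge0_integralTE//; apply: ereal_sup_le => _ [h hf <-].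
by exists h => // x; apply: le_trans (hf x) (fg x).
Qed.

Lemma iterated_integral_ge0 d (f : 'rV[R]_d -> \bar R) :
  (forall x, 0 <= f x) -> 0 <= iterated_integral f.
Proof.
elim: d f => [|d ih] f f0 /=; first exact: f0.
by apply: integral_ge0 => x _; apply: ih.
Qed.

Lemma le_iterated_integral d (f g : 'rV[R]_d -> \bar R) :
  (forall x, 0 <= f x) -> (forall x, f x <= g x) ->
  iterated_integral f <= iterated_integral g.
Proof.
elim: d f g => [|d ih] f g f0 fg /=; first exact: fg.
apply: ge0_le_integral_nonmeasurable => x; first by apply: iterated_integral_ge0.
exact: ih.
Qed.

Definition floor_row d (x : 'rV[R]_d) : 'rV[int]_d := map_mx Num.floor x.

Lemma floor_fiberE (a : int) :
  [set y : R | Num.floor y = a] = `[a%:~R, (a + 1)%:~R[%classic.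
Proof.
apply/seteqP; split => y /=; rewrite in_itv /=; first by move=> <-; apply: floor_itv.
exact: floor_def.
Qed.

Lemma integral_floor_fiber (a : int) :
  \int[lebesgue_measure]_(x in [set: R]) (\1_[set y : R | Num.floor y = a] x)%:E = 1.
Proof.
rewrite floor_fiberE integral_indic//= setIT.
by rewrite lebesgue_measure_itv /= lte_fin ltr_int ltzD1 lexx -EFinB intrD addrAC subrr add0r.
Qed.

(** The integrand is the indicator of the union of the unit cells at the points of [F]. Slice [F] by
    the first coordinate: finitely many slices are nonempty, and each is integrated over an interval
    of length 1. *)
Lemma iterated_integral_step d (F : {fset 'rV[int]_d}) :
  iterated_integral (fun x : 'rV[R]_d => (floor_row x \in F)%:R%:E) = #|` F|%:R%:E.
Proof.
elim: d F => [|d ih] F /=.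
  have -> : floor_row (0%R : 'rV[R]_0) = 0%R by apply/rowP => -[].
  have [h|h] := boolP (0%R \in F).
    have -> : F = [fset 0%R]%fset.
      apply/fsetP => x; rewrite inE; have -> : x = 0%R by apply/rowP => -[].
      by rewrite h eqxx.
    by rewrite cardfs1.
  have -> : F = fset0; last by rewrite cardfs0.
  apply/fsetP => x; rewrite inE; have -> : x = 0%R by apply/rowP => -[].
  by apply/negbTE.
pose fib (a : int) := [seq u : 'rV[int]_(1 + d) <- F | u 0%R 0%R == a].
pose sl (a : int) : {fset 'rV[int]_d} := [fset v in map rsubmx (fib a)]%fset.
have fstE (u : 'rV[int]_(1 + d)) : lsubmx u = const_mx (u 0%R 0%R).
  by apply/rowP => i; rewrite !mxE (ord1 i); congr (u _ _); apply/val_inj.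
have consE a (v : 'rV[int]_d) : (row_mx (const_mx a) v : 'rV[int]_(1 + d)) 0%R 0%R = a.
  have := fstE (row_mx (const_mx a) v); rewrite row_mxKl => /rowP/(_ 0%R).
  by rewrite !mxE => <-.
have fib_cons a u : u \in fib a -> u = row_mx (const_mx a) (rsubmx u).
  by rewrite mem_filter => /andP[/eqP <- _]; rewrite -fstE hsubmxK.
have memsl a v : (v \in sl a) = ((row_mx (const_mx a) v : 'rV[int]_(1 + d)) \in F).
  rewrite inE; apply/mapP/idP => [[u uf ->]|h].
    by rewrite -fib_cons//; move: uf; rewrite mem_filter => /andP[].
  exists (row_mx (const_mx a) v); last by rewrite row_mxKr.
  by rewrite mem_filter h consE eqxx.
have cardsl a : #|` sl a| = count (fun u : 'rV[int]_(1 + d) => u 0%R 0%R == a) F.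
  rewrite card_fseq undup_id ?size_map ?size_filter// map_inj_in_uniq.
    by rewrite filter_uniq// fset_uniq.
  by move=> u u' uf uf' e; rewrite (fib_cons a u uf) (fib_cons a u' uf') e.
have fr x v : floor_row (row_mx (const_mx x : 'rV[R]_1) v : 'rV[R]_d.+1) =
    (row_mx (const_mx (Num.floor x)) (floor_row v) : 'rV[int]_(1 + d)).
  by rewrite -[LHS]/(map_mx Num.floor (row_mx (const_mx x : 'rV[R]_1) v)) map_row_mx map_const_mx.
have inner x : iterated_integral (fun v : 'rV[R]_d =>
      (floor_row (row_mx (const_mx x : 'rV[R]_1) v : 'rV[R]_d.+1) \in F)%:R%:E) =
    #|` sl (Num.floor x)|%:R%:E.
  rewrite -ih; congr iterated_integral; apply/funext => v.
  by rewrite memsl -fr.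
under eq_integral do rewrite inner.
pose A := undup [seq (u : 'rV[int]_(1 + d)) 0%R 0%R | u <- F].
pose h (a : int) (x : R) : \bar R := #|` sl a|%:R%:E * (\1_[set y : R | Num.floor y = a] x)%:E.
have sl0 a : a \notin A -> sl a = fset0.
  move=> aA; apply/fsetP => v; rewrite inE memsl; apply/negbTE; apply: contra aA => vF.
  rewrite mem_undup; apply/mapP; exists (row_mx (const_mx a) v).
    exact: vF.
  exact: (esym (consE a v)).
have hE x : #|` sl (Num.floor x)|%:R%:E = \sum_(a <- A) h a x.
  have [fA|fA] := boolP (Num.floor x \in A); last first.
    rewrite sl0// cardfs0 big_seq big1// => a aA; rewrite /h indicE memNset ?mule0// => /= e.
    by rewrite e aA in fA.
  rewrite (big_rem _ fA) /= big_seq big1 ?adde0; last first.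
    move=> a; rewrite mem_rem_uniq ?undup_uniq// inE => /andP[ne _].
    by rewrite /h indicE memNset ?mule0// => /= e; rewrite e eqxx in ne.
  by rewrite /h indicE mem_set ?mule1.
under eq_integral do rewrite hE.
have mset a : measurable [set y : R | Num.floor y = a].
  by rewrite floor_fiberE; exact: measurable_itv.
rewrite ge0_integral_sum//; last first.
- by move=> a x _; rewrite /h mule_ge0// lee_fin.
- move=> a; apply: measurable_funeM; apply/measurable_EFinP; apply: measurable_indic.
  exact: mset.
rewrite (eq_bigr (fun a => #|` sl a|%:R%:E)); last first.
  move=> a _; rewrite /h ge0_integralZl_EFin//; last first.
    by apply/measurable_EFinP; apply: measurable_indic; exact: mset.
  by rewrite integral_floor_fiber mule1.
rewrite sumEFin; congr EFin; rewrite -natr_sum; congr (_%:R).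
have -> : #|` F| = (\sum_(a <- A) count (fun u : 'rV[int]_(1 + d) => u 0%R 0%R == a) F)%N.
  by rewrite sum_count_fibers ?undup_uniq//; apply/allP => u uF; rewrite mem_undup; apply: map_f.
by apply: eq_bigr => a _; rewrite cardsl.
Qed.

End Volume.

Section BallWindow.
Variables (R : realType) (d : nat).
Implicit Types (r : R) (x y : 'rV[R]_d) (v : 'rV[int]_d).
Local Notation ballr := (@euclidean_ball R d).
Local Notation toR := (map_mx (intr : int -> R)).

(** This monotonicity yields both the convexity along lines and the comparison of the ball with the
    corners of unit cells. *)
Lemma euclidean_ball_le r x y : ballr r x -> (forall i, `|y 0 i| <= `|x 0 i|) -> ballr r y.
Proof.
move=> [r0 hx] h; split=> //; apply: le_lt_trans hx; apply: ler_sum => i _.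
by rewrite -[leLHS]real_normK ?num_real// -[leRHS]real_normK ?num_real// lerXn2r ?nnegrE.
Qed.

Lemma euclidean_ball_coord r x i : ballr r x -> `|x 0 i| < r.
Proof.
move=> [r0 hx]; rewrite -(ltr_pXn2r (ltn0Sn 1)) ?nnegrE ?(ltW r0)//.
apply: le_lt_trans hx; rewrite real_normK ?num_real// (bigD1 i)//= lerDl.
by apply: sumr_ge0 => j _; apply: sqr_ge0.
Qed.

Definition ball_fset r : {fset 'rV[int]_d} :=
  [fset v in box_seq d (Num.truncn r).+1 | `[< ballr r (toR v) >]]%fset.

Lemma mem_ball_fset r v : v \in ball_fset r <-> ballr r (toR v).
Proof.
rewrite !inE; split => [/andP[_ /asboolP//]|h]; apply/andP; split; last exact/asboolP.
apply/mem_box_seq => i; have r0 : 0 <= r by case: h => /ltW.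
have := euclidean_ball_coord i h; rewrite mxE -intr_norm => hi.
have /andP[_ hr] := truncn_itv r0; have := lt_trans hi hr.
by rewrite pmulrn ltr_int; lia.
Qed.

Lemma ball_fset_window r : window (ball_fset r) (Num.truncn r).+1.
Proof.
split; last by move=> v; rewrite !inE => /andP[/mem_box_seq].
move=> i v m n /mem_ball_fset hv /mem_ball_fset hn mn; apply/mem_ball_fset.
have e u j : (toR u) 0 j = (u 0 j)%:~R by rewrite mxE.
have [h|h] := leP (`|v 0%R i + m%:Z|) (`|v 0 i|).
  apply: euclidean_ball_le hv _ => j; rewrite !e -!intr_norm ler_int mxE unit_rowE.
  by case: eqVneq => [<-//|_]; rewrite addr0.
apply: euclidean_ball_le hn _ => j; rewrite !e -!intr_norm ler_int !mxE !unit_rowE.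
case: eqVneq => [<-|_]; last by rewrite addr0.
by move: h => /=; lia.
Qed.

(* The vertices of the unit cube: the unit cell at [v] meets the ball only if some
   [v + corner e] is in it, and is contained in the ball if all of them are. *)
Definition corner (e : {ffun 'I_d -> bool}) : 'rV[int]_d := \row_i (e i : nat)%:Z.

Lemma exits_corner r e :
  (exits (ball_fset r) (corner e) <= d * (Num.truncn r).+1.*2.+1 ^ d.-1)%N.
Proof.
apply: leq_trans (exits_bound _ (ball_fset_window r)) _; rewrite leq_mul2r; apply/orP; right.
apply: (@leq_trans (\sum_(i < d) 1)%N); last by rewrite sum_nat_const card_ord muln1.
by apply: leq_sum => i _; rewrite mxE /=; case: (e i).
Qed.

Definition inner_fset r : {fset 'rV[int]_d} :=
  [fset v in ball_fset r | [forall e : {ffun 'I_d -> bool}, (v + corner e)%R \in ball_fset r]]%fset.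

Definition outer_fset r : {fset 'rV[int]_d} :=
  [fset v in box_seq d (Num.truncn r).+2 |
     [exists e : {ffun 'I_d -> bool}, (v + corner e)%R \in ball_fset r]]%fset.

Definition ball_error r : nat :=
  (2 ^ d * (d * (Num.truncn r).+1.*2.+1 ^ d.-1))%N.

Lemma sum_exits_corner (F : {fset 'rV[int]_d}) r (t : {ffun 'I_d -> bool} -> 'rV[int]_d) :
  (forall e, (exits F (t e) <= d * (Num.truncn r).+1.*2.+1 ^ d.-1)%N) ->
  (\sum_e exits F (t e) <= ball_error r)%N.
Proof.
move=> h; apply: (@leq_trans (\sum_(e : {ffun 'I_d -> bool}) (d * (Num.truncn r).+1.*2.+1 ^ d.-1))%N).
  by apply: leq_sum.
by rewrite sum_nat_const card_ffun card_bool card_ord.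
Qed.

(** A point of the ball that is not inner exits the ball along one of the [2 ^ d] corners. *)
Lemma card_inner r : (#|` ball_fset r| <= #|` inner_fset r| + ball_error r)%N.
Proof.
apply: leq_trans (leq_add (leqnn _) (sum_exits_corner (exits_corner r))).
have -> : #|` ball_fset r| = count predT (ball_fset r) by rewrite count_predT.
rewrite (count_split _ (mem (inner_fset r))); apply: leq_add.
  rewrite -size_filter; apply: uniq_leq_size; first by rewrite filter_uniq// fset_uniq.
  by move=> v; rewrite mem_filter => /andP[/andP[]].
under eq_bigr do rewrite /exits -sum1_count big_mkcond.
rewrite exchange_big /= -sum1_count big_mkcond /= big_seq [X in (_ <= X)%N]big_seq.
apply: leq_sum => v vF; case: ifP => //=; rewrite andbT => h.
have /forallPn[e he] : ~~ [forall e : {ffun 'I_d -> bool}, v + corner e \in ball_fset r].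
  by apply: contra h => hv; move: vF; rewrite !inE => ->.
by rewrite (bigD1 e)//= he.
Qed.

Lemma card_outer r : (#|` outer_fset r| <= #|` ball_fset r| + ball_error r)%N.
Proof.
have hx e : (exits (ball_fset r) (- corner e) <= d * (Num.truncn r).+1.*2.+1 ^ d.-1)%N.
  by rewrite exitsN exits_corner.
apply: leq_trans (leq_add (leqnn _) (sum_exits_corner hx)).
have -> : #|` outer_fset r| = count predT (outer_fset r) by rewrite count_predT.
rewrite (count_split _ (mem (ball_fset r))); apply: leq_add.
  rewrite -size_filter; apply: uniq_leq_size; first by rewrite filter_uniq// fset_uniq.
  by move=> v; rewrite mem_filter => /andP[/andP[]].
pose B := [seq v <- outer_fset r | v \notin ball_fset r].
have -> : count (predI (predC (mem (ball_fset r))) predT) (outer_fset r) = size B.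
  by rewrite size_filter; apply: eq_count => v /=; rewrite andbT.
have le e : (count (fun v => (v + corner e)%R \in ball_fset r) B <=
    exits (ball_fset r) (- corner e))%N.
  rewrite /exits -!size_filter -[X in (X <= _)%N](size_map (fun v => v + corner e)).
  apply: uniq_leq_size.
    by rewrite map_inj_uniq ?filter_uniq ?fset_uniq//; apply: addIr.
  move=> _ /mapP[v + ->]; rewrite !mem_filter addrK => /andP[-> /andP[h _]].
  by rewrite h.
apply: (@leq_trans (\sum_e count (fun v => (v + corner e)%R \in ball_fset r) B)%N); last first.
  by apply: leq_sum.
under [X in (_ <= X)%N]eq_bigr do rewrite -sum1_count big_mkcond.
rewrite exchange_big /= -sum1_size big_seq [X in (_ <= X)%N]big_seq.
apply: leq_sum => v; rewrite mem_filter => /andP[_]; rewrite inE => /andP[_ /existsP[e he]].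
by rewrite (bigD1 e)//= he.
Qed.

Lemma floor_corner_inner r x : floor_row x \in inner_fset r -> ballr r x.
Proof.
(* The corner of the cell farthest from the origin, which dominates [x] in every coordinate. *)
rewrite inE => /andP[_ /forallP/(_ [ffun i => 0 <= Num.floor (x 0 i)])] /mem_ball_fset h.
apply: euclidean_ball_le h _ => i; rewrite !mxE ffunE.
have /andP[h1 h2] := floor_itv (x 0 i).
case: (leP 0 (Num.floor (x 0 i))) => h0 /=.
  have f0 : 0 <= (Num.floor (x 0 i))%:~R :> R by rewrite ler0z.
  by rewrite !ger0_norm ?(ltW h2) ?(le_trans f0)// ltW// (le_lt_trans _ h2)// (le_trans f0).
have f0 : (Num.floor (x 0 i) + 1)%:~R <= 0 :> R by rewrite lerz0; lia.
rewrite addr0 ler0_norm ?ler0_norm ?lerN2//; last by apply: ltW; apply: lt_le_trans h2 f0.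
by rewrite ltW// ltrz0.
Qed.

Lemma floor_corner_outer r x : ballr r x -> floor_row x \in outer_fset r.
Proof.
(* The corner of the cell nearest to the origin, which [x] dominates in every coordinate. *)
move=> hx; pose e := [ffun i => x 0 i < 0].
have hc : floor_row x + corner e \in ball_fset r.
  apply/mem_ball_fset; apply: euclidean_ball_le hx _ => i; rewrite !mxE ffunE.
  have /andP[h1 h2] := floor_itv (x 0 i).
  case: (ltP (x 0 i) 0) => h0 /=.
    have f0 : (Num.floor (x 0 i) + 1)%:~R <= 0 :> R.
      have fl : Num.floor (x 0 i) < 0 by rewrite floor_lt0.
      by rewrite lerz0; lia.
    by rewrite !ler0_norm ?(ltW h0)// lerN2 ltW.
  rewrite addr0 !ger0_norm//; by rewrite ler0z floor_ge0.
rewrite inE; apply/andP; split; last by apply/existsP; exists e.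
apply/mem_box_seq; have -> : floor_row x = (floor_row x + corner e) - corner e by rewrite addrK.
rewrite -[(Num.truncn r).+2]addn1; apply: inboxD.
  exact: (ball_fset_window r).2.
by apply: inboxN => i; rewrite mxE /=; case: (e i).
Qed.

(** Squeezing between the step functions of the inner and the outer set also shows that the iterated
    integral is finite, so that [fine] loses nothing. *)
Lemma volume_ball r : `|volume (ballr r) - #|` ball_fset r|%:R| <= (ball_error r)%:R.
Proof.
pose f (x : 'rV[R]_d) := (\1_(ballr r) x)%:E : \bar R.
have h1 : (#|` inner_fset r|%:R%:E <= iterated_integral f)%E.
  rewrite -iterated_integral_step; apply: le_iterated_integral => x; rewrite lee_fin//.
  rewrite indicE; case: (boolP (floor_row x \in _)) => // h.
  by rewrite mem_set//; apply: floor_corner_inner.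
have h2 : (iterated_integral f <= #|` outer_fset r|%:R%:E)%E.
  rewrite -iterated_integral_step; apply: le_iterated_integral => x; rewrite lee_fin//.
  rewrite indicE; case: (boolP (x \in _)) => //; rewrite inE => /floor_corner_outer ->.
  by [].
rewrite /volume -/f; case: (iterated_integral f) h1 h2 => [s| |] //=.
rewrite !lee_fin => h1 h2.
have := card_inner r; have := card_outer r; rewrite -!(ler_nat R) !natrD => h3 h4.
by rewrite ler_norml; apply/andP; split; lra.
Qed.

End BallWindow.

(** * Topological entropy *)

Section RangeWindow.
Variable d : nat.
Implicit Types (v : 'rV[int]_d).

(** The cube from [- a] to [b]. It is not centred because [translate t w] reads [w] at [m - t]: for
    [t] in [cube N] these positions spread to the negative side. *)
Definition range_fset (a b : nat) : {fset 'rV[int]_d} :=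
  [fset v in [seq \row_i ((f i : nat)%:Z - a%:Z) | f : {ffun 'I_d -> 'I_(a + b).+1}]]%fset.

Lemma mem_range_fset a b v : v \in range_fset a b <-> forall i, - a%:Z <= v 0 i <= b%:Z.
Proof.
rewrite inE; split => [/mapP[f _ ->] i|hv].
  by rewrite mxE; case: (f i) => k hk /=; lia.
apply/mapP; exists [ffun i => inord (`|(v 0 i + a%:Z)%R|)%N]; first by rewrite mem_enum.
apply/rowP => i; rewrite mxE ffunE inordK; have := hv i => /=; lia.
Qed.

Lemma card_range_fset a b : #|` range_fset a b| = ((a + b).+1 ^ d)%N.
Proof.
rewrite card_fseq undup_id; first by rewrite size_map -cardE card_ffun !card_ord.
rewrite map_inj_uniq ?enum_uniq// => f g /rowP e; apply/ffunP => i.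
have := e i; rewrite !mxE /= => h; apply/val_inj => /=; move: h.
by case: (f i) => k hk; case: (g i) => l hl /=; lia.
Qed.

Lemma range_fset_window a b : window (range_fset a b) (a + b).
Proof.
split; last by move=> v /mem_range_fset hv i; have := hv i => /=; lia.
move=> i v m n /mem_range_fset hv /mem_range_fset hn mn; apply/mem_range_fset => j.
have := hv j; have := hn j; rewrite !mxE !unit_rowE; case: eqP => _; last by rewrite addr0.
by move=> /= h1 h2; lia.
Qed.

End RangeWindow.

Section Cylinders.
Variable d : nat.
Implicit Types (w : shift_space d) (m t z : 'rV[int]_d) (V : set 'rV[int]_d).

Definition cylinder (c : nat) w : set (shift_space d) :=
  [set w' | forall m, inbox c m -> w' m = w m].

Lemma nbhs_coordinate m w : nbhs w [set w' : shift_space d | w' m = w m].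
Proof.
have h := @proj_continuous _ (fun _ : 'rV[int]_d => bool) m w.
apply: (h [set b : bool | b = w m]).
by rewrite nbhs_principalE; apply/principal_filterP.
Qed.

Lemma nbhs_cylinder c w : nbhs w (cylinder c w).
Proof.
have : nbhs w (\bigcap_(m in [set` box_fset d c]) [set w' : shift_space d | w' m = w m]).
  by apply: filter_bigI => m _; apply: nbhs_coordinate.
by apply: filterS => w' h m hm; apply: h; apply/mem_box_fset.
Qed.

(** Otherwise points outside [A] that agree with [w] on larger and larger boxes would converge to
    [w]. *)
Lemma open_cylinder (A : set (shift_space d)) w : open A -> A w ->
  exists c, cylinder c w `<=` A.
Proof.
move=> oA Aw; apply: contrapT => hn.
have /choice[g hg] : forall c, exists w', cylinder c w w' /\ ~ A w'.
  move=> c; apply: contrapT => h; apply: hn; exists c => w' cw'.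
  by apply: contrapT => nA; apply: h; exists w'.
have cg : g @ \oo --> w.
  apply/cvg_sup => m Q /= [_ [[U oU <-] Um BQ]].
  have [c _ hc] := inbox_ex m; exists c => // n /= cn; apply: BQ.
  by rewrite /preimage /= (hg n).1//; apply: inbox_le hc.
have [n _ hn'] := cg _ (open_nbhs_nbhs (conj oA Aw)).
by apply: (hg n).2; apply: hn' => /=.
Qed.

Lemma shift_space_compact : compact [set: shift_space d].
Proof.
have := @tychonoff _ (fun _ : 'rV[int]_d => _) _ (fun=> bool_compact).
by congr (compact _); rewrite eqEsubset.
Qed.

Lemma hull_compact V : compact (hull V).
Proof.
by apply: (subclosed_compact _ shift_space_compact) => //; apply: closed_closure.
Qed.

Lemma hull_translate V t : hull V (translate t (char_fun V)).
Proof. by apply: subset_closure; exists t. Qed.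

(** A Lebesgue number, by compactness: a cluster point of counterexamples for growing [c] has a
    cylinder inside some member of [U], and this cylinder contains that of a late counterexample. *)
Lemma uniform_cover V (U : set (set (shift_space d))) : open_cover (hull V) U ->
  exists c, forall w, hull V w -> exists2 A, U A & cylinder c w `<=` A.
Proof.
move=> [oU cU].
apply: contrapT => hn.
have /choice[g hg] : forall c, exists w, hull V w /\ forall A, U A -> ~ cylinder c w `<=` A.
  move=> c; apply: contrapT => h; apply: hn; exists c => w Xw; apply: contrapT => h2.
  by apply: h; exists w; split => // A UA cA; apply: h2; exists A.
have [|w [Xw clw]] := @hull_compact V (g @ \oo) _.
  by exists 0%N => // n _; exact: (hg n).1.
have [A UA Aw] := cU w Xw; have [c hc] := open_cylinder (oU A UA) Aw.
have tail : (g @ \oo) [set g n | n in [set n | (c <= n)%N]].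
  by exists c => // n cn; exists n.
have [_ [[n cn <-] hgn]] := clw _ _ tail (nbhs_cylinder c w).
apply: ((hg n).2 A UA); apply: subset_trans hc => w' hw' m hm.
by rewrite hw' ?hgn//; apply: inbox_le hm.
Qed.

End Cylinders.

(** * Subcover numbers compared with patch counts on cubes *)

Section EntropyPatches.
Variables (R : realType) (d : nat) (V : set 'rV[int]_d).
Implicit Types (U : set (set (shift_space d))) (w : shift_space d) (z t m : 'rV[int]_d).
Local Notation X := (hull V).
Local Notation orbit z := (translate (- z) (char_fun V)).

Lemma orbitE z m : (orbit z m : bool) = ((m + z) \in V).
Proof. by rewrite /translate /char_fun opprK. Qed.

Lemma orbit_agree (D : set 'rV[int]_d) z z' :
  patch_set V D z = patch_set V D z' -> forall m, D m -> orbit z m = orbit z' m.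
Proof.
move=> e m Dm; rewrite !orbitE; apply/idP/idP; rewrite !inE => h.
  by have : patch_set V D z m by []; rewrite e => -[].
by have : patch_set V D z' m by []; rewrite -e => -[].
Qed.

Lemma patch_count_fin (D : {fset 'rV[int]_d}) :
  exists s : seq 'rV[int]_d, [/\ size s = patch_count V [set` D],
    forall z, exists2 z', z' \in s & patch_set V [set` D] z = patch_set V [set` D] z' &
    uniq [seq patch_set V [set` D] z | z <- s]].
Proof.
have fP := patches_finite V D.
have /choice[h hh] : forall Y : set 'rV[int]_d, exists z,
    (exists z, patch_set V [set` D] z = Y) -> patch_set V [set` D] z = Y.
  move=> Y; have [[z hz]|nz] := pselect (exists z, patch_set V [set` D] z = Y).
    by exists z.
  by exists 0.
pose P := fset_set [set patch_set V [set` D] z | z in [set: 'rV[int]_d]].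
have inP z : patch_set V [set` D] z \in P by rewrite in_fset_set// inE; exists z.
have hP Y : Y \in P -> patch_set V [set` D] (h Y) = Y.
  by rewrite in_fset_set// inE => -[z _ e]; apply: hh; exists z.
exists (map h P); split.
- by rewrite size_map.
- move=> z; exists (h (patch_set V [set` D] z)); first by apply: map_f; apply: inP.
  by rewrite hP.
- rewrite -map_comp map_inj_in_uniq ?fset_uniq// => Y Y' YP YP' /=.
  by rewrite !hP.
Qed.

(** Every point of the hull agrees on a large box with a translate of [V]. If two points agree on
    the cube from [- (N + c)] to [c], their translates by [cube N] agree on the box of radius [c],
    so they can share a member of the join; one member per patch suffices. *)
Lemma subcover_le U : open_cover X U -> exists c, forall N,
  exists F : {fset (set (shift_space d))},
   [/\ [set` F] `<=` cover_join (@translate d) (@cube d N) U,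
       X `<=` \bigcup_(A in [set` F]) A &
       (#|` F| <= patch_count V [set` range_fset d (N + c) c])%N].
Proof.
move=> hU; have [c hc] := uniform_cover hU; exists c => N.
have [s [szs hs _]] := patch_count_fin (range_fset d (N + c) c).
have /choice[A hA] : forall w, exists A, X w -> U A /\ cylinder c w `<=` A.
  move=> w; have [Xw|nX] := pselect (X w); last by exists set0.
  by have [A UA cA] := hc w Xw; exists A.
pose M z : set (shift_space d) :=
  \bigcap_(t in @cube d N) (translate t @^-1` A (translate t (orbit z))).
have tt z t : translate t (orbit z) = translate (t - z) (char_fun V).
  by apply/funext => m; rewrite /translate opprD opprK addrA.
exists [fset B in map M s]%fset; split.
- move=> B /=; rewrite inE => /mapP[z _ ->].
  exists (fun t => A (translate t (orbit z))) => // t.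
  by have [] := hA _ (@hull_translate d V (t - z)); rewrite tt.
- move=> w Xw.
  have [_ [[t0 _ <-] ht0]] := Xw _ (nbhs_cylinder (N + c + c) w).
  have [z zs hz] := hs (- t0).
  exists (M z); first by rewrite /= inE; apply: map_f.
  move=> t ct; have [_] := hA _ (@hull_translate d V (t - z)); rewrite -tt; apply.
  move=> m hm; rewrite {1}/translate {1}/translate.
  have mt : m - t \in range_fset d (N + c) c.
    apply/mem_range_fset => i; have := hm i; have := ct i; rewrite !mxE /=; lia.
  have -> : w (m - t) = orbit (- t0) (m - t).
    rewrite opprK ht0//; exact: (range_fset_window d (N + c) c).2.
  exact: (orbit_agree hz).
- rewrite card_fseq -szs -(size_map M); exact: size_undup.
Qed.

(** The partition by the value at 0. Its translates read off every coordinate, so it already attains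
    the full entropy. *)
Definition coordinate_cover : set (set (shift_space d)) :=
  [set [set w : shift_space d | w 0 = b] | b in [set: bool]].

Lemma coordinate_cover_open : open_cover X coordinate_cover.
Proof.
split=> [_ [b _ <-]|w _]; last by exists [set w' : shift_space d | w' 0 = w 0] => //; exists (w 0).
rewrite openE => w /= wb; have := nbhs_coordinate 0 w; rewrite /interior /=.
by apply: filterS => w' /= ->.
Qed.

(** A member of the join fixes the coordinates [- t] for [t] in [cube N], that is, the cube from
    [- N.-1] to 0. So translates of [V] with different patches there need different members. *)
Lemma subcover_ge (N : nat) (F : {fset (set (shift_space d))}) : (0 < N)%N ->
  [set` F] `<=` cover_join (@translate d) (@cube d N) coordinate_cover ->
  X `<=` \bigcup_(A in [set` F]) A ->
  (patch_count V [set` range_fset d N.-1 0] <= #|` F|)%N.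
Proof.
move=> N0 FU cF; have [s [szs _ us]] := patch_count_fin (range_fset d N.-1 0).
have /choice[g hg] : forall z, exists A, A \in F /\ A (orbit z).
  by move=> z; have [A AF Az] := cF _ (@hull_translate d V (- z)); exists A.
rewrite -szs -(size_map g); apply: uniq_leq_size.
  rewrite map_inj_in_uniq; first exact: map_uniq us.
  move=> z z' zs zs' e.
  suff pe : patch_set V [set` range_fset d N.-1 0] z = patch_set V [set` range_fset d N.-1 0] z'.
    have zi := nth_index 0 zs; have zi' := nth_index 0 zs'.
    rewrite -zi -zi'; congr nth; apply/eqP.
    rewrite -(nth_uniq set0 _ _ us) ?size_map ?index_mem//.
    by rewrite !(nth_map 0) ?index_mem// zi zi' pe.
  have [gF gz] := hg z; have [_ gz'] := hg z'; rewrite -e in gz'.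
  have [B UB BE] := FU _ gF.
  have agree t : @cube d N t -> orbit z (- t) = orbit z' (- t).
    move=> ct; have [b _ bE] := UB t; move: gz gz'; rewrite -BE => /(_ t ct) + /(_ t ct).
    by rewrite -bE /preimage /= {1 3}/translate !sub0r => -> ->.
  have agree2 v : v \in range_fset d N.-1 0 -> orbit z v = orbit z' v.
    move=> /mem_range_fset hv; rewrite -[v]opprK; apply: agree => i; have := hv i.
    by rewrite mxE /=; lia.
  apply/seteqP; split => v /= [hv vD]; split => //.
    by have := agree2 v vD; rewrite !orbitE mem_set// => /esym/set_mem.
  by have := agree2 v vD; rewrite !orbitE [in RHS]mem_set// => /set_mem.
by move=> _ /mapP[z _ ->]; have [] := hg z.
Qed.

Lemma min_subcover_le U : open_cover X U -> exists c, forall N,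
  1 <= min_subcover R X (cover_join (@translate d) (@cube d N) U) <=
    (patch_count V [set` range_fset d (N + c) c])%:R.
Proof.
move=> hU; have [c hc] := subcover_le hU; exists c => N.
have [F [FU cF szF]] := hc N; apply/andP; split.
  apply: lb_le_inf; first by exists #|` F|%:R, F.
  move=> _ [G [_ cG] <-]; rewrite ler1n cardfs_gt0; apply/negP => /eqP G0.
  by have [A] := cG _ (@hull_translate d V 0); rewrite G0.
apply: le_trans (_ : #|` F|%:R <= _); last by rewrite ler_nat.
by apply: ge_inf; [exists 0 => _ [G _ <-]|exists F].
Qed.

Lemma min_subcover_ge N : (0 < N)%N ->
  (patch_count V [set` range_fset d N.-1 0])%:R <=
  min_subcover R X (cover_join (@translate d) (@cube d N) coordinate_cover).
Proof.
move=> N0; have [c hc] := subcover_le coordinate_cover_open.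
have [F [FU cF szF]] := hc N; apply: lb_le_inf; first by exists #|` F|%:R, F.
by move=> _ [G [GU cG] <-]; rewrite ler_nat; apply: subcover_ge.
Qed.

End EntropyPatches.

(** * Limits *)

(** A discrete mean value inequality, used to compare the volume of a cube with that of an enlarged
    one. *)
Lemma leq_exp_add (x h d : nat) :
  ((x + h) ^ d <= x ^ d + d * h * (x + h) ^ d.-1)%N.
Proof.
elim: d => [|d ih]; first by rewrite !expn0.
rewrite expnS; apply: (@leq_trans ((x + h) * (x ^ d) + d * h * (x + h) ^ d)).
  have [->|d0] := posnP d; first by rewrite expn0 !mul0n addn0.
  rewrite -[in X in (_ <= _ + X)%N](prednK d0) expnS [(_ * ((x + h) * _))%N]mulnCA -mulnDr.
  by rewrite leq_mul2l (prednK d0) ih orbT.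
rewrite mulnDl expnS -addnA leq_add2l mulSn mulnDl leq_add2r leq_mul2l.
by case: (d) => [|m]; rewrite ?orbT// leq_exp2r// leq_addr orbT.
Qed.

Section LimitSuperior.
Variable R : realType.
Implicit Types (u : nat -> R) (L : R).
Local Open Scope ereal_scope.

Lemma limn_esup_le u L :
  (forall eps : R, (0 < eps)%R -> exists N, forall n, (N <= n)%N -> (u n <= L + eps)%R) ->
  limn_esup (fun n => (u n)%:E) <= L%:E.
Proof.
move=> h; apply/lee_addgt0Pr => eps e0; have [N hN] := h eps e0.
rewrite -EFinD; apply: (@le_trans _ _ (ereal_sup [set (u n)%:E | n in [set n | (N <= n)%N]])).
  by apply: ereal_inf_lbound; exists [set n | (N <= n)%N] => //; exists N.
by apply: ge_ereal_sup => _ [n /= Nn <-]; rewrite lee_fin; apply: hN.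
Qed.

Lemma limn_esup_ge u L :
  (forall eps : R, (0 < eps)%R -> exists N, forall n, (N <= n)%N -> (L - eps <= u n)%R) ->
  L%:E <= limn_esup (fun n => (u n)%:E).
Proof.
move=> h; apply/lee_addgt0Pr => eps e0; have [N hN] := h eps e0.
rewrite -leeBlDr// -EFinB; apply: le_ereal_inf_tmp => _ [A [M _ hM] <-].
apply: (@le_trans _ _ (u (maxn N M))%:E).
  by rewrite lee_fin; apply: hN; apply: leq_maxl.
by apply: ereal_sup_ubound; exists (maxn N M) => //; apply: hM; apply: leq_maxr.
Qed.

End LimitSuperior.

Section EntropyLimits.
Variables (R : realType) (K : fieldType) (d : nat) (phi : 'rV[int]_d -> K) (k : nat).
Hypothesis phiD : is_dedekind phi.
Hypothesis k2 : (2 <= k)%N.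
Variable zt : R.
Hypothesis hzt : is_sum (norm_weight R phi k) (nonzero_ideal (range phi)) zt.
Hypothesis zt1 : 1 <= zt.
Let phiP := dedekind_order phiD.
Let d0 : (0 < d)%N := order_dim_gt0 phiP.
Local Notation V := (kfree_vectors phi k).
Local Notation L := (ln 2 / zt).
Implicit Types (F : {fset 'rV[int]_d}).

Let L0 : 0 <= L.
Proof. by rewrite divr_ge0 ?ln_ge0 ?ler1n// (le_trans ler01). Qed.

(** [vol] will be [N ^ d] or the volume of a ball, equal to the size of [F] up to a boundary term.
    Applying [patch_asymptotics] with [eps * c] leaves [eps] after division by [vol]. *)
Lemma rate_estimate (eps c E : R) : 0 < eps -> 0 < c -> 0 <= E ->
  exists2 C : R, 0 <= C & forall F B vol, window F B -> (0 < B)%N ->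
    c * B%:R ^+ d <= vol -> `|vol - #|` F|%:R| <= E * B%:R ^+ d.-1 ->
    `|ln (patch_count V [set` F])%:R / vol - L| <= eps + C / B%:R.
Proof.
move=> e0 c0 E0; have [C0 C00 hC] := patch_asymptotics phiD k2 hzt zt1 (mulr_gt0 e0 c0).
exists ((C0 + L * E) / c); first by rewrite divr_ge0 ?(ltW c0)// addr_ge0// mulr_ge0.
move=> F B vol hF B0 hvol hE; have := hC F B hF B0; rewrite !natrX => h.
have Bd : B%:R ^+ d = B%:R * B%:R ^+ d.-1 :> R by rewrite -exprS prednK.
have BR : 0 < B%:R :> R by rewrite ltr0n.
have Bd0 : 0 < B%:R ^+ d.-1 :> R by rewrite exprn_gt0.
have v0 : 0 < vol by apply: lt_le_trans hvol; rewrite mulr_gt0// exprn_gt0.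
set lp := ln _ in h *.
have -> : lp / vol - L = (lp - L * vol) / vol by field; rewrite !gt_eqF// (lt_le_trans ltr01).
rewrite normrM (gtr0_norm (_ : 0 < vol^-1)) ?invr_gt0// ler_pdivrMr//.
have h1 : `|lp - L * vol| <= eps * c * B%:R ^+ d + (C0 + L * E) * B%:R ^+ d.-1.
  have -> : lp - L * vol = (lp - L * #|` F|%:R) - L * (vol - #|` F|%:R) by ring.
  apply: le_trans (ler_normB _ _) _; rewrite normrM (ger0_norm L0) mulrDl addrA.
  by rewrite lerD// -mulrA ler_wpM2l.
apply: le_trans h1 _; rewrite [leRHS]mulrDl lerD//.
  by rewrite -mulrA ler_wpM2l// ltW.
have -> : (C0 + L * E) * B%:R ^+ d.-1 = (C0 + L * E) / c / B%:R * (c * B%:R ^+ d).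
  by rewrite Bd; field; rewrite !gt_eqF// (lt_le_trans ltr01).
by rewrite ler_wpM2l// divr_ge0 ?divr_ge0 ?(ltW c0) ?(ltW BR)// addr_ge0// mulr_ge0.
Qed.

Lemma entropy_upper (eps : R) c : 0 < eps -> exists N0, forall N, (N0 <= N)%N ->
  ln (patch_count V [set` range_fset d (N + c) c])%:R / N%:R ^+ d <= L + eps.
Proof.
(* [a] comes from [B <= (1 + 2 * c) * N] for [B = N + 2 * c], and [E] below from [leq_exp_add] with
   [h = 2 * c + 1]. *)
move=> e0; pose a : R := ((1 + 2 * c)%N%:R ^+ d)^-1.
have a0 : 0 < a by rewrite invr_gt0 exprn_gt0// ltr0n.
pose E : R := (d * (2 * c + 1) * 2 ^ d.-1)%N%:R.
have [|C C0 hC] := @rate_estimate (eps / 2) a E _ a0 (ler0n _ _); first by rewrite divr_gt0.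
pose N0 := (Num.truncn (C / (eps / 2))).+1; exists N0 => N hN.
have N1 : (0 < N)%N by apply: leq_trans hN.
pose B := (N + c + c)%N; have B0 : (0 < B)%N by rewrite /B -addnA ltn_addr.
have NB : (N <= B)%N by rewrite /B -addnA leq_addr.
have h : `|ln (patch_count V [set` range_fset d (N + c) c])%:R / N%:R ^+ d - L| <=
    eps / 2 + C / B%:R.
  apply: (hC _ B _ (range_fset_window d (N + c) c) B0).
- rewrite /a mulrC ler_pdivrMr ?exprn_gt0 ?ltr0n// -exprMn -natrM lerXn2r ?nnegrE//.
  by rewrite ler_nat /B mulnDr muln1 -addnA leq_add2l addnn -mul2n leq_pmull.
- rewrite card_range_fset -/B distrC -!natrX.
  have h1 : (N ^ d <= B.+1 ^ d)%N by rewrite leq_exp2r// leqW.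
  rewrite ger0_norm ?subr_ge0 ?ler_nat// lerBlDl -natrM -natrD ler_nat.
  have -> : B.+1 = (N + (2 * c + 1))%N by rewrite /B; lia.
  apply: leq_trans (leq_exp_add _ _ _) _; rewrite leq_add2l -[X in (_ <= X)%N]mulnA leq_mul2l -expnMn.
  apply/orP; right; case: (d.-1) => [//|m]; rewrite leq_exp2r// /B; lia.
have : C / B%:R <= eps / 2.
  rewrite ler_pdivrMr ?ltr0n// mulrC -ler_pdivrMr ?divr_gt0//.
  apply: ltW; apply: lt_le_trans (truncnS_gt _) _; rewrite ler_nat.
  exact: leq_trans hN NB.
by move: h; rewrite ler_norml => /andP[_]; lra.
Qed.

Lemma entropy_lower (eps : R) : 0 < eps -> exists N0, forall N, (N0 <= N)%N ->
  (0 < N)%N /\ L - eps <= ln (patch_count V [set` range_fset d N.-1 0])%:R / N%:R ^+ d.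
Proof.
move=> e0.
have [|C C0 hC] := @rate_estimate (eps / 2) 1 0 _ ltr01 (lexx _); first by rewrite divr_gt0.
pose N0 := (Num.truncn (C / (eps / 2))).+2; exists N0 => N hN.
have N2 : (1 < N)%N by apply: leq_trans hN.
have N1 : (0 < N)%N by apply: ltnW.
split => //; pose B := N.-1; have B0 : (0 < B)%N by rewrite /B -ltnS prednK.
have := range_fset_window d N.-1 0; rewrite addn0 => hw.
have h : `|ln (patch_count V [set` range_fset d N.-1 0])%:R / N%:R ^+ d - L| <=
    eps / 2 + C / B%:R.
  apply: (hC _ B _ hw B0).
- by rewrite mul1r lerXn2r ?nnegrE// ler_nat leq_pred.
- by rewrite card_range_fset addn0 prednK// natrX subrr normr0 mul0r.
have : C / B%:R <= eps / 2.
  rewrite ler_pdivrMr ?ltr0n// mulrC -ler_pdivrMr ?divr_gt0//.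
  apply: ltW; apply: lt_le_trans (truncnS_gt _) _; rewrite ler_nat /B.
  by rewrite -ltnS prednK.
by move: h; rewrite ler_norml => /andP[+ _]; lra.
Qed.

Lemma topological_entropyE : topological_entropy R (hull V) (@translate d) = L%:E.
Proof.
apply/eqP; rewrite eq_le; apply/andP; split.
  apply: ge_ereal_sup => _ [U hU <-]; rewrite /cover_entropy; apply: limn_esup_le => eps e0.
  have [c hc] := min_subcover_le R hU; have [N0 hN0] := entropy_upper c e0.
  exists N0 => N hN; apply: le_trans (hN0 N hN); have /andP[h1 h2] := hc N.
  rewrite ler_wpM2r ?invr_ge0 ?exprn_ge0// ler_ln ?posrE//; first exact: lt_le_trans h1.
  by apply: lt_le_trans h2; apply: lt_le_trans h1.
apply: (@le_trans _ _ (@cover_entropy R d _ (hull V) (@translate d) (@coordinate_cover d))).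
  rewrite /cover_entropy; apply: limn_esup_ge => eps e0.
  have [N0 hN0] := entropy_lower e0; exists N0 => N hN; have [N1 hN1] := hN0 N hN.
  apply: le_trans hN1 _; have h := min_subcover_ge R V N1.
  have [c hc] := min_subcover_le R (coordinate_cover_open V); have /andP[h1 _] := hc N.
  rewrite ler_wpM2r ?invr_ge0 ?exprn_ge0// ler_ln ?posrE//; last exact: lt_le_trans h1.
  by rewrite ltr0n; apply: leq_trans (patch_count_ge R phiD k2 _); rewrite expn_gt0.
by apply: ereal_sup_ubound; exists (@coordinate_cover d) => //; apply: coordinate_cover_open.
Qed.

Lemma patch_numberE (r : R) : patch_number V r = patch_count V [set` ball_fset d r].
Proof.
rewrite /patch_number /patch_count; congr (#|` fset_set _|).
apply: eq_imagel => z _; apply/seteqP; split => v /= [hv hb]; split => //.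
  exact/mem_ball_fset.
exact/mem_ball_fset.
Qed.

(** The ball contains the cube from 0 to [m] when [m * d < r], since [d * m ^ 2 <= (m * d) ^ 2]. A
    crude constant is enough: it only serves to bound the volume below by a multiple of [r ^ d]. *)
Lemma card_ball_ge (r : R) : 1 <= r ->
  ((Num.truncn r).+1 ^ d <= (2 * d) ^ d * #|` ball_fset d r|)%N.
Proof.
move=> r1; pose t := Num.truncn r.
have t1 : (0 < t)%N by rewrite truncn_gt0.
have r0 : 0 < r by apply: lt_le_trans r1.
have tr : t%:R <= r by rewrite truncn_le ltW.
pose m := (t.-1 %/ d)%N.
have sub : {subset range_fset d 0 m <= ball_fset d r}.
  move=> v /mem_range_fset hv; apply/mem_ball_fset; split => //.
  have m0 : (m * d)%N%:R < r.
    apply: lt_le_trans tr; rewrite ltr_nat; apply: leq_ltn_trans (leq_trunc_div _ _) _.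
    by rewrite ltn_predL.
  have hi i : (map_mx (intr : int -> R) v) 0 i ^+ 2 <= m%:R ^+ 2.
    have /andP[h0 h1] := hv i; rewrite oppr0 in h0.
    rewrite mxE lerXn2r ?nnegrE ?ler0z ?ler0n//.
    by rewrite -[m%:R]/(m%:Z%:~R) ler_int.
  apply: le_lt_trans (ler_sum _ (fun i _ => hi i)) _.
  rewrite sumr_const card_ord -[_ *+ d]mulr_natr.
  apply: (@le_lt_trans _ _ ((m * d)%N%:R ^+ 2)); last by rewrite ltrXn2r// ltW.
  rewrite natrM exprMn ler_wpM2l ?exprn_ge0// -natrX ler_nat.
  by rewrite -mulnn leq_pmulr.
have : (#|` range_fset d 0 m| <= #|` ball_fset d r|)%N.
  by apply: uniq_leq_size => //; apply: fset_uniq.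
rewrite card_range_fset add0n => h; apply: leq_trans (leq_mul (leqnn _) h).
rewrite -expnMn leq_exp2r//; have := ltn_ceil t.-1 d0; rewrite -/m => h2.
have : (t <= m.+1 * d)%N by rewrite -(prednK t1).
by rewrite -mulnA [(d * _)%N]mulnC; lia.
Qed.

Lemma patch_rate_cvg : patch_rate V r @[r --> (+oo : set_system R)] --> L.
Proof.
pose E : R := (2 ^ d * d * 3 ^ d.-1)%N%:R; pose A : R := (2 * d)%N%:R ^+ d.
have A0 : 0 < A by rewrite exprn_gt0// ltr0n muln_gt0.
have E0 : 0 <= E by [].
apply/cvgrPdist_le => eps e0.
have c0 : 0 < (2 * A)^-1 by rewrite invr_gt0 mulr_gt0.
have [|C C0 hC] := @rate_estimate (eps / 2) _ E _ c0 E0; first by rewrite divr_gt0.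
near=> r.
have r1 : 1 <= r by near: r; exact: nbhs_pinfty_ge.
(* From here on the boundary error is at most half of the lower bound for the number of lattice
   points; hence the factor 2 in [2 * A]. *)
have rE : 2 * A * E <= r by near: r; apply: nbhs_pinfty_ge; rewrite num_real.
have rC : C / (eps / 2) <= r by near: r; apply: nbhs_pinfty_ge; rewrite num_real.
pose B := (Num.truncn r).+1.
have rB : r <= B%:R by apply: ltW; apply: truncnS_gt.
have BR : 0 < B%:R :> R by rewrite ltr0n.
have Bd : B%:R ^+ d = B%:R * B%:R ^+ d.-1 :> R by rewrite -exprS prednK.
have Bd0 : 0 <= B%:R ^+ d.-1 :> R by rewrite exprn_ge0.
have err : (ball_error d r)%:R <= E * B%:R ^+ d.-1 :> R.
  rewrite -natrX -natrM ler_nat /ball_error -/B mulnA -[X in (_ <= X)%N]mulnA leq_mul2l.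
  rewrite -expnMn; apply/orP; right.
  by case: (d.-1) => [//|m]; rewrite leq_exp2r//; lia.
have vb := le_trans (volume_ball d r) err.
have vlow : (2 * A)^-1 * B%:R ^+ d <= volume (@euclidean_ball R d r).
  have h1 : B%:R ^+ d <= A * #|` ball_fset d r|%:R.
    by rewrite /A -!natrX -natrM ler_nat card_ball_ge.
  have h2 : #|` ball_fset d r|%:R - E * B%:R ^+ d.-1 <= volume (@euclidean_ball R d r).
    by move: vb; rewrite ler_norml => /andP[]; lra.
  have h3 : 2 * A * E * B%:R ^+ d.-1 <= B%:R ^+ d.
    by rewrite Bd ler_wpM2r// (le_trans rE).
  apply: le_trans h2; rewrite mulrC ler_pdivrMr ?mulr_gt0//.
  by move: h1 h3; nra.
have := hC _ B _ (ball_fset_window d r) isT vlow vb.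
rewrite /patch_rate patch_numberE distrC => /le_trans; apply.
have : C / B%:R <= eps / 2; last by lra.
by rewrite ler_pdivrMr// mulrC -ler_pdivrMr ?divr_gt0// (le_trans rC).
Unshelve. all: by end_near. Qed.

End EntropyLimits.

(** * Cyclotomic orders *)

Section ReducedQuotient.
Variables (K : fieldType) (d : nat) (phi : 'rV[int]_d -> K) (pi : K) (q : nat).
Hypothesis phiP : is_order phi.
Local Notation O := (range phi).
Hypotheses (Opi : O pi) (pi0 : pi != 0) (q1 : (1 < q)%N).
Hypothesis frob : forall y, O y -> principal_ideal O pi (y ^+ q - y).
Local Notation piO := (principal_ideal O pi).

Let idpi : is_ideal O piO := principal_is_ideal phiP Opi.

(** Iterating [frob] gives [u = u ^+ (q ^ N)] modulo [pi], and this is a multiple of [u ^+ N]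
    because [N <= q ^ N]. *)
Lemma reduced_root u N : O u -> piO (u ^+ N) -> piO u.
Proof.
move=> Ou uN; have key j : piO (u ^+ (q ^ j) - u).
  elim: j => [|j ih]; first by rewrite expn0 expr1 subrr; case: idpi.
  rewrite -(subrK (u ^+ (q ^ j)) (u ^+ (q ^ j.+1))) -addrA; apply: (idealD idpi) => //.
  by rewrite expnSr exprM; apply: frob; apply: OX.
rewrite -[u](subKr (u ^+ (q ^ N))); apply: (idealB phiP idpi); last exact: key.
have Nq : (N <= q ^ N)%N by apply: ltnW; apply: ltn_expl.
rewrite -(subnKC Nq) exprD mulrC; apply: (idealM idpi) => //; exact: OX.
Qed.

(* Multiply an integral equation for [y] by a power of [pi]: some power of [pi * y]
   is in [piO], hence so is [pi * y], as [O / piO] is reduced. *)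
Lemma reduced_integral y : integralOver (intr : int -> K) y -> O (pi * y) -> O y.
Proof.
move=> [p mp rp] Oy; pose N := (size p).-1.
have sp : size p = N.+1 by rewrite prednK// size_poly_gt0 monic_neq0.
have : (map_poly intr p).[y] = 0 by apply/eqP.
rewrite (horner_coef_wide _ (n := N.+1)); last by rewrite -sp size_poly.
rewrite big_ord_recr /= coef_map /= -[p`_N]/(lead_coef p) (eqP mp) mul1r => e.
have : piO (pi * y).
  apply: (@reduced_root _ N) => //.
  have -> : (pi * y) ^+ N = - (\sum_(i < N) (pi ^+ (N - i)) * ((p`_i)%:~R * (pi * y) ^+ i)).
    rewrite exprMn; apply/eqP; rewrite -addr_eq0; apply/eqP.
    rewrite -[RHS](mulr0 (pi ^+ N)) -[X in _ = _ * X]e mulrDr addrC; congr (_ + _).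
    rewrite mulr_sumr; apply: eq_bigr => i _; rewrite coef_map /= exprMn.
    have -> : pi ^+ N = pi ^+ (N - i) * pi ^+ i by rewrite -exprD subnK// ltnW.
    by ring.
  apply: subgroupN; first exact: (ideal_subgroup phiP idpi).
  apply: subgroup_sum => [|i _]; first exact: (ideal_subgroup phiP idpi).
  have -> : (N - i = (N - i.+1).+1)%N by rewrite subnSK.
  rewrite exprSr mulrAC; apply: (idealM idpi); last by exists 1; rewrite ?mul1r//; apply: (O1 phiP).
  apply: (OM phiP); first exact: OX.
  apply: (OM phiP); last exact: OX.
  by apply: subgroupMz; [exact: (O_subgroup phiP)|exact: (O1 phiP)].
by move=> [a Oa]; rewrite mulrC => /(mulfI pi0) <-.
Qed.

(* With [Q = (piO : P)], the product over [y] in [P / piO] of the [1 - y ^+ q.-1] is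
   in [Q] and congruent to 1 modulo [P], so that [P + Q = O] and [P * Q = piO]. *)
Lemma reduced_prime_invertible P : prime_ideal O P -> P pi -> invertible phi P.
Proof.
move=> [idP _ _] Ppi; pose Q := [set x | O x /\ forall y, P y -> piO (x * y)].
have idQ : is_ideal O Q.
  split.
  - by move=> x [].
  - by split; [exact: (O_subgroup phiP).1|move=> y _; rewrite mul0r; case: idpi].
  - move=> x y [Ox hx] [Oy hy]; split; first exact: (OD phiP).
    by move=> z Pz; rewrite mulrDl; apply: (idealD idpi); [apply: hx|apply: hy].
  - move=> a x Oa [Ox hx]; split; first exact: OM.
    by move=> z Pz; rewrite -mulrA; apply: (idealM idpi) => //; apply: hx.
have pin : piO <> [set 0].
  move=> e; have : piO pi by exists 1; rewrite ?mul1r//; apply: (O1 phiP).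
  by rewrite e => /eqP; rewrite (negPf pi0).
have [m [s [sO _ cs] _]] := has_index_ex phiP idpi pin.
(* [h r] is an element of [P] in the class of [r] modulo [pi], if there is one. The default 0 is
   harmless: it contributes the factor 1 to [v]. *)
have /choice[h hh] : forall r, exists y, P y /\ forall y', P y' -> piO (y' - r) -> piO (y' - y).
  move=> r; have [[y [Py yr]]|nr] := pselect (exists y, P y /\ piO (y - r)).
    exists y; split => // y' _ yr'; apply: (subgroup_trans (ideal_subgroup phiP idpi) yr').
    by apply: (subgroup_swap (ideal_subgroup phiP idpi)).
  exists 0; split; first by case: idP.
  by move=> y' Py' yr'; exfalso; apply: nr; exists y'.
have qE y : y ^+ q = y * y ^+ q.-1 by rewrite -exprS prednK// ltnW.
pose v := \prod_(r <- s) (1 - h r ^+ q.-1).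
have Oh r : O (1 - h r ^+ q.-1).
  by apply: (OB phiP); [exact: (O1 phiP)|apply: OX => //; apply: (idealO idP (hh r).1)].
have [Ov Pv] : O v /\ P (1 - v).
  rewrite /v; elim: (s) => [|r t [Ot Pt]].
    by rewrite big_nil subrr; split; [exact: (O1 phiP)|case: idP].
  rewrite big_cons; set u := \prod_(_ <- _) _ in Ot Pt *; split; first exact: (OM phiP).
  have -> : 1 - (1 - h r ^+ q.-1) * u = (1 - u) + u * h r ^+ q.-2 * h r.
    by rewrite -[u * _ * _]mulrA -exprSr prednK ?mulrBl ?mul1r; [ring|rewrite -ltnS prednK// ltnW].
  apply: (idealD idP) => //; apply: (idealM idP) (hh r).1; apply: (OM phiP) => //.
  by apply: OX => //; apply: (idealO idP (hh r).1).
have Qv : Q v.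
  (* The factor of [v] belonging to the class of [y] annihilates [h r] modulo [pi], because
     [h r ^+ q = h r] there. *)
  split => // y Py; have [r rs hr] := cs y (idealO idP Py).
  have yh := (hh r).2 y Py hr.
  have -> : v * y = v * (y - h r) + v * h r by ring.
  apply: (idealD idpi); first by apply: (idealM idpi).
  rewrite /v (big_rem r rs) /=; set u := \prod_(_ <- _) _.
  have Ou : O u.
    rewrite /u; elim: (rem r s) => [|a t ih]; first by rewrite big_nil; apply: (O1 phiP).
    by rewrite big_cons; apply: (OM phiP).
  have -> : (1 - h r ^+ q.-1) * u * h r = - (u * (h r ^+ q - h r)) by rewrite qE; ring.
  apply: subgroupN; first exact: (ideal_subgroup phiP idpi).
  by apply: (idealM idpi) => //; apply: frob; apply: (idealO idP (hh r).1).
exists Q, pi; split => //; apply/seteqP; split.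
  apply: ideal_mul_min; first exact: (ideal_subgroup phiP idpi).
  by move=> x y Px [_ hy]; rewrite mulrC; apply: hy.
have idPQ := ideal_mul_ideal phiP idP idQ.
move=> _ [a Oa <-]; apply: (idealM idPQ) => //.
(* [1 - v] is in [P] and [pi] in [Q]; [pi] is in [P] and [v] in [Q]. *)
have -> : pi = (1 - v) * pi + pi * v by ring.
apply: (idealD idPQ); apply: ideal_mul_in => //.
split => // y Py; rewrite mulrC; exists y => //; exact: (idealO idP Py).
Qed.

End ReducedQuotient.

Section FrobeniusModPrime.
Variables (K : fieldType) (d : nat) (phi : 'rV[int]_d -> K) (l : nat).
Hypothesis phiP : is_order phi.
Hypothesis pl : prime l.
Local Notation O := (range phi).
Local Notation lO := (principal_ideal O (l%:R : K)).

Let idl : is_ideal O lO := principal_is_ideal phiP (On phiP l).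

Lemma frobenius_add1 a b : O a -> O b -> lO ((a + b) ^+ l - (a ^+ l + b ^+ l)).
Proof.
move=> Oa Ob; have l0 := prime_gt0 pl.
rewrite exprDn (bigD1 ord0)//= (bigD1 ord_max) /=; last by rewrite -val_eqE /= -lt0n.
rewrite subn0 subnn !expr0 mul1r mulr1 bin0 binn !mulr1n.
set S := \sum_(_ < _ | _) _.
have -> : a ^+ l + (b ^+ l + S) - (a ^+ l + b ^+ l) = S by ring.
apply: subgroup_sum => [|i /andP[i0 il]]; first exact: (ideal_subgroup phiP idl).
have /dvdnP[c ->] : (l %| 'C(l, i))%N.
  apply: prime_dvd_bin => //; rewrite -!val_eqE /= in i0 il.
  by have := ltn_ord i; lia.
rewrite mulrnA; exists (a ^+ (l - i) * b ^+ i *+ c); last by rewrite mulr_natr.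
by apply: subgroupMn; [exact: (O_subgroup phiP)|apply: (OM phiP); apply: OX].
Qed.

Lemma frobenius_add s a b : O a -> O b ->
  lO ((a + b) ^+ (l ^ s) - (a ^+ (l ^ s) + b ^+ (l ^ s))).
Proof.
move=> Oa Ob; elim: s => [|s ih]; first by rewrite expn0 !expr1 subrr; case: idl.
have sl := ideal_subgroup phiP idl.
rewrite expnSr !exprM; set x := (a + b) ^+ _ in ih *; set y := a ^+ _ in ih *.
set z := b ^+ _ in ih *.
have Oy : O y by apply: OX. have Oz : O z by apply: OX.
have Ox : O x by apply: OX => //; apply: (OD phiP).
apply: (subgroup_trans sl _ (frobenius_add1 Oy Oz)).
have Oyz := OD phiP Oy Oz; have Od := OB phiP Ox Oyz.
have := frobenius_add1 Od Oyz; rewrite subrK => h.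
apply: (subgroup_trans sl h _); rewrite addrK.
have -> : (x - (y + z)) ^+ l = (x - (y + z)) ^+ l.-1 * (x - (y + z)).
  by rewrite -exprSr prednK// prime_gt0.
by apply: (idealM idl) => //; apply: OX.
Qed.

Lemma frobenius_sub s a b : O a -> O b ->
  lO ((a - b) ^+ (l ^ s) - (a ^+ (l ^ s) - b ^+ (l ^ s))).
Proof.
move=> Oa Ob; have := frobenius_add s (OB phiP Oa Ob) Ob; rewrite subrK => h.
set x := (a - b) ^+ _ in h *; set y := a ^+ _ in h *; set z := b ^+ _ in h *.
have -> : x - (y - z) = - (y - (x + z)) by ring.
exact: (subgroupN (ideal_subgroup phiP idl)).
Qed.

(** Together with the product case, this makes the elements fixed by the power map modulo [pi] a
    ring, so that only the generator [xi] has to be tested. *)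
Lemma frobenius_fixed_sub pi s a b : O pi -> principal_ideal O pi l%:R -> O a -> O b ->
  principal_ideal O pi (a ^+ (l ^ s) - a) -> principal_ideal O pi (b ^+ (l ^ s) - b) ->
  principal_ideal O pi ((a - b) ^+ (l ^ s) - (a - b)).
Proof.
move=> Opi lpi Oa Ob ha hb; have idpi := principal_is_ideal phiP Opi.
have h : principal_ideal O pi ((a - b) ^+ (l ^ s) - (a ^+ (l ^ s) - b ^+ (l ^ s))).
  by have [c Oc <-] := frobenius_sub s Oa Ob; apply: (idealM idpi).
apply: (subgroup_trans (ideal_subgroup phiP idpi) h).
set y := a ^+ _ in ha *; set z := b ^+ _ in hb *.
have -> : y - z - (a - b) = (y - a) - (z - b) by ring.
exact: (idealB phiP idpi).
Qed.

Lemma frobenius_fixed_mul pi s a b : O pi -> O a -> O b ->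
  principal_ideal O pi (a ^+ (l ^ s) - a) -> principal_ideal O pi (b ^+ (l ^ s) - b) ->
  principal_ideal O pi ((a * b) ^+ (l ^ s) - a * b).
Proof.
move=> Opi Oa Ob ha hb; have idpi := principal_is_ideal phiP Opi.
rewrite exprMn; set y := a ^+ _ in ha *; set z := b ^+ _ in hb *.
have Oz : O z by apply: OX.
have -> : y * z - a * b = z * (y - a) + a * (z - b) by ring.
by apply: (idealD idpi); apply: (idealM idpi).
Qed.

End FrobeniusModPrime.

(** * The ring generated by a primitive root of unity *)

Section CyclotomicOrder.
Variables (n : nat) (K : fieldExtType rat) (xi : K).
Hypothesis n0 : (0 < n)%N.
Hypothesis hxi : n.-primitive_root xi.
Hypothesis hK : <<1; xi>>%VS = {:K}%VS.
Local Notation pZtoK := (map_poly (intr : int -> K)).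
Local Notation pZtoQ := (map_poly (intr : int -> rat)).
Local Notation pQtoK := (map_poly (in_alg K)).
Local Notation A := (int_adjoin xi).
Local Notation d := (totient n).

Lemma pQtoK_int (p : {poly int}) : pQtoK (pZtoQ p) = pZtoK p.
Proof. by rewrite -map_poly_comp; apply: eq_map_poly => x; exact: rmorph_int. Qed.

(** [xi ^+ n = 1] makes [xi] a root of some ['Phi_j] with [j] dividing [n]; then [xi ^+ j = 1], and
    primitivity gives [j = n]. *)
Lemma Cyclotomic_root : root (pZtoK 'Phi_n) xi.
Proof.
have e m : (0 < m)%N -> xi ^+ m - 1 = \prod_(j <- divisors m) (pZtoK 'Phi_j).[xi].
  move=> m0; rewrite -horner_prod -rmorph_prod prod_Cyclotomic//.
  by rewrite rmorphB /= map_polyXn rmorph1 !hornerE.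
have : \prod_(j <- divisors n) (pZtoK 'Phi_j).[xi] == 0.
  by rewrite -e// (prim_expr_order hxi) subrr.
rewrite prodf_seq_eq0 => /hasP[j jn /= r0].
move: jn; rewrite -dvdn_divisors// => jn.
have j0 : (0 < j)%N by apply: dvdn_gt0 jn.
have : xi ^+ j == 1.
  rewrite -subr_eq0 e//; rewrite prodf_seq_eq0; apply/hasP; exists j => //.
  by rewrite -dvdn_divisors.
rewrite -(prim_order_dvd hxi) => nj.
by rewrite /root; have -> : n = j by apply/eqP; rewrite eqn_dvd nj.
Qed.

(** Irreducibility of the cyclotomic polynomial, known through [algC], is carried to the abstract
    field [K] by a gcd: that of [p] and ['Phi_n] vanishes at [xi], so it is not constant and has a
    root [w] in [algC], a primitive root whose minimal polynomial, of degree [d], divides [p]. *)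
Lemma small_rat_poly_root (p : {poly rat}) :
  (size p <= d)%N -> root (pQtoK p) xi -> p = 0.
Proof.
move=> sp rp; apply/eqP/negPn/negP => p0.
pose P := pZtoQ 'Phi_n; pose g := gcdp p P.
have g0 : g != 0 by rewrite gcdp_eq0 negb_and p0.
have rg : root (pQtoK g) xi.
  by rewrite gcdp_map root_gcd rp pQtoK_int Cyclotomic_root.
have sg : size g != 1%N.
  apply/negP => /size_poly1P[c c0 gE]; move: rg; rewrite gE map_polyC /root hornerC.
  by rewrite fmorph_eq0 (negPf c0).
have /closed_rootP[w hw] : size (map_poly (ratr : rat -> algC) g) != 1%N.
  by rewrite size_map_poly.
have rgw q : g %| q -> root (map_poly ratr q) w.
  by move=> gq; apply: root_dvdp hw; rewrite dvdp_map.
have [z pz] := C_prim_root_exists n0.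
have pw : n.-primitive_root w.
  rewrite -(root_cyclotomic pz) -(Cintr_Cyclotomic pz).
  have -> : map_poly intr 'Phi_n = map_poly (ratr : rat -> algC) P.
    by rewrite -map_poly_comp; apply: eq_map_poly => x /=; rewrite ratr_int.
  by apply: rgw; apply: dvdp_gcdr.
have [q [qE _ qdiv]] := minCpolyP w.
have : q %| p by rewrite -qdiv; apply: rgw; apply: dvdp_gcdl.
move=> /dvdp_leq-/(_ p0); rewrite -(size_map_poly (ratr : {rmorphism rat -> algC}) q) -qE.
by rewrite (minCpoly_cyclotomic pw) size_cyclotomic leqNgt ltnS sp.
Qed.

Definition cyclotomic_vector (v : 'rV[int]_d) : K := \sum_(i < d) (v 0 i)%:~R * xi ^+ i.
Local Notation phi := cyclotomic_vector.

Lemma vectorE v : phi v = (pZtoK (rVpoly v)).[xi].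
Proof.
rewrite (horner_coef_wide _ (n := d)); last first.
  by apply: leq_trans (size_poly _ _) _; apply: size_poly.
by apply: eq_bigr => i _; rewrite coef_map /= coef_rVpoly_ord.
Qed.

Lemma range_vector : range phi = A.
Proof.
apply/seteqP; split => [_ [v _ <-]|_ [p _ <-]].
  by exists (rVpoly v) => //; rewrite vectorE.
pose r := Pdiv.Ring.rmodp p 'Phi_n; have mP := Cyclotomic_monic n.
exists (poly_rV r) => //; rewrite vectorE poly_rV_K; last first.
  by rewrite -ltnS -size_Cyclotomic /r Pdiv.Ring.ltn_rmodp monic_neq0.
rewrite [in RHS](Pdiv.RingMonic.rdivp_eq mP p) rmorphD rmorphM /= hornerD hornerM.
by rewrite (eqP Cyclotomic_root) mulr0 add0r.
Qed.

Lemma vector_order : is_order phi.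
Proof.
have hB u v : phi (u - v) = phi u - phi v.
  by rewrite -sumrB; apply: eq_bigr => i _; rewrite !mxE rmorphB /= mulrBl.
split => //.
- move=> u v e; apply/eqP; rewrite -subr_eq0; apply/eqP.
  have r0 : root (pQtoK (pZtoQ (rVpoly (u - v)))) xi.
    by rewrite pQtoK_int /root -vectorE hB e subrr.
  have : pZtoQ (rVpoly (u - v)) = 0.
    apply: small_rat_poly_root r0; apply: leq_trans (size_poly _ _) _; exact: size_poly.
  rewrite -(map_poly0 (intr : int -> rat)) => /(map_inj_poly (@intr_inj rat) erefl) h.
  by rewrite -[u - v]rVpolyK h linear0.
- have : A 1 by exists 1 => //; rewrite rmorph1 hornerC.
  by rewrite -range_vector => -[u _ <-]; exists u.
- move=> u v; have : A (phi u * phi v).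
    by exists (rVpoly u * rVpoly v) => //; rewrite rmorphM hornerM -!vectorE.
  by rewrite -range_vector => -[w _ <-]; exists w.
- move=> x; have : x \in <<1; xi>>%VS by rewrite hK memvf.
  move=> /Fadjoin_polyP[p /polyOver1P[q ->] ->].
  have [z [a a0 ->]] := rat_poly_scale q.
  have e : (pQtoK (a%:~R^-1 *: pZtoQ z)).[xi] *~ a = (pZtoK z).[xi].
    rewrite map_polyZ hornerZ pQtoK_int mulr_algl -scaler_int scalerA.
    by rewrite mulfV ?intr_eq0// scale1r.
  have [v _ vE] : range phi (pZtoK z).[xi] by rewrite range_vector; exists z.
  case: a a0 e => m m0 e; first by exists m, v; split; [rewrite lt0n|rewrite vE -e].
  have h0 : phi 0 = 0 by rewrite -(subrr 0) hB subrr.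
  by exists m.+1, (- v); split => //; rewrite -[- v]sub0r hB vE -e NegzE mulrNz opprK h0 add0r.
Qed.

Let phiP := vector_order.
Local Notation O := (range phi).
Local Notation idl := (principal_ideal O).

Lemma xi_in : O xi.
Proof. by rewrite range_vector; exists 'X => //; rewrite map_polyX hornerX. Qed.

Lemma int_in (m : int) : O m%:~R.
Proof. by apply: subgroupMz; [exact: (O_subgroup phiP)|exact: (O1 phiP)]. Qed.

Lemma order_ind (T : K -> Prop) : T 1 -> T xi ->
  (forall x y, O x -> O y -> T x -> T y -> T (x - y)) ->
  (forall x y, O x -> O y -> T x -> T y -> T (x * y)) -> forall x, O x -> T x.
Proof.
move=> T1 Tx TB TM x; rewrite range_vector => -[p _ <-].
have T0 : T 0 by rewrite -(subrr 1); apply: (TB) => //; exact: (O1 phiP).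
have TD a b : O a -> O b -> T a -> T b -> T (a + b).
  move=> Oa Ob Ta Tb; rewrite -[b]opprK; apply: (TB) => //; first exact: (ON phiP).
  by rewrite -sub0r; apply: (TB) => //; exact: (O_subgroup phiP).1.
have Tn m : T m%:R.
  elim: m => [|m ih]; first by rewrite mulr0n.
  by rewrite -natr1; apply: (TD) => //; [exact: (On phiP)|exact: (O1 phiP)].
have Tz (m : int) : T m%:~R.
  case: m => m; first exact: Tn.
  rewrite NegzE mulrNz -sub0r.
  by apply: (TB); [exact: (O_subgroup phiP).1|exact: (On phiP m.+1)|exact: T0|exact: (Tn m.+1)].
suff [] : O (pZtoK p).[xi] /\ T (pZtoK p).[xi] by [].
elim/poly_ind: p => [|p c [Op Tp]]; first by rewrite rmorph0 horner0; split => //; exact: (O_subgroup phiP).1.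
rewrite rmorphD rmorphM /= map_polyX map_polyC /= hornerD hornerMX hornerC.
have Ox := xi_in; split; first by apply: (OD phiP); [exact: (OM phiP)|exact: int_in].
by apply: TD; [exact: (OM phiP)|exact: int_in|exact: TM|exact: Tz].
Qed.

Lemma frobenius_data l pi s : prime l -> (0 < s)%N -> O pi -> idl pi l%:R ->
  idl pi (xi ^+ (l ^ s) - xi) -> (1 < l ^ s)%N /\ forall y, O y -> idl pi (y ^+ (l ^ s) - y).
Proof.
move=> pl s0 Opi lpi hx; split.
  by rewrite -(exp1n s) ltn_exp2r// prime_gt1.
have idpi := principal_is_ideal phiP Opi.
apply: order_ind => //; first by rewrite expr1n subrr; case: idpi.
- by move=> x y Ox Oy; apply: (frobenius_fixed_sub phiP pl).
- by move=> x y Ox Oy; apply: (frobenius_fixed_mul phiP).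
Qed.

(* [pi] is [l] if [l] does not divide [n]; otherwise it is [1 - xi ^+ m], where
   [m] is the part of [n] prime to [l]. *)
Lemma prime_data l : prime l -> exists pi q E,
  [/\ O pi, pi != 0 & (1 < q)%N] /\
  [/\ forall y, O y -> idl pi (y ^+ q - y), idl pi l%:R & idl l%:R (pi ^+ E)].
Proof.
move=> pl; have l0 := prime_gt0 pl; have l1 := prime_gt1 pl.
have Ol : O l%:R := On phiP l.
have self x : O x -> idl x x by move=> Ox; exists 1; rewrite ?mul1r//; apply: (O1 phiP).
have [ln|ln] := boolP (l %| n)%N; last first.
  have cop : coprime l n by rewrite prime_coprime.
  (* [l ^ d] is 1 modulo [n] by Euler's theorem, so this power map fixes [xi]. *)
  exists l%:R, (l ^ d)%N, 1%N.
  have dd : (0 < d)%N by rewrite totient_gt0.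
  have [|q1 hfrob] := @frobenius_data l l%:R d pl dd Ol (self _ Ol).
    have -> : xi ^+ (l ^ d) = xi.
      rewrite -(expr_mod (l ^ d) (prim_expr_order hxi)) (cyclic.Euler_exp_totient cop).
      by rewrite (expr_mod _ (prim_expr_order hxi)) expr1.
    by rewrite subrr; case: (principal_is_ideal phiP Ol).
  by split; split => //; rewrite ?expr1; [exact: (natr_order_neq0 phiP)|exact: self|exact: self].
pose a := logn l n; pose m := (n %/ l ^ a)%N.
have nE : n = (m * l ^ a)%N by rewrite divnK// pfactor_dvdnn.
have a0 : (0 < a)%N by rewrite logn_gt0 mem_primes pl n0.
have m0 : (0 < m)%N by rewrite lt0n; apply: contraTneq n0 => e; rewrite nE e.
have cop : coprime l m.
  rewrite prime_coprime//; apply/negP => lm.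
  have : (l ^ a.+1 %| n)%N by rewrite nE expnS dvdn_mul.
  by rewrite pfactor_dvdn// ltnn.
pose zeta := xi ^+ m; pose pi := 1 - zeta.
have Oz : O zeta by apply: (OX phiP); exact: xi_in.
have Opi : O pi by apply: (OB phiP) => //; exact: (O1 phiP).
have idpi := principal_is_ideal phiP Opi.
have za : zeta ^+ (l ^ a) = 1 by rewrite /zeta -exprM -nE (prim_expr_order hxi).
have zj j : idl pi (1 - zeta ^+ j).
  elim: j => [|j ih]; first by rewrite expr0 subrr; case: idpi.
  have -> : 1 - zeta ^+ j.+1 = zeta * (1 - zeta ^+ j) + pi by rewrite /pi exprS; ring.
  by apply: (idealD idpi); [apply: (idealM idpi)|exact: self].
have pi0 : pi != 0.
  rewrite subr_eq0 eq_sym -(prim_order_dvd hxi); apply/negP => /dvdn_leq -/(_ m0).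
  rewrite leqNgt => /negP; apply; rewrite {1}nE.
  by rewrite -[X in (X < _)%N]muln1 ltn_pmul2l// -(exp1n a) ltn_exp2r.
(* [z'] is an [l]-th root of unity other than 1, so its powers sum to 0, and [l] is the sum of the
   [1 - z' ^+ i], all multiples of [pi]. *)
have lpi : idl pi l%:R.
  pose z' := zeta ^+ (l ^ a.-1).
  have z'1 : z' != 1.
    rewrite /z' /zeta -exprM -(prim_order_dvd hxi); apply/negP => /dvdn_leq.
    rewrite muln_gt0 m0 expn_gt0 l0 => /(_ isT); rewrite leqNgt => /negP; apply.
    by rewrite {1}nE ltn_pmul2l// ltn_exp2l// ltn_predL.
  have z'l : z' ^+ l = 1 by rewrite /z' -exprM -expnSr prednK.
  have s0 : \sum_(i < l) z' ^+ i = 0.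
    have := subrX1 z' l; rewrite z'l subrr => /esym/eqP; rewrite mulf_eq0 subr_eq0.
    by rewrite (negPf z'1) => /eqP.
  have -> : l%:R = \sum_(i < l) (1 - z' ^+ i).
    by rewrite sumrB s0 subr0 sumr_const card_ord.
  apply: subgroup_sum => [|i _]; first exact: (ideal_subgroup phiP idpi).
  by rewrite /z' -exprM.
pose s := totient m.
(* As [l ^ s = 1 + m * j] for some [j], the power map sends [xi] to [xi * zeta ^+ j], and [zeta] is
   1 modulo [pi]. *)
have hx : idl pi (xi ^+ (l ^ s) - xi).
  have : (l ^ s = 1 %[mod m])%N by apply: cyclic.Euler_exp_totient.
  have ls : (0 < l ^ s)%N by rewrite expn_gt0 l0.
  move/eqP; rewrite eqn_mod_dvd// => /dvdnP[j lsE].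
  have -> : (l ^ s = 1 + m * j)%N by rewrite mulnC -lsE subnKC.
  rewrite exprD expr1 exprM -/zeta.
  have -> : xi * zeta ^+ j - xi = - xi * (1 - zeta ^+ j) by ring.
  by apply: (idealM idpi); [apply: (ON phiP); exact: xi_in|exact: zj].
have s0 : (0 < s)%N by rewrite totient_gt0.
have [q1 hfrob] := frobenius_data pl s0 Opi lpi hx.
exists pi, (l ^ s)%N, (l ^ a)%N; split; split => //.
(* Modulo [l], [(1 - zeta) ^+ (l ^ a)] is [1 - zeta ^+ (l ^ a)], which vanishes. *)
have := frobenius_sub phiP pl a (O1 phiP) Oz.
by rewrite expr1n za subrr subr0.
Qed.

(** A nonzero prime contains a positive integer, hence a rational prime [l], hence a power of the
    [pi] attached to [l], hence [pi] itself; then [reduced_prime_invertible] applies. *)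
Lemma vector_dedekind : is_dedekind phi.
Proof.
split; first exact: phiP; move=> P pP P0; have [idP PO primeP] := pP.
have [m m0 Pm] := integer_in_ideal phiP (conj idP P0).
have P1 : ~ P 1 by move=> /(ideal1 idP).
have [l pl Pl] : exists2 l, prime l & P l%:R.
  elim/ltn_ind: m => m ih in m0 Pm *.
  have [m1|m1] := leqP m 1.
    by have m_1 : m = 1%N by [lia|]; rewrite m_1 in Pm.
  have pm := pdiv_prime m1; have dm := pdiv_dvd m.
  move: Pm; rewrite -{1}(divnK dm) natrM => /(primeP _ _ (On phiP _) (On phiP _)).
  case=> Pm'; last by exists (pdiv m).
  apply: (ih (m %/ pdiv m)%N) => //; first by rewrite ltn_Pdiv// prime_gt1.
  by rewrite divn_gt0 ?prime_gt0// dvdn_leq.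
have [pi [q [E [[Opi pi0 q1] [hfrob lpi piE]]]]] := prime_data pl.
apply: (reduced_prime_invertible phiP Opi pi0 q1 hfrob pP).
have : P (pi ^+ E) by have [c Oc <-] := piE; apply: (idealM idP).
elim: E {piE} => [|E ih]; first by rewrite expr0.
rewrite exprS => /primeP; case=> //; exact: (OX phiP).
Qed.

Lemma order_integral x : O x -> integralOver (intr : int -> K) x.
Proof.
move: x; apply: order_ind.
- exact: integral1.
- exists 'Phi_n; [exact: Cyclotomic_monic|exact: Cyclotomic_root].
- by move=> x y _ _; apply: integral_sub.
- by move=> x y _ _; apply: integral_mul.
Qed.

(** An integral [x] has a multiple [x *+ m] in [O]. The prime factors [l] of [m] are removed one at
    a time: [l] divides a power of [pi], and [reduced_integral] strips the factors [pi]. So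
    [dedekind_zeta] and [kfree_points] refer to the same ring. *)
Lemma int_adjoin_integral : @ring_of_integers K = A.
Proof.
apply/seteqP; split => x; last by rewrite -range_vector; apply: order_integral.
rewrite /ring_of_integers /= => ix; rewrite -range_vector.
have [m [v [m0 mx]]] := order_frac phiP x.
have : O (x *+ m) by exists v.
elim/ltn_ind: m => m ih in m0 {mx} *; move=> Omx.
have [m1|m1] := leqP m 1.
  by have m_1 : m = 1%N by [lia|]; rewrite m_1 mulr1n in Omx.
have pm := pdiv_prime m1; have dm := pdiv_dvd m; set l := pdiv m in pm dm.
have lm : (0 < m %/ l)%N by rewrite divn_gt0 ?prime_gt0// dvdn_leq.
apply: (ih (m %/ l)%N _ lm); first by rewrite ltn_Pdiv// prime_gt1.
pose y := x *+ (m %/ l).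
have iy : integralOver (intr : int -> K) y.
  by rewrite /y -mulr_natr; apply: integral_mul => //; apply: integral_nat.
have Oly : O (l%:R * y) by rewrite /y mulr_natl -mulrnA divnK.
have [pi [q [E [[Opi pi0 q1] [hfrob lpi piE]]]]] := prime_data pm.
have ipi := order_integral Opi.
have : O (pi ^+ E * y) by have [c Oc <-] := piE; rewrite -mulrA; apply: (OM phiP).
elim: E {piE} => [|e ihe]; first by rewrite expr0 mul1r.
rewrite exprS -mulrA => h; apply: ihe.
apply: (reduced_integral phiP Opi pi0 q1 hfrob _ h); apply: integral_mul => //.
elim: (e) => [|e' ihe']; first by rewrite expr0; apply: integral1.
by rewrite exprS; apply: integral_mul.
Qed.

End CyclotomicOrder.

Lemma dedekind_zetaE (R : realType) (K : fieldExtType rat) (d k : nat)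
    (phi : 'rV[int]_d -> K) (z : R) :
  is_dedekind phi -> range phi = @ring_of_integers K ->
  is_sum (norm_weight R phi k) (nonzero_ideal (range phi)) z ->
  dedekind_zeta K (k%:R : R) = z.
Proof.
move=> phiD OK hz; rewrite /dedekind_zeta -OK.
have -> : (\esum_(I in nonzero_ideal (range phi))
    ((ideal_norm (range phi) I)%:R `^ (- k%:R))%:E)%E =
    (\esum_(I in nonzero_ideal (range phi)) (norm_weight R phi k I)%:E)%E.
  by apply: eq_esum => I _; rewrite powRN powR_mulrn.
by rewrite (is_sum_esum hz).
Qed.

Theorem proposition3p4 (R : realType) (n k d : nat)
    (K : fieldExtType rat) (xi : K)
    (hn : (2 < n)%N) (hn4 : (n %% 4 != 2)%N)
    (hxi : n.-primitive_root xi) (hK : <<1; xi>>%VS = {:K}%VS)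
    (hd : d = totient n) (hk : (2 <= k)%N) :
  let V := kfree_points xi d k in
  [/\ cvg (patch_rate V r @[r --> (+oo : set_system R)]),
      topological_entropy R (hull V) (@translate d) =
        (patch_entropy R V)%:E
    & patch_entropy R V = ln 2 / dedekind_zeta K (k%:R : R)].
Proof.
have n0 : (0 < n)%N by apply: leq_trans hn.
subst d => V.
have phiD := vector_dedekind n0 hxi hK.
have phiA := range_vector n0 hxi.
have VE : V = kfree_vectors (@cyclotomic_vector n K xi) k.
  by rewrite /kfree_vectors phiA.
have [z hz z1] := zeta_sum R phiD hk.
have zE : dedekind_zeta K (k%:R : R) = z.
  by apply: (dedekind_zetaE phiD) => //; rewrite phiA (int_adjoin_integral n0 hxi hK).
have cv : patch_rate V r @[r --> (+oo : set_system R)] --> ln 2 / z.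
  by rewrite VE; apply: patch_rate_cvg.
have eE : patch_entropy R V = ln 2 / z by apply: cvg_lim.
split; first by apply/cvg_ex; exists (ln 2 / z).
  by rewrite eE VE; apply: topological_entropyE.
by rewrite eE zE.
Qed.
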